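(* Let $c,\gamma_1,\gamma_2>0$ be such that $\gamma:=\left(\frac1{\gamma_1}+\frac2{\gamma_2}\right)^{-1}<1$, and let $c'>0$. There exist constants $C_1,C_2>0$ depending only on $c',\gamma_1,\gamma_2,c$ such that the following holds. Let $(X_t,Y_t)_t$, with $X_t\in\mathbb{R}^p$, $Y_t\in\mathbb{R}^q$, be a strictly stationary, mean-zero process whose $\beta$-mixing coefficients satisfy $\beta(n)\le2\exp(-c\,n^{\gamma_1})$ for all $n\in\mathbb{N}$, and suppose that for all $t$ the vectors $X_t$ and $Y_t$ are subweibull($\gamma_2$) with $\|X_t\|_{\psi_{\gamma_2}}\le K_X$ and $\|Y_t\|_{\psi_{\gamma_2}}\le K_Y$. Suppose $\Theta^\star$ is $s$-sparse. Let $$K:=2^{2/\gamma_2}\big(K_Y+K_X(1+|||\Theta^\star|||)\big)^2 .$$ Then for sample size $T\ge C_1(\log(pq))^{\frac2\gamma-1}$, $$\mathbb{P}\left(\frac1T|||\mathbf{X}'\mathbf{W}|||_\infty>C_2K\sqrt{\frac{\log(pq)}{T}}\right)\le2\exp(-c'\log(pq)).$$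
   Context: Data matrices: $\mathbf{Y}=(Y_1,\dots,Y_T)'\in\mathbb{R}^{T\times q}$, $\mathbf{X}=(X_1,\dots,X_T)'\in\mathbb{R}^{T\times p}$. Prime denotes transpose. Target: $\Theta^\star=\arg\min_{\Theta\in\mathbb{R}^{p\times q}}\mathbb{E}\|Y_t-\Theta'X_t\|_2^2$ (independent of $t$ by stationarity); it is $s$-sparse if it has exactly $s$ nonzero entries. Residuals: $\mathbf{W}=\mathbf{Y}-\mathbf{X}\Theta^\star$. $|||\cdot|||$ is the operator (spectral) norm; $|||\mathbf{M}|||_\infty=\max_{i,j}|\mathbf{M}_{ij}|$. Subweibull: for a real random variable $U$ and $\gamma>0$, $\|U\|_{\psi_\gamma}=\sup_{r\ge1}(\mathbb{E}|U|^r)^{1/r}r^{-1/\gamma}$, and $U$ is subweibull($\gamma$) if this is finite. For a random vector $V\in\mathbb{R}^m$, $\|V\|_{\psi_\gamma}=\sup_{\|v\|_2=1}\|v'V\|_{\psi_\gamma}$; $V$ is subweibull($\gamma$) if all its one-dimensional projections are. $\beta$-mixing: for random elements $U,V$, $\beta(U,V)=\sup\frac12\sum_{i=1}^I\sum_{j=1}^J|P(A_i\cap B_j)-P(A_i)P(B_j)|$, the supremum over pairs of finite partitions $\{A_i\}$, $\{B_j\}$ of the sample space with $A_i\in\sigma(U)$, $B_j\in\sigma(V)$. For a stationary process $(Z_t)$ (extended to index set $\mathbb{Z}$), $\beta(l)=\beta(Z_{-\infty:t},Z_{t+l:\infty})$, $l\ge1$. Here $Z_t=(X_t,Y_t)$.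 *)

(* Defs.v *)
From HB Require Import structures.
From mathcomp Require Import all_boot all_order all_algebra.
From mathcomp Require Import all_classical all_reals all_analysis.
Set Implicit Arguments.
Unset Strict Implicit.
Unset Printing Implicit Defensive.
Import Order.TTheory GRing.Theory Num.Theory.
Import numFieldNormedType.Exports.
Local Open Scope classical_set_scope.
Local Open Scope ring_scope.

Section linear_algebra.
Context {R : realType}.

Definition l2norm n (v : 'cV[R]_n) : R := Num.sqrt (\sum_i v i 0 ^+ 2).

(* A real supremum: the set is nonempty only when n > 0. *)
Definition opnorm m n (A : 'M[R]_(m, n)) : R :=
  sup [set l2norm (A *m v) | v in [set v : 'cV[R]_n | l2norm v = 1]].

Definition sparse m n (s : nat) (A : 'M[R]_(m, n)) : Prop :=
  #|[pred ij : 'I_m * 'I_n | A ij.1 ij.2 != 0]| = s.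

(* The product sigma-algebra on R^(m x n), i.e. the Borel one. *)
Definition mx_borel m n : set_system 'M[R]_(m, n) :=
  <<s \bigcup_(ij in [set: 'I_m * 'I_n])
        preimage_set_system setT (fun A : 'M[R]_(m, n) => A ij.1 ij.2)
          measurable >>.

End linear_algebra.

Section random_vectors.
Context {R : realType} d (Omega : measurableType d) (P : probability Omega R).

Definition random_vector m (V : Omega -> 'cV[R]_m) : Prop :=
  forall B, mx_borel B -> measurable (V @^-1` B).

Definition mean_zero m (V : Omega -> 'cV[R]_m) : Prop :=
  forall i, ('E_P[fun w => V w i 0%R] = 0)%E.

Definition psi_norm (gamma : R) (U : Omega -> R) : \bar R :=
  ereal_sup [set (Lnorm P r%:E (EFin \o U) * (r `^ (- gamma^-1))%:E)%E
            | r in [set r : R | 1 <= r]].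

Definition proj m (v : 'cV[R]_m) (V : Omega -> 'cV[R]_m) : Omega -> R :=
  fun w => (v^T *m V w) 0 0.

Definition psi_vnorm m (gamma : R) (V : Omega -> 'cV[R]_m) : \bar R :=
  ereal_sup [set psi_norm gamma (proj v V)
            | v in [set v : 'cV[R]_m | l2norm v = 1]].

Definition subweibull (gamma : R) (U : Omega -> R) : Prop :=
  (psi_norm gamma U < +oo)%E.

Definition subweibull_vec m (gamma : R) (V : Omega -> 'cV[R]_m) : Prop :=
  forall v : 'cV[R]_m, subweibull gamma (proj v V).

(* The coefficient beta(U, V), as a function of F = sigma(U), G = sigma(V). *)
Definition beta_dep (F G : set_system Omega) : \bar R :=
  ereal_sup [set x : \bar R |
    exists (I J : nat) (A : 'I_I -> set Omega) (B : 'I_J -> set Omega),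
      [/\ partition setT A setT, partition setT B setT,
          forall i, F (A i), forall j, G (B j)
        & x = ((2^-1)%:E * \sum_(i < I) \sum_(j < J)
                 `|P (A i `&` B j) - P (A i) * P (B j)|)%E]].

End random_vectors.

Section processes.
Context {R : realType} d (Omega : measurableType d) (P : probability Omega R).

Definition sigma_process m (Z : int -> Omega -> 'cV[R]_m) (S : set int) :
    set_system Omega :=
  <<s \bigcup_(t in S) preimage_set_system setT (Z t) (@mx_borel R m 1) >>.

(* beta(Z_{-oo:t}, Z_{t+l:oo}); independent of t when Z is stationary. *)
Definition beta_mixing m (Z : int -> Omega -> 'cV[R]_m) (t : int) (l : nat) :
    \bar R :=
  beta_dep P (sigma_process Z [set s | s <= t])
             (sigma_process Z [set s | t + l%:Z <= s]).

(* Column j of the m x k matrix window Z tau w is Z_(tau j). *)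
Definition window m k (Z : int -> Omega -> 'cV[R]_m) (tau : 'I_k -> int) :
    Omega -> 'M[R]_(m, k) :=
  fun w => \matrix_(i < m, j < k) Z (tau j) w i 0.

Definition strictly_stationary m (Z : int -> Omega -> 'cV[R]_m) : Prop :=
  forall (h : int) k (tau : 'I_k -> int) (B : set 'M[R]_(m, k)), mx_borel B ->
    P (window Z (fun j => tau j + h) @^-1` B) = P (window Z tau @^-1` B).

Definition joint p q (X : int -> Omega -> 'cV[R]_p)
    (Y : int -> Omega -> 'cV[R]_q) : int -> Omega -> 'cV[R]_(p + q) :=
  fun t w => col_mx (X t w) (Y t w).

Definition risk p q (X : int -> Omega -> 'cV[R]_p)
    (Y : int -> Omega -> 'cV[R]_q) (t : int) (Theta : 'M[R]_(p, q)) : \bar R :=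
  'E_P[fun w => l2norm (Y t w - Theta^T *m X t w) ^+ 2].

(* The minimizer need not be unique; under stationarity the risk, hence the
   set of minimizers, does not depend on t. *)
Definition is_target p q (X : int -> Omega -> 'cV[R]_p)
    (Y : int -> Omega -> 'cV[R]_q) (Theta : 'M[R]_(p, q)) : Prop :=
  forall (t : int) (Theta' : 'M[R]_(p, q)),
    (risk X Y t Theta <= risk X Y t Theta')%E.

(* The rows are the observations at times 1, ..., T. *)
Definition data_mx m (Z : int -> Omega -> 'cV[R]_m) (T : nat) (w : Omega) :
    'M[R]_(T, m) :=
  \matrix_(i < T, j < m) Z (i.+1)%:Z w j 0.

Definition residuals p q (X : int -> Omega -> 'cV[R]_p)
    (Y : int -> Omega -> 'cV[R]_q) (Theta : 'M[R]_(p, q)) (T : nat)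
    (w : Omega) : 'M[R]_(T, q) :=
  data_mx Y T w - data_mx X T w *m Theta.

End processes.

(* Main.v *)
Require Import Defs.
From HB Require Import structures.
From mathcomp Require Import all_boot all_order all_algebra.
From mathcomp Require Import all_classical all_reals all_analysis.
From mathcomp Require Import measurable_realfun zify ring lra.
Set Implicit Arguments.
Unset Strict Implicit.
Unset Printing Implicit Defensive.
Import Order.TTheory GRing.Theory Num.Theory.
Import numFieldNormedType.Exports.
Local Open Scope classical_set_scope.
Local Open Scope ring_scope.

(** The entry (i, j) of X'W is the sum over t of the products X_ti W_tj.
Each product has mean zero: the risk is a quadratic polynomial in every entry
of the coefficient matrix, and its derivative vanishes at a minimizer
(target_orthogonal). After division by K, or by the smaller
KX (KY + KX (1 + |||Theta|||)), each product has an exponential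
moment of order a = gamma2 / 2 bounded by a constant (product_exp_moment).
A union bound over the 2pq signed entries therefore reduces the theorem to a
deviation inequality for real variables (mixing_tail): with
1/gamma = 1/gamma1 + 1/a and T >= C1 L^(2/gamma - 1),
P(U_1 + ... + U_T > C2 sqrt(L T)) <= exp(- c2 L). Of absolute regularity only
partitions into two sets are used, that is, strong mixing (beta_dep_alpha).

The proof of mixing_tail works at the level l = L + ln T, so that a union
bound over t is free. The variables are truncated at M = (K1 l)^(1/a), which
changes the sum with negligible probability and introduces a negligible bias
(tail_prob, cutoff_bias). Time is cut into blocks whose length is proportional
to B = K2 l^(1/gamma1); a gap of one block then has a mixing coefficient below
any prescribed power of exp(- l).

Within a block, E exp(lam S_n) <= exp(C lam^2 n) for
lam <= const * l^(1 - 1/gamma), without any logarithmic loss. This is the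
heart of the matter (mgf_mixing). A sum of n terms is split into two halves
and a gap of length about n (n/B)^h between them. The gap is separated from the
halves by Hoelder's inequality with exponents close to 1 and to infinity, and
the halves from each other by a covariance inequality. The losses are summable
over the dyadic lengths (gap_schedule). The covariance error is controlled as
long as exp(4 lam n |V|), the value for n equal variables, has a mean of at
most exp of a small multiple of the mixing rate of the gap. That a single large
variable repeated n times is affordable is where gamma < 1 enters
(exponent_bound).

Across blocks, the even and the odd ones are separated by gaps. The product of
their exponentials is frozen once it exceeds the threshold of interest, so that
the covariance error of each step is proportional to the threshold and
Markov's inequality loses nothing (capped_tail). Finally lam = sqrt(L / T) is
the optimal parameter, and it is admissible exactly when T is of the order of
L^(2/gamma - 1) (sample_size_dominates absorbs the logarithm of T in l).

Two degenerate cases remain: if pq = 1 the bound is trivial since ln 1 = 0,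
and if KX = 0 then X vanishes almost surely. *)

(** * Bounded random variables and their means *)
Section mean.
Context {R : realType} d (Omega : measurableType d) (P : probability Omega R).

(** Once the variables are truncated all functions are bounded, and
integrability never has to be checked. *)
Definition bmeas (f : Omega -> R) : Prop :=
  measurable_fun setT f /\ exists C, forall w, `|f w| <= C.

Definition mean (f : Omega -> R) : R := \int[P]_w f w.

Lemma bmeas_integrable f : bmeas f -> P.-integrable setT (EFin \o f).
Proof.
move=> [mf [C fC]]; apply: measurable_bounded_integrable => //.
  by rewrite (le_lt_trans (probability_le1 _ _)) ?ltry.
by exists C; split; [exact: num_real|move=> M CM w _; exact: le_trans (fC w) (ltW CM)].
Qed.

Lemma bmeas_cst a : bmeas (fun=> a).
Proof. by split; [exact: measurable_cst|exists `|a|]. Qed.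

Lemma eq_bmeas f g : bmeas f -> f =1 g -> bmeas g.
Proof. by move=> bf /funext <-. Qed.

Lemma bmeasD f g : bmeas f -> bmeas g -> bmeas (fun w => f w + g w).
Proof.
move=> [mf [C fC]] [mg [D gD]]; split; first exact: measurable_funD.
by exists (C + D) => w; rewrite (le_trans (ler_normD _ _))// lerD.
Qed.

Lemma bmeasM f g : bmeas f -> bmeas g -> bmeas (fun w => f w * g w).
Proof.
move=> [mf [C fC]] [mg [D gD]]; split; first exact: measurable_funM.
by exists (C * D) => w; rewrite normrM ler_pM.
Qed.

Lemma bmeasZ a f : bmeas f -> bmeas (fun w => a * f w).
Proof. by move=> bf; apply: bmeasM => //; exact: bmeas_cst. Qed.

Lemma bmeasN f : bmeas f -> bmeas (fun w => - f w).
Proof.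
by move=> /(bmeasZ (-1)) bf; rewrite (_ : (fun _ => _) = (fun w => -1 * f w))//;
  apply/funext => w; rewrite mulN1r.
Qed.

Lemma bmeasB f g : bmeas f -> bmeas g -> bmeas (fun w => f w - g w).
Proof. by move=> bf bg; apply: bmeasD => //; exact: bmeasN. Qed.

Lemma bmeasX f n : bmeas f -> bmeas (fun w => f w ^+ n).
Proof.
move=> bf; elim: n => [|n ih]; first exact: bmeas_cst.
rewrite (_ : (fun _ => _) = (fun w => f w * f w ^+ n)); first exact: bmeasM.
by apply/funext => w; rewrite exprS.
Qed.

Lemma bmeas_sum (I : Type) (r : seq I) (Q : pred I) (f : I -> Omega -> R) :
  (forall i, Q i -> bmeas (f i)) -> bmeas (fun w => \sum_(i <- r | Q i) f i w).
Proof.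
move=> bf; elim: r => [|i r ih].
  by apply: (eq_bmeas (bmeas_cst 0)) => w; rewrite big_nil.
suff bS : bmeas (fun w => (if Q i then f i w else 0) +
    \sum_(j <- r | Q j) f j w).
  apply: (eq_bmeas bS) => w; rewrite big_cons.
  by case: ifPn => // _; rewrite add0r.
apply: bmeasD => //; case: (boolP (Q i)) => Qi; [exact: bf|exact: bmeas_cst].
Qed.

Lemma bmeas_exp f : bmeas f -> bmeas (fun w => expR (f w)).
Proof.
move=> [mf [C fC]]; split.
  exact: (measurableT_comp (@measurable_expR R)).
exists (expR C) => w; rewrite ger0_norm ?expR_ge0// ler_expR.
exact: le_trans (ler_norm _) (fC w).
Qed.

Lemma bmeas_norm f : bmeas f -> bmeas (fun w => `|f w|).
Proof.
move=> [mf [C fC]]; split; first exact: measurableT_comp.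
by exists C => w; rewrite normr_id.
Qed.

Lemma bmeas_indic (A : set Omega) : measurable A -> bmeas (\1_A : Omega -> R).
Proof.
move=> mA; split; first exact: measurable_indic.
by exists 1 => w; rewrite indicE; case: (_ \in _); rewrite ?normr1 ?normr0.
Qed.

Lemma mean_cst a : mean (fun=> a) = a.
Proof.
have P1 : fine (P setT) = 1 by rewrite (@probability_setT _ _ _ P).
by rewrite /mean (Rintegral_cst P measurableT a) P1 mulr1.
Qed.

Lemma meanD f g : bmeas f -> bmeas g ->
  mean (fun w => f w + g w) = mean f + mean g.
Proof. by move=> bf bg; apply: RintegralD => //; exact: bmeas_integrable. Qed.

Lemma meanB f g : bmeas f -> bmeas g ->
  mean (fun w => f w - g w) = mean f - mean g.
Proof. by move=> bf bg; apply: RintegralB => //; exact: bmeas_integrable. Qed.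

Lemma meanZ a f : bmeas f -> mean (fun w => a * f w) = a * mean f.
Proof. by move=> bf; apply: RintegralZl => //; exact: bmeas_integrable. Qed.

Lemma mean_sum (I : Type) (r : seq I) (Q : pred I) (f : I -> Omega -> R) :
  (forall i, Q i -> bmeas (f i)) ->
  mean (fun w => \sum_(i <- r | Q i) f i w) = \sum_(i <- r | Q i) mean (f i).
Proof.
move=> bf; elim: r => [|i r ih].
  rewrite big_nil -[RHS](mean_cst 0); congr mean.
  by apply/funext => w; rewrite big_nil.
rewrite big_cons -ih; case: ifPn => Qi.
  rewrite -meanD; [|exact: bf|exact: bmeas_sum].
  by congr mean; apply/funext => w; rewrite big_cons Qi.
by congr mean; apply/funext => w; rewrite big_cons (negbTE Qi).
Qed.

Lemma le_mean f g : bmeas f -> bmeas g -> (forall w, f w <= g w) ->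
  mean f <= mean g.
Proof. by move=> bf bg fg; apply: le_Rintegral => //; exact: bmeas_integrable. Qed.

Lemma mean_ge0 f : (forall w, 0 <= f w) -> 0 <= mean f.
Proof. by move=> f0; exact: Rintegral_ge0. Qed.

Lemma ler_norm_mean f : bmeas f -> `|mean f| <= mean (fun w => `|f w|).
Proof. by move=> bf; apply: le_normr_Rintegral => //; exact: bmeas_integrable. Qed.

Lemma mean_indic (A : set Omega) : measurable A -> mean \1_A = fine (P A).
Proof. by move=> mA; rewrite /mean /Rintegral integral_indic// setIT. Qed.

Lemma mean_fin f : bmeas f -> (\int[P]_w (f w)%:E)%E = (mean f)%:E.
Proof.
by move=> bf; rewrite /mean /Rintegral fineK//; apply: integrable_fin_num => //;
  exact: bmeas_integrable.
Qed.

Lemma measurable_gt (f : Omega -> R) (y : R) : measurable_fun setT f ->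
  measurable [set w | y < f w].
Proof.
move=> mf; rewrite [X in measurable X](_ : _ = f @^-1` `]y, +oo[); last first.
  by apply/seteqP; split=> w' /=; rewrite in_itv/= andbT.
by rewrite -[X in measurable X]setTI; exact: mf.
Qed.

End mean.

Ltac bmeas_tac := repeat first [assumption | exact: bmeas_cst
  | exact: bmeas_indic | apply: bmeas_exp | apply: bmeas_norm | apply: bmeasX
  | apply: bmeasN | apply: bmeasM | apply: bmeasB | apply: bmeasD].

(** * Covariance inequalities under strong mixing *)
Section covariance.
Context {R : realType} d (Omega : measurableType d) (P : probability Omega R).
Implicit Types f g : Omega -> R.

(** A bound on the strong mixing coefficient of Rosenblatt for the pair of
sigma-algebras generated by f and g. *)
Definition mixed f g (al : R) : Prop := forall A B : set R,
  measurable A -> measurable B ->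
  `|fine (P (f @^-1` A `&` g @^-1` B))
    - fine (P (f @^-1` A)) * fine (P (g @^-1` B))| <= al.

Lemma mixed_comp (phi psi : R -> R) f g al :
  measurable_fun setT phi -> measurable_fun setT psi ->
  mixed f g al -> mixed (phi \o f) (psi \o g) al.
Proof.
move=> mphi mpsi fg A B mA mB; apply: (fg (phi @^-1` A) (psi @^-1` B)).
  by rewrite -[X in measurable X]setTI; exact: mphi.
by rewrite -[X in measurable X]setTI; exact: mpsi.
Qed.

Definition cov f g : R := mean P (fun w => f w * g w) - mean P f * mean P g.

Lemma covDl f1 f2 g : bmeas f1 -> bmeas f2 -> bmeas g ->
  cov (fun w => f1 w + f2 w) g = cov f1 g + cov f2 g.
Proof.
move=> b1 b2 bg; rewrite /cov meanD//.
rewrite (_ : (fun w => _) = (fun w => f1 w * g w + f2 w * g w)); last first.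
  by apply/funext => w; rewrite mulrDl.
by rewrite meanD; [ring|exact: bmeasM|exact: bmeasM].
Qed.

Lemma covZl a f g : bmeas f -> bmeas g ->
  cov (fun w => a * f w) g = a * cov f g.
Proof.
move=> bf bg; rewrite /cov meanZ//.
rewrite (_ : (fun w => _) = (fun w => a * (f w * g w))); last first.
  by apply/funext => w; rewrite mulrA.
by rewrite meanZ; [ring|exact: bmeasM].
Qed.

Lemma covC f g : cov f g = cov g f.
Proof.
by rewrite /cov mulrC; congr (mean P _ - _); apply/funext => w; rewrite mulrC.
Qed.

Lemma cov_cstl a g : bmeas g -> cov (fun=> a) g = 0.
Proof. by move=> bg; rewrite /cov meanZ// mean_cst subrr. Qed.

Lemma covDr f g1 g2 : bmeas f -> bmeas g1 -> bmeas g2 ->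
  cov f (fun w => g1 w + g2 w) = cov f g1 + cov f g2.
Proof. by move=> bf b1 b2; rewrite !(covC f) covDl. Qed.

Lemma covZr a f g : bmeas f -> bmeas g -> cov f (fun w => a * g w) = a * cov f g.
Proof. by move=> bf bg; rewrite !(covC f) covZl. Qed.

Lemma cov_suml n (F : 'I_n -> Omega -> R) g :
  (forall i, bmeas (F i)) -> bmeas g ->
  cov (fun w => \sum_i F i w) g = \sum_i cov (F i) g.
Proof.
move=> bF bg; rewrite /cov mean_sum// mulr_suml.
rewrite (_ : (fun w => _) = (fun w => \sum_i F i w * g w)); last first.
  by apply/funext => w; rewrite mulr_suml.
rewrite mean_sum; last by move=> i _; exact: bmeasM.
by rewrite -sumrB.
Qed.

Lemma cov_sumr n f (G : 'I_n -> Omega -> R) :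
  bmeas f -> (forall i, bmeas (G i)) ->
  cov f (fun w => \sum_i G i w) = \sum_i cov f (G i).
Proof.
by move=> bf bG; rewrite covC cov_suml//; apply: eq_bigr => i _; rewrite covC.
Qed.

Lemma staircase n (y : R) : 0 <= y ->
  let s := \sum_(i < n) (i.+1%:R <= y)%R%:R in
  (n%:R <= y -> s = n%:R) /\ (y < n%:R -> s <= y < s + 1).
Proof.
move=> y0; elim: n => [|n [ih1 ih2]] /=.
  by rewrite big_ord0; split=> // /(le_lt_trans y0); rewrite ltxx.
rewrite big_ord_recr /=; set s := \sum_(_ < _) _ in ih1 ih2 *.
have n1 : n.+1%:R = n%:R + 1 :> R by rewrite -natr1.
case: (lerP n.+1%:R y) => [ny|yn].
  by split=> //; rewrite ih1 ?n1//; rewrite n1 in ny; lra.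
split=> // _; rewrite addr0; case: (lerP n%:R y) => [ny|]; last exact: ih2.
by rewrite ih1// ny -n1.
Qed.

(** Discretised layer-cake formula: a function with values in [0, 1] is nearly
the average of the indicators of its superlevel sets at the levels k / n. *)
Definition stair n f : Omega -> R := fun w =>
  \sum_(i < n) n%:R^-1 * \1_(f @^-1` `[i.+1%:R / n%:R, +oo[) w.

Lemma stair_near n f w : (0 < n)%N -> 0 <= f w <= 1 ->
  0 <= stair n f w /\ stair n f w <= f w <= stair n f w + n%:R^-1.
Proof.
move=> n0 /andP[f0 f1].
have nR : 0 < n%:R :> R by rewrite ltr0n.
have y0 : 0 <= n%:R * f w by rewrite mulr_ge0// ltW.
have -> : stair n f w = n%:R^-1 * \sum_(i < n) (i.+1%:R <= n%:R * f w)%R%:R.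
  rewrite mulr_sumr; apply: eq_bigr => i _; congr (_ * _).
  rewrite indicE; congr (_ %:R); congr nat_of_bool.
  apply/idP/idP; rewrite inE /= in_itv/= andbT.
    by rewrite ler_pdivrMr// mulrC.
  by rewrite ler_pdivrMr// mulrC.
have [h1 h2] := staircase n y0.
set s := \sum_(_ < _) _ in h1 h2 *.
have s0 : 0 <= s by apply: sumr_ge0.
split; first by rewrite mulr_ge0// invr_ge0 ltW.
have fE : f w = n%:R^-1 * (n%:R * f w) by rewrite mulrA mulVf ?mul1r// gt_eqF.
suff : s <= n%:R * f w <= s + 1.
  move=> /andP[a b]; rewrite fE ler_pM2l ?invr_gt0// a/=.
  have -> : n%:R^-1 * s + n%:R^-1 = n%:R^-1 * (s + 1) :> R.
    by rewrite mulrDr mulr1.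
  by rewrite ler_pM2l ?invr_gt0.
case: (lerP n%:R (n%:R * f w)) => [ny|yn].
  rewrite h1// ny/= (@le_trans _ _ n%:R) ?lerDl//.
  by rewrite -{2}[n%:R]mulr1 ler_pM2l.
by have /andP[-> /ltW ->] := h2 yn.
Qed.

Lemma bmeas_stair n f : measurable_fun setT f -> bmeas (stair n f).
Proof.
move=> mf; apply: bmeas_sum => i _; apply: bmeasZ; apply: bmeas_indic.
by rewrite -[X in measurable X]setTI; apply: mf => //; exact: measurable_itv.
Qed.

(** Covariance is bilinear, and the covariance of the indicators of two
superlevel sets is one of the differences that mixing controls. *)
Lemma cov_stair n f g al : (0 < n)%N -> measurable_fun setT f ->
  measurable_fun setT g -> mixed f g al -> `|cov (stair n f) (stair n g)| <= al.
Proof.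
move=> n0 mf mg fg.
have mI (h : Omega -> R) (i : nat) : measurable_fun setT h ->
    measurable (h @^-1` `[i.+1%:R / n%:R, +oo[).
  move=> mh; rewrite -[X in measurable X]setTI.
  by apply: mh => //; exact: measurable_itv.
have bI (h : Omega -> R) (i : nat) : measurable_fun setT h ->
    bmeas (\1_(h @^-1` `[i.+1%:R / n%:R, +oo[) : Omega -> R).
  by move=> mh; apply: bmeas_indic; exact: mI.
have nR : 0 < n%:R :> R by rewrite ltr0n.
have ni : 0 < n%:R^-1 :> R by rewrite invr_gt0.
have sumc : \sum_(i < n) n%:R^-1 * al = al.
  rewrite sumr_const card_ord -(mulr_natl (n%:R^-1 * al)) mulrA mulfV ?mul1r//.
  by rewrite gt_eqF.
rewrite cov_suml; [|by move=> i; apply/bmeasZ/bI|exact: bmeas_stair].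
apply: (@le_trans _ _ (\sum_(i < n) n%:R^-1 * al)); last first.
  by rewrite sumc.
apply: (le_trans (ler_norm_sum _ _ _)); apply: ler_sum => i _.
rewrite covZl; [|exact: bI|exact: bmeas_stair].
rewrite normrM (gtr0_norm ni) ler_pM2l//.
rewrite cov_sumr; [|exact: bI|by move=> j; apply/bmeasZ/bI].
apply: (@le_trans _ _ (\sum_(j < n) n%:R^-1 * al)); last first.
  by rewrite sumc.
apply: (le_trans (ler_norm_sum _ _ _)); apply: ler_sum => j _.
rewrite covZr; [|exact: bI|exact: bI].
rewrite normrM (gtr0_norm ni) ler_pM2l//.
rewrite /cov -?indicI.
rewrite (_ : (fun w => _) = \1_(f @^-1` `[i.+1%:R / n%:R, +oo[ `&`
   g @^-1` `[j.+1%:R / n%:R, +oo[)); last by rewrite indicI.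
rewrite !mean_indic; [|exact: mI|exact: mI|by apply: measurableI; exact: mI].
by apply: fg; exact: measurable_itv.
Qed.

Lemma cov_le01 f g al : bmeas f -> bmeas g ->
  (forall w, 0 <= f w <= 1) -> (forall w, 0 <= g w <= 1) ->
  mixed f g al -> `|cov f g| <= al.
Proof.
move=> bf bg f01 g01 fg.
suff h n : (0 < n)%N -> `|cov f g| <= al + 4 / n%:R.
  apply/ler_addgt0Pr => e e0.
  have e4 : 0 < 4 / e by rewrite divr_gt0.
  have := archi_boundP (ltW e4).
  set n := Num.bound _ => en.
  have npos : (0 < n)%N by rewrite -(@ltr0n R); exact: lt_trans en.
  apply: (le_trans (h n npos)); rewrite lerD2l ler_pdivrMr ?ltr0n//.
  by rewrite mulrC -ler_pdivrMr// ltW.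
move=> n0; have nR : 0 < n%:R :> R by rewrite ltr0n.
set e := n%:R^-1; have e0 : 0 < e by rewrite invr_gt0.
pose f' := stair n f; pose g' := stair n g.
have bf' : bmeas f' by apply: bmeas_stair; exact: bf.1.
have bg' : bmeas g' by apply: bmeas_stair; exact: bg.1.
have nf w := stair_near n0 (f01 w); have ng w := stair_near n0 (g01 w).
have c1 : `|mean P (fun w => f w * g w) - mean P (fun w => f' w * g' w)| <= 2 * e.
  rewrite -meanB; [|exact: bmeasM|exact: bmeasM].
  apply: (le_trans (ler_norm_mean _ _)).
    by apply: bmeasB; exact: bmeasM.
  rewrite -[leRHS](mean_cst P); apply: le_mean; last 1 first.
  - move=> w; have [f0 /andP[fl fu]] := nf w; have [g0 /andP[gl gu]] := ng w.
    have /andP[f1 f2] := f01 w; have /andP[g1 g2] := g01 w.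
    rewrite -/(f' w) -/(g' w) -/e in f0 fl fu g0 gl gu *.
    by rewrite ger0_norm ?subr_ge0; [nra|exact: ler_pM].
  - by apply/bmeas_norm/bmeasB; exact: bmeasM.
  - exact: bmeas_cst.
have cm h : bmeas h -> (forall w, 0 <= h w <= 1) ->
    [/\ 0 <= mean P (stair n h), mean P (stair n h) <= mean P h,
        mean P h <= mean P (stair n h) + e & mean P h <= 1].
  move=> bh h01.
  have bs : bmeas (stair n h) by apply: bmeas_stair; exact: bh.1.
  have nh w := stair_near n0 (h01 w).
  split.
  - by apply: mean_ge0 => w; case: (nh w).
  - by apply: le_mean => // w; have [_ /andP[]] := nh w.
  - rewrite -[e](mean_cst P) -meanD//; last exact: bmeas_cst.
    apply: le_mean => //; first by apply: bmeasD => //; exact: bmeas_cst.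
    by move=> w; have [_ /andP[]] := nh w.
  - rewrite -[leRHS](mean_cst P); apply: le_mean => //; first exact: bmeas_cst.
    by move=> w; have /andP[] := h01 w.
have [a1 a2 a3 a4] := cm f bf f01; have [b1 b2 b3 b4] := cm g bg g01.
have := cov_stair n0 bf.1 bg.1 fg; rewrite -/f' -/g' /cov in a1 a2 a3 a4 b1 b2 b3 b4 *.
move: c1; rewrite !ler_norml => /andP[c1 c2] /andP[d1 d2].
have c3 : mean P f * mean P g - mean P f' * mean P g' <= 2 * e by nra.
have c4 : 0 <= mean P f * mean P g - mean P f' * mean P g'.
  by rewrite subr_ge0 ler_pM.
by apply/andP; split; lra.
Qed.

(** The affine map x |-> (c + x) / (2 c) carries [- c, c] to [0, 1], where the
layer-cake formula applies with constant 1. *)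
Lemma cov_bounded f g a b al : bmeas f -> bmeas g -> 0 < a -> 0 < b ->
  (forall w, `|f w| <= a) -> (forall w, `|g w| <= b) ->
  mixed f g al -> `|cov f g| <= 4 * a * b * al.
Proof.
move=> bf bg a0 b0 fa gb fg.
pose u (c x : R) := (2 * c)^-1 * (c + x).
have mu c : measurable_fun setT (u c).
  by apply: measurable_funM => //; exact: measurable_funD.
have bu (c : R) (h : Omega -> R) : bmeas h -> bmeas (u c \o h).
  by move=> bh; apply/bmeasZ/bmeasD => //; exact: bmeas_cst.
have u01 (c x : R) : 0 < c -> `|x| <= c -> 0 <= u c x <= 1.
  move=> c0; rewrite ler_norml => /andP[x1 x2].
  rewrite /u mulrC ler_pdivrMr ?divr_ge0 /=; [|lra|lra|lra].
  by lra.
have uE c h : 0 < c -> h = (fun w => - c + (2 * c) * (u c \o h) w) :> (Omega -> R).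
  by move=> c0; apply/funext => w; rewrite /u /=; field; rewrite gt_eqF.
have -> : cov f g = (2 * a) * ((2 * b) * cov (u a \o f) (u b \o g)).
  rewrite {1}(uE a f a0) covDl; [|exact: bmeas_cst|exact/bmeasZ/bu|by []].
  rewrite cov_cstl// add0r covZl; [|exact: bu|by []].
  rewrite {1}(uE b g b0) covDr; [|exact: bu|exact: bmeas_cst|exact/bmeasZ/bu].
  rewrite covC cov_cstl ?add0r; last exact: bu.
  by rewrite covC covZl; [rewrite covC|exact: bu|exact: bu].
have := cov_le01 (bu a f bf) (bu b g bg) (fun w => u01 a _ a0 (fa w))
  (fun w => u01 b _ b0 (gb w)) (mixed_comp (mu a) (mu b) fg).
move=> h; rewrite !normrM (gtr0_norm a0) (gtr0_norm b0).
rewrite (@ger0_norm _ 2)// !mulrA.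
rewrite (_ : 2 * a * 2 * b = 4 * a * b); last by ring.
by rewrite ler_pM2l// !mulr_gt0.
Qed.

Definition clamp (a x : R) : R := Num.max (- a) (Num.min a x).

Lemma measurable_clamp a : measurable_fun setT (clamp a).
Proof.
by apply: measurable_maxr => //; apply: measurable_minr.
Qed.

Lemma clamp_bound a x : 0 <= a -> `|clamp a x| <= a.
Proof.
move=> a0; rewrite /clamp ler_norml le_max lexx/= ge_max ge_min lexx andbT.
lra.
Qed.

Lemma clamp_le a x : 0 <= a -> `|clamp a x| <= `|x|.
Proof.
move=> a0; rewrite /clamp maxEle minEle.
by case: (lerP a x) => h; case: ifPn; rewrite -?ltNge => h';
  rewrite ?ler_norml; case: (ger0P x) => h2; rewrite ?ler_norml; lra.
Qed.

Lemma clamp_err a x : 0 < a -> `|x - clamp a x| <= x ^+ 2 / a.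
Proof.
move=> a0; rewrite ler_pdivlMr// /clamp maxEle minEle.
case: (lerP a x) => h; case: ifPn; rewrite -?ltNge => h';
  rewrite ?subrr ?normr0 ?mul0r ?sqr_ge0//; try lra.
  by rewrite ger0_norm; [nra|lra].
by rewrite opprK; case: (ger0P (x + a)) => h2; nra.
Qed.

Lemma bmeas_clamp a f : 0 <= a -> bmeas f -> bmeas (clamp a \o f).
Proof.
move=> a0 [mf _]; split; first exact: measurableT_comp (measurable_clamp a) mf.
by exists a => w; exact: clamp_bound.
Qed.

(** The part of f beyond the truncation level s is at most f ^+ 2 / s, so its
product with g is bounded through the fourth moments of f and g. *)
Let cov_rest f f2 g s : 0 < s -> bmeas f -> bmeas f2 -> bmeas g ->
  mean P (fun w => f w ^+ 4) <= 1 -> mean P (fun w => g w ^+ 4) <= 1 ->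
  (forall w, `|f2 w| <= f w ^+ 2 / s) -> `|cov f2 g| <= 2 / s.
Proof.
move=> s0 bf b2 bg f4 g4 f2f.
have bf4 : bmeas (fun w => f w ^+ 4) by exact: bmeasX.
have bg4 : bmeas (fun w => g w ^+ 4) by exact: bmeasX.
have h1 : mean P (fun w => `|f2 w * g w|) <= s^-1.
  apply: (@le_trans _ _ (mean P (fun w =>
    s^-1 * (2^-1 * f w ^+ 4 + (4^-1 + 4^-1 * g w ^+ 4))))).
    apply: le_mean; [bmeas_tac|bmeas_tac|move=> w].
    rewrite normrM; apply: (@le_trans _ _ (f w ^+ 2 / s * `|g w|)).
        by rewrite ler_wpM2r.
      rewrite mulrAC mulrC ler_pM2l ?invr_gt0//.
      have -> : g w ^+ 4 = `|g w| ^+ 4 by rewrite -normrX ger0_norm// exprn_even_ge0.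
      set y := `|g w|.
      have := sqr_ge0 (f w ^+ 2 - y); have := sqr_ge0 (y ^+ 2 - 1).
      rewrite !expr2; nra.
  rewrite meanZ; last by bmeas_tac.
  rewrite meanD; [|bmeas_tac|bmeas_tac].
  rewrite meanD; [|bmeas_tac|bmeas_tac].
  rewrite !meanZ// mean_cst -[leRHS]mulr1 ler_pM2l ?invr_gt0//; lra.
have h2 : mean P (fun w => `|f2 w|) <= s^-1.
  apply: (@le_trans _ _ (mean P (fun w => s^-1 * (2^-1 + 2^-1 * f w ^+ 4)))).
    apply: le_mean; [bmeas_tac|bmeas_tac|move=> w].
    apply: (le_trans (f2f w)); rewrite mulrC ler_pM2l ?invr_gt0//.
      have := sqr_ge0 (f w ^+ 2 - 1); rewrite !expr2; nra.
  rewrite meanZ; last by bmeas_tac.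
  rewrite meanD; [|bmeas_tac|bmeas_tac].
  rewrite meanZ// mean_cst -[leRHS]mulr1 ler_pM2l ?invr_gt0//; lra.
have h3 : mean P (fun w => `|g w|) <= 1.
  apply: (@le_trans _ _ (mean P (fun w => 3/4 + 4^-1 * g w ^+ 4))).
    apply: le_mean; [bmeas_tac|bmeas_tac|move=> w].
    have -> : g w ^+ 4 = `|g w| ^+ 4 by rewrite -normrX ger0_norm// exprn_even_ge0.
      set y := `|g w|; have := sqr_ge0 (y ^+ 2 - 1); have := sqr_ge0 (y - 1).
      rewrite !expr2; nra.
  rewrite meanD; [|exact: bmeas_cst|exact: bmeasZ].
  by rewrite mean_cst meanZ//; lra.
rewrite /cov (le_trans (ler_normB _ _))// normrM.
have k1 := ler_norm_mean P (bmeasM b2 bg).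
have k2 := ler_norm_mean P b2; have k3 := ler_norm_mean P bg.
have : `|mean P f2| * `|mean P g| <= s^-1 * 1.
  by apply: ler_pM => //; [exact: le_trans h2|exact: le_trans h3].
lra.
Qed.

(** Davydov's inequality for fourth moments, with the truncation level m s
left free: truncating both variables there costs 1 / s, and the truncated ones
are bounded. The two terms balance when s is al to the power - 1 / 3. *)
Lemma cov_fourth f g m s al : bmeas f -> bmeas g -> 0 < m -> 0 < s ->
  mean P (fun w => f w ^+ 4) <= m ^+ 4 -> mean P (fun w => g w ^+ 4) <= m ^+ 4 ->
  mixed f g al -> `|cov f g| <= 4 * m ^+ 2 * (s ^+ 2 * al + s^-1).
Proof.
move=> bf bg m0 s0; wlog -> : f g m m0 bf bg / m = 1.
  move=> hw f4 g4 fg; pose h (u : Omega -> R) w := m^-1 * u w.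
  have bh u : bmeas u -> bmeas (h u) by exact: bmeasZ.
  have h4 u : bmeas u -> mean P (fun w => u w ^+ 4) <= m ^+ 4 ->
      mean P (fun w => h u w ^+ 4) <= 1 ^+ 4.
    move=> bu u4; rewrite /h.
    under eq_fun do rewrite exprMn.
    rewrite meanZ; last exact: bmeasX.
    by rewrite exprVn mulrC ler_pdivrMr ?exprn_gt0// expr1n mul1r.
  have mm : measurable_fun setT (fun x : R => m^-1 * x).
    by apply: measurable_funM => //; exact: measurable_id.
  have := hw (h f) (h g) 1 ltr01 (bh _ bf) (bh _ bg) erefl (h4 _ bf f4)
    (h4 _ bg g4) (mixed_comp mm mm fg).
  rewrite /h covZl//; last exact: bmeasZ.
  rewrite covZr// !normrM gtr0_norm ?invr_gt0// expr1n mulr1 => k.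
  rewrite (_ : 4 * m ^+ 2 * _ = m * (m * (4 * (s ^+ 2 * al + s^-1)))); last first.
    by rewrite expr2; ring.
  by rewrite -ler_pdivrMl// -ler_pdivrMl.
rewrite !expr1n mulr1 => f4 g4 fg.
pose f1 := clamp s \o f; pose g1 := clamp s \o g.
pose f2 w := f w - f1 w; pose g2 w := g w - g1 w.
have bf1 : bmeas f1 by apply: bmeas_clamp => //; exact: ltW.
have bg1 : bmeas g1 by apply: bmeas_clamp => //; exact: ltW.
have bf2 : bmeas f2 by exact: bmeasB.
have bg2 : bmeas g2 by exact: bmeasB.
have fE : f = (fun w => f1 w + f2 w).
  by apply/funext => w; rewrite /f2 addrC subrK.
have gE : g = (fun w => g1 w + g2 w).
  by apply/funext => w; rewrite /g2 addrC subrK.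
have -> : cov f g = cov f1 g1 + cov f1 g2 + cov f2 g.
  by rewrite {1}fE covDl// {1}gE covDr.
have c1 : `|cov f1 g1| <= 4 * s * s * al.
  apply: cov_bounded => //.
  - by move=> w; apply: clamp_bound; exact: ltW.
  - by move=> w; apply: clamp_bound; exact: ltW.
  - by apply: mixed_comp => //; exact: measurable_clamp.
have c2 : `|cov f2 g| <= 2 / s.
  by apply: (@cov_rest f) => // w; exact: clamp_err.
have c3 : `|cov f1 g2| <= 2 / s.
  rewrite covC; apply: (@cov_rest g) => //; last by move=> w; exact: clamp_err.
  apply: le_trans f4; apply: le_mean; [exact: bmeasX|exact: bmeasX|].
  move=> w; have e4 (x : R) : x ^+ 4 = `|x| ^+ 4.
    by rewrite -normrX ger0_norm// exprn_even_ge0.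
  rewrite (e4 (f1 w)) (e4 (f w)) lerXn2r ?nnegrE//.
  by apply: clamp_le; exact: ltW.
apply: (le_trans (ler_normD _ _)).
have := ler_normD (cov f1 g1) (cov f1 g2).
rewrite mulrDr expr2; move: c1 c2 c3; lra.
Qed.

End covariance.

(** * Powers and the schedule of gaps *)
Section power_estimates.
Context {R : realType}.
Implicit Types x y z a b : R.

Lemma powR_expR x a : 0 < x -> x `^ a = expR (a * ln x).
Proof. by move=> x0; rewrite /powR gt_eqF. Qed.

Lemma powR_add_le a b z : 0 <= a -> 0 <= b -> 0 < z <= 1 ->
  (a + b) `^ z <= a `^ z + b `^ z.
Proof.
move=> a0 b0 /andP[z0 z1].
have [s0|s0] := leP (a + b) 0.
  have -> : a = 0 by lra.
  have -> : b = 0 by lra.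
  by rewrite addr0 lerDl powR_ge0.
have part u : 0 <= u -> u <= a + b -> u / (a + b) * (a + b) `^ z <= u `^ z.
  move=> u0 us; have [->|un0] := eqVneq u 0; first by rewrite !mul0r powR_ge0.
  have u1 : 0 < u / (a + b) by rewrite divr_gt0// lt0r un0.
  rewrite [leRHS](_ : _ = (u / (a + b)) `^ z * (a + b) `^ z); last first.
    by rewrite -powRM ?mulfVK ?gt_eqF// ltW.
  rewrite ler_wpM2r ?powR_ge0// ger1_powR// u1/=.
  by rewrite ler_pdivrMr// mul1r.
apply: (le_trans _ (lerD (part a _ _) (part b _ _))); [|lra..].
by rewrite -!mulrDl mulfV ?mul1r// gt_eqF.
Qed.

Lemma powR_exp_decay (k : nat) a z : 0 < a -> 0 < z ->
  exists2 C : R, 0 < C & forall x, 1 <= x -> x ^+ k * expR (- (a * x `^ z)) <= C.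
Proof.
move=> a0 z0; pose m := (Num.trunc (k%:R / z)).+1.
have km : k%:R <= z * m%:R.
  rewrite mulrC -ler_pdivrMr//.
  by apply/ltW/(proj2 (andP (truncn_itv _))); rewrite divr_ge0// ltW.
have f0 : 0 < m`!%:R :> R by rewrite ltr0n fact_gt0.
exists (m`!%:R / a ^+ m); first by rewrite divr_gt0// exprn_gt0.
move=> x x1; have x0 : 0 < x by exact: lt_le_trans x1.
rewrite expRN ler_pdivrMr ?expR_gt0//.
set t := a * x `^ z; have t0 : 0 <= t by rewrite mulr_ge0 ?powR_ge0// ltW.
have := expR_ge1Dxn (Num.trunc (k%:R / z)) t0; rewrite -/m => ht.
have {}ht : t ^+ m / m`!%:R <= expR t by apply: le_trans ht; rewrite lerDr.
apply: (@le_trans _ _ (m`!%:R / a ^+ m * (t ^+ m / m`!%:R))); last first.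
  by rewrite ler_wpM2l// divr_ge0 ?ltW// exprn_gt0.
have -> : m`!%:R / a ^+ m * (t ^+ m / m`!%:R) = (x `^ z) ^+ m.
  by rewrite /t exprMn; field; rewrite expf_neq0 ?gt_eqF.
rewrite -(@powR_mulrn _ _ m) ?powR_ge0// -powRrM.
by rewrite -(@powR_mulrn _ x k) ?ler_powR// ltW.
Qed.

(** Bookkeeping for the halving recursion. A sum of n <= kappa B terms is split
into two parts of at most n / 2 terms and a gap of rho terms between them, which
costs a factor 1 + O(delta) in the variance proxy. Take e = h z,
delta = 8 ((n/B)^e + n^-e) and rho of the order of n ((n/B)^h + n^-h). Along
dyadic lengths both terms of delta are geometric, the first dominated by the
longest length and the second by the shortest. Therefore
psi n = max (1, 3/2 + A ((n/B)^e - n^-e)) increases by 4 delta at each doubling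
and still remains in [1, 2]. The gap is long enough for mixing and so short
that (rho/n)^z <= delta / 4: it can afford the large conjugate exponent
1 + 1 / delta. *)
Lemma gap_schedule (h z : R) : 0 < h < 1 -> 0 < z <= 2^-1 ->
  exists (kappa : R) (n0 : nat), [/\ 0 < kappa <= 1, (0 < n0)%N &
  forall B : R, 0 < B -> exists psi : nat -> R,
    (forall n, n%:R <= kappa * B -> 1 <= psi n <= 2) /\
    forall n, (n0 <= n)%N -> n%:R <= kappa * B ->
    exists (rho : nat) (delta : R),
      [/\ 0 < delta <= 1 /\ 1 <= n%:R * delta, (0 < rho)%N /\ (2 * rho <= n)%N,
          n%:R * (n%:R / B) `^ h <= rho%:R /\ n%:R `^ (1 - h) <= rho%:R,
          4 * rho%:R <= delta ^+ 2 * n%:R /\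
          4 * (B / n%:R) `^ z <= delta * (B / rho%:R) `^ z
        & forall n', (0 < n')%N -> (2 * n' <= n)%N ->
            psi n' + 4 * delta <= psi n]].
Proof.
move=> /andP[h0 h1] /andP[z0 z1].
have pw1 (t : R) : 1 `^ t = 1 by rewrite powR1.
pose e := h * z; have e0 : 0 < e by rewrite mulr_gt0.
have e1 : e <= 1 by rewrite /e; nra.
(* th is the relative variation of (n/B)^e and of n^-e under a doubling of n. *)
pose th : R := 1 - 2 `^ (- e).
have thE : 2 `^ (- e) = 1 - th by rewrite /th; ring.
have th0 : 0 < th.
  rewrite subr_gt0 -[ltRHS](powRr0 2) !powR_expR// ltr_expR mul0r.
  by rewrite mulNr oppr_lt0 mulr_gt0// ln_gt0// ltr1n.
have th1 : th <= 2^-1.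
  suff : 2^-1 <= (2:R) `^ (- e) by rewrite thE; lra.
  by rewrite -powR_inv1// ler_powR ?ler1n// lerN2.
have th2 : 1 + th <= 2 `^ e.
  rewrite -[e]opprK powRN thE -[leRHS]mul1r ler_pdivlMr; nra.
pose A := 32 / th; have A0 : 0 < A by rewrite divr_gt0.
have Ath : A * th = 32 by rewrite /A mulfVK// gt_eqF.
have A4 : 0 < 4 * A by rewrite mulr_gt0.
(* As long as (n/B)^e and n^-e are at most q, psi n lies within 1/4 of 3/2. *)
pose q := (4 * A)^-1; have q0 : 0 < q by rewrite invr_gt0 mulr_gt0.
have Aq : A * q = 4^-1 by rewrite /q invfM mulrCA mulfV ?mulr1// gt_eqF.
have q64 : 64 * q <= 4^-1 by rewrite -Aq ler_pM2r//; nra.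
have q1 : q <= 1 by lra.
exists (q `^ e^-1), (Num.trunc ((4 * A) `^ e^-1)).+1; split=> //.
  rewrite powR_gt0//= -[leRHS](pw1 e^-1) ge0_ler_powR ?nnegrE ?invr_ge0//; exact: ltW.
move=> B B0.
pose a n := (n%:R / B) `^ e; pose b n : R := n%:R `^ (- e).
pose psi n := if n == 0%N then 1 else Num.max 1 (3 / 2 + A * (a n - b n)).
have aq n : n%:R <= q `^ e^-1 * B -> a n <= q.
  move=> nB; rewrite /a.
  have -> : q = (q `^ e^-1) `^ e by rewrite -powRrM mulVf ?gt_eqF// powRr1// ltW.
  apply: ge0_ler_powR; rewrite ?nnegrE ?powR_ge0 ?divr_ge0//; try exact: ltW.
  by rewrite ler_pdivrMr.
have a_ge0 n : 0 <= a n by exact: powR_ge0.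
have b_ge0 n : 0 <= b n by exact: powR_ge0.
exists psi; split.
  move=> n nB; rewrite /psi; case: eqP => _; first by lra.
  rewrite le_max lexx/= ge_max; apply/andP; split; first by lra.
  have := aq n nB; have := b_ge0 n; nra.
move=> n n0 nB; have an := aq n nB; have an0 := a_ge0 n; have bn0 := b_ge0 n.
have npos : (0 < n)%N by exact: leq_trans n0.
have nR : 0 < n%:R :> R by rewrite ltr0n.
have n1R : 1 <= n%:R :> R by rewrite ler1n.
have bn : b n <= q.
  have e4 : (4 * A) `^ e^-1 <= n%:R.
    have := truncn_itv (powR_ge0 (4 * A) e^-1) => /andP[_ /ltW t].
    by apply: (le_trans t); rewrite ler_nat.
  rewrite /b powRN /q lef_pV2 ?posrE ?powR_gt0//.
  have -> : 4 * A = ((4 * A) `^ e^-1) `^ e.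
    by rewrite -powRrM mulVf ?gt_eqF// powRr1// ltW.
  by apply: ge0_ler_powR; rewrite ?nnegrE ?powR_ge0//; exact: ltW.
pose y := (n%:R / B) `^ h + n%:R `^ (- h).
have y0 : 0 <= y by rewrite addr_ge0 ?powR_ge0.
pose rho := (Num.trunc (n%:R * y)).+1; pose delta := 8 * (a n + b n).
have /andP[rho1 rho2] : (rho%:R - 1 : R) <= n%:R * y < rho%:R.
  have := truncn_itv (mulr_ge0 (ltW nR) y0); rewrite -/rho => /andP[u v].
  by rewrite v andbT /rho -natr1 addrK.
have nh : n%:R * n%:R `^ (- h) = n%:R `^ (1 - h) :> R.
  by rewrite powRD ?(gt_eqF nR) ?implybT// powRr1// ltW.
have nh1 : 1 <= n%:R `^ (1 - h) :> R.
  by rewrite -[leLHS](powRr0 n%:R) ler_powR// subr_ge0 ltW.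
have rho3 : rho%:R <= 2 * (n%:R * y).
  have : n%:R * n%:R `^ (- h) <= n%:R * y.
    by rewrite ler_pM2l// /y lerDr powR_ge0.
  by rewrite nh; lra.
have rhoR : 0 < rho%:R :> R by rewrite ltr0n.
have d0 : 0 < delta.
  by rewrite mulr_gt0// ltr_wpDl// powR_gt0.
have d1 : delta <= 1.
  by rewrite /delta; lra.
have rz : 4 * (rho%:R / n%:R) `^ z <= delta.
  apply: (@le_trans _ _ (4 * (2 * y) `^ z)).
    rewrite ler_pM2l// ge0_ler_powR ?nnegrE ?divr_ge0 ?mulr_ge0//; try exact: ltW.
    by rewrite ler_pdivrMr// -mulrA (mulrC y).
  rewrite powRM// /delta.
  have -> : 8 = 4 * 2 :> R by ring.
  rewrite -mulrA ler_pM2l//; apply: ler_pM; rewrite ?powR_ge0//.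
    by rewrite -[leRHS]powRr1// ler_powR ?ler1n//; lra.
  apply: le_trans (powR_add_le _ _ _) _; rewrite ?powR_ge0//; first by lra.
  by rewrite -!powRrM mulNr.
have r1 : rho%:R / n%:R <= 1 :> R.
  rewrite leNgt; apply/negP => r1.
  have : 1 < (rho%:R / n%:R) `^ z :> R.
    by rewrite -[ltLHS](pw1 z) gt0_ltr_powR ?nnegrE ?ler01// divr_ge0// ltW.
  by move: rz d1; lra.
have r16 : 16 * rho%:R <= delta ^+ 2 * n%:R.
  rewrite -ler_pdivrMr// -mulrA.
  have rr : rho%:R / n%:R <= ((rho%:R / n%:R) `^ z) ^+ 2 :> R.
    rewrite -powR_mulrn ?powR_ge0// -powRrM ger1_powR ?divr_gt0//.
    by rewrite mulrC -ler_pdivlMl// mulr1.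
  set r := rho%:R / n%:R in rz rr *; set rz' := r `^ z in rz rr.
  have : 0 <= rz' by exact: powR_ge0.
  nra.
exists rho, delta; split.
- split; first by rewrite d0.
  have ne : 1 <= n%:R * b n.
    have -> : n%:R * b n = n%:R `^ (1 - e).
      by rewrite /b powRD ?(gt_eqF nR) ?implybT// powRr1// ltW.
    by rewrite -[leLHS](powRr0 n%:R) ler_powR// subr_ge0.
  rewrite /delta; have : 0 <= n%:R * a n by rewrite mulr_ge0// ltW.
  by nra.
- split=> //; rewrite -(ler_nat R) natrM.
  have : delta ^+ 2 <= 1 by rewrite expr_le1// ltW.
  nra.
- split; apply: le_trans (ltW rho2); rewrite -?nh ler_pM2l// /y.
    by rewrite lerDl powR_ge0.
  by rewrite lerDr powR_ge0.
- split; first by nra.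
  have -> : B / n%:R = (B / rho%:R) * (rho%:R / n%:R) by rewrite mulrA mulfVK ?gt_eqF.
  rewrite powRM ?divr_ge0//; try exact: ltW.
  by rewrite mulrCA mulrC ler_wpM2r// powR_ge0.
move=> n' n'0 n'n; rewrite /psi !gtn_eqF//.
have n'R : 0 < n'%:R :> R by rewrite ltr0n.
have n'n2 : n'%:R <= 2^-1 * n%:R :> R.
  by rewrite -ler_pdivrMl ?invr_gt0// invrK -natrM ler_nat.
have B_ge0 := ltW B0.
have half (t : R) : 2^-1 `^ t = 2 `^ (- t).
  by rewrite -[X in X `^ _]powR_inv1// -powRrM mulN1r.
have A' : A * (a n' - b n') + 4 * delta <= A * (a n - b n).
  have ha : a n' <= a n * (1 - th).
    rewrite -thE /a; apply: (@le_trans _ _ ((2^-1 * (n%:R / B)) `^ e)).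
      rewrite ge0_ler_powR ?nnegrE ?mulr_ge0 ?invr_ge0//; try exact: ltW.
      by rewrite mulrA ler_pM2r ?invr_gt0.
    by rewrite powRM ?invr_ge0 ?divr_ge0// mulrC half.
  have hb : b n * (1 + th) <= b n'.
    rewrite /b; apply: (@le_trans _ _ ((2^-1 * n%:R) `^ (- e))); last first.
      rewrite !powRN lef_pV2 ?posrE ?powR_gt0 ?mulr_gt0 ?invr_gt0//.
      by rewrite ge0_ler_powR ?nnegrE ?mulr_ge0 ?invr_ge0//; exact: ltW.
    by rewrite powRM ?invr_ge0// half opprK mulrC ler_wpM2r.
  have -> : 4 * delta = A * (th * (a n + b n)) by rewrite [RHS]mulrA Ath /delta; ring.
  by rewrite -mulrDr ler_pM2l//; lra.
have hd : 4 * delta <= 4^-1.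
  have q2 : 32 * (2 * q) = 2 * th * 4^-1 by rewrite -Ath -Aq; ring.
  by rewrite /delta; lra.
have hA : A * (a n - b n) >= - 4^-1 by nra.
rewrite le_max; apply/orP; right.
by rewrite maxEle; case: ifP => _; clear - A' hd hA; lra.
Qed.

End power_estimates.

(** * Exponential inequalities *)
Section exponential_inequalities.
Context {R : realType}.
Implicit Types x y : R.

Lemma expR_sub1_le x : expR x - 1 <= x * expR x.
Proof.
have : (1 - x) * expR x <= 1.
  have := expR_ge1Dx (- x); rewrite expRN -ler_pdivlMr ?expR_gt0// div1r.
  by lra.
by lra.
Qed.

Lemma norm_expR_sub1_le x : `|expR x - 1| <= `|x| * expR `|x|.
Proof.
case: (ger0P x) => x0.
  rewrite ger0_norm ?expR_sub1_le// subr_ge0 -expR0 ler_expR//.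
have e1 : expR x <= 1 by rewrite -expR0 ler_expR ltW.
rewrite ler0_norm ?subr_le0// opprB.
have := expR_ge1Dx x; have : 1 <= expR (- x) by rewrite -expR0 ler_expR; lra.
nra.
Qed.

Lemma expR_taylor2_le x : expR x <= 1 + x + x ^+ 2 * expR `|x|.
Proof.
have h := expR_sub1_le x.
suff : x * (expR x - 1) <= x ^+ 2 * expR `|x| by lra.
have := norm_expR_sub1_le x => h2; apply: (le_trans (ler_norm _)).
by rewrite normrM -(real_normK (num_real x)) expr2 -mulrA ler_wpM2l.
Qed.

(** Both exponentials on the right lie above the tangent of expR at x + y, and
in the convex combination the first order terms cancel. *)
Lemma expR_young (t x y : R) : 0 < t < 1 ->
  expR (x + y) <= t * expR (x / t) + (1 - t) * expR (y / (1 - t)).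
Proof.
move=> /andP[t0 t1]; have t1' : 0 < 1 - t by lra.
have tangent u : expR (x + y) * (1 + (u - (x + y))) <= expR u.
  rewrite [leRHS](_ : _ = expR (x + y) * expR (u - (x + y))).
    by rewrite ler_pM2l ?expR_gt0//; exact: expR_ge1Dx.
  by rewrite -expRD; congr expR; ring.
have := ler_wpM2l (ltW t0) (tangent (x / t)).
have := ler_wpM2l (ltW t1') (tangent (y / (1 - t))).
set E := expR (x + y) => h1 h2.
apply: le_trans (lerD h2 h1).
rewrite le_eqVlt; apply/orP; left; apply/eqP.
by field; rewrite !gt_eqF.
Qed.

End exponential_inequalities.

(** * Information and strong mixing of a sequence *)
Section information.
Context {R : realType} d (Omega : measurableType d) (P : probability Omega R).
Context (Fam : nat -> set_system Omega).
Context (Fam_meas : forall t, Fam t `<=` measurable).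

(** Fam t is the information revealed at time t, so this is measurability with
respect to the information of the times in I. *)
Definition known (I : set nat) (f : Omega -> R) : Prop :=
  measurable_fun setT
    (f : g_sigma_algebraType (\bigcup_(t in I) Fam t) -> R).

Lemma known_measurable I f : known I f -> measurable_fun setT f.
Proof.
move=> kf _ A mA; have := kf measurableT A mA.
apply: smallest_sub; first exact: sigma_algebra_measurable.
by move=> B [t _]; exact: Fam_meas.
Qed.

Lemma sub_known I J f : I `<=` J -> known I f -> known J f.
Proof.
move=> IJ kf _ A mA; have := kf measurableT A mA.
apply: smallest_sub; first exact: smallest_sigma_algebra.
by move=> B [t It FB]; apply: sub_gen_smallest; exists t => //; exact: IJ.
Qed.

Lemma known_comp I f (phi : R -> R) : measurable_fun setT phi -> known I f ->
  known I (phi \o f).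
Proof. by move=> mphi kf; exact: measurableT_comp. Qed.

Lemma known_sum I (J : Type) (r : seq J) (Q : pred J) (f : J -> Omega -> R) :
  (forall j, Q j -> known I (f j)) ->
  known I (fun w => \sum_(j <- r | Q j) f j w).
Proof.
move=> kf; rewrite /known (_ : (fun w => _) =
    (fun w => \sum_(j <- r) (if Q j then f j w else 0))); last first.
  by apply/funext => w; rewrite big_mkcond.
apply: measurable_sum => j; case: (boolP (Q j)) => Qj; first exact: kf.
exact: measurable_cst.
Qed.

(** The past consists of the times before k, the future of those from k + l on,
so that l times lie strictly between them. *)
Definition alpha_mixing (al : nat -> R) : Prop := forall k l A B,
  <<s \bigcup_(t in [set t | (t < k)%N]) Fam t >> A ->
  <<s \bigcup_(t in [set t | (k + l <= t)%N]) Fam t >> B ->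
  `|fine (P (A `&` B)) - fine (P A) * fine (P B)| <= al l.

Lemma alpha_mixed al k l f g : alpha_mixing al ->
  known [set t | (t < k)%N] f -> known [set t | (k + l <= t)%N] g ->
  mixed P f g (al l).
Proof.
move=> mix kf kg A B mA mB; apply: (mix k).
  by have := kf measurableT A mA; rewrite setTI.
by have := kg measurableT B mB; rewrite setTI.
Qed.

End information.

(** * Moment generating functions of partial sums *)
Section mgf_tools.
Context {R : realType} d (Omega : measurableType d) (P : probability Omega R).
Implicit Types X Y : Omega -> R.

(** Hoelder's inequality for the mean of expR X * expR Y with the exponents 1 / t
and 1 / (1 - t), in the form used when bounds for both factors are at hand. *)
Lemma mgf_young (t : R) X Y (x y : R) : 0 < t < 1 -> bmeas X -> bmeas Y ->
  mean P (fun w => expR (X w / t)) <= expR (x / t) ->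
  mean P (fun w => expR (Y w / (1 - t))) <= expR (y / (1 - t)) ->
  mean P (fun w => expR (X w + Y w)) <= expR (x + y).
Proof.
move=> t01 bX bY hX hY; have /andP[t0 t1] := t01.
have t1' : 0 <= 1 - t by lra.
have bXt : bmeas (fun w => expR (X w / t)) by bmeas_tac.
have bYt : bmeas (fun w => expR (Y w / (1 - t))) by bmeas_tac.
pose a := expR (x + y) * (t * expR (- (x / t))).
pose b := expR (x + y) * ((1 - t) * expR (- (y / (1 - t)))).
apply: (@le_trans _ _ (mean P (fun w => a * expR (X w / t)
    + b * expR (Y w / (1 - t))))).
  apply: le_mean; [by bmeas_tac|by bmeas_tac|move=> w].
  have -> : X w + Y w = (x + y) + ((X w - x) + (Y w - y)) by ring.
  rewrite expRD; apply: le_trans (ler_wpM2l (expR_ge0 _) (expR_young _ _ t01)) _.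
  have split (u v r : R) : expR ((u - v) / r) = expR (- (v / r)) * expR (u / r).
    by rewrite mulrBl expRD mulrC.
  by rewrite !split /a /b mulrDr !mulrA.
rewrite meanD; [|by bmeas_tac|by bmeas_tac].
rewrite !meanZ//; apply: (@le_trans _ _ (a * expR (x / t) + b * expR (y / (1 - t)))).
  by rewrite lerD// ler_wpM2l// !mulr_ge0 ?expR_ge0// ltW.
have e1 (u : R) : expR (- u) * expR u = 1 by rewrite -expRD addNr expR0.
have -> : a * expR (x / t) = expR (x + y) * t by rewrite /a -!mulrA e1 mulr1.
have -> : b * expR (y / (1 - t)) = expR (x + y) * (1 - t).
  by rewrite /b -!mulrA e1 mulr1.
by rewrite -mulrDr (addrC t) subrK mulr1.
Qed.

(** The mean of the product differs from the product of the means by the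
covariance of expR X - 1 and expR Y - 1. Subtracting 1 matters: for X and Y of
order lam the fourth roots m are of order lam, and the error is of order
lam ^+ 2, the same as that of the main term. *)
Lemma mgf_decouple X Y (a b m s al : R) : bmeas X -> bmeas Y ->
  mixed P X Y al -> 0 <= al -> 0 < m -> 0 < s -> 0 <= a -> 0 <= b ->
  mean P (fun w => (expR (X w) - 1) ^+ 4) <= m ^+ 4 ->
  mean P (fun w => (expR (Y w) - 1) ^+ 4) <= m ^+ 4 ->
  mean P (fun w => expR (X w)) <= expR a ->
  mean P (fun w => expR (Y w)) <= expR b ->
  mean P (fun w => expR (X w + Y w)) <=
    expR (a + b + 4 * m ^+ 2 * (s ^+ 2 * al + s^-1)).
Proof.
move=> bX bY XY al0 m0 s0 a0 b0 X4 Y4 hX hY.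
pose F w := expR (X w) - 1; pose G w := expR (Y w) - 1.
have bF : bmeas F by rewrite /F; bmeas_tac.
have bG : bmeas G by rewrite /G; bmeas_tac.
have mE : measurable_fun setT (fun x : R => expR x - 1).
  by apply: measurable_funB => //; exact: measurable_expR.
set err := 4 * _ * _.
have err0 : 0 <= err.
  by rewrite !mulr_ge0// ?exprn_ge0// ?addr_ge0 ?mulr_ge0 ?exprn_ge0 ?invr_ge0// ltW.
have : `|cov P F G| <= err.
  exact: (cov_fourth bF bG m0 s0 X4 Y4 (mixed_comp mE mE XY)).
have -> : cov P F G = cov P (fun w => expR (X w)) (fun w => expR (Y w)).
  have bEX : bmeas (fun w => expR (X w)) by bmeas_tac.
  have bEY : bmeas (fun w => expR (Y w)) by bmeas_tac.
  have b1 : bmeas ((fun=> -1) : Omega -> R) by exact: bmeas_cst.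
  rewrite (covDl P bEX b1 bG) (cov_cstl P (-1) bG) addr0.
  by rewrite (covDr P bEX bEY b1) (covC P _ (fun=> -1)) (cov_cstl P (-1) bEX) addr0.
rewrite /cov ler_norml => /andP[_].
rewrite lerBlDr (_ : (fun w => _) = (fun w => expR (X w + Y w))); last first.
  by apply/funext => w; rewrite expRD.
move=> /le_trans; apply.
have M : mean P (fun w => expR (X w)) * mean P (fun w => expR (Y w)) <=
    expR (a + b).
  by rewrite expRD ler_pM// mean_ge0// => w; exact: expR_ge0.
rewrite expRD; have e1 := expR_ge1Dx err.
have eab : 1 <= expR (a + b) by rewrite -expR0 ler_expR addr_ge0.
apply: (@le_trans _ _ (expR (a + b) * (1 + err))).
  by rewrite mulrDr mulr1 addrC lerD ?ler_peMl.
by rewrite ler_wpM2l// expR_ge0.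
Qed.

End mgf_tools.

Section partial_sums.
Context {R : realType} d (Omega : measurableType d) (P : probability Omega R).
Implicit Types V : nat -> Omega -> R.

Definition psum V (u n : nat) (w : Omega) : R := \sum_(u <= t < u + n) V t w.

Lemma psumD V u n n' w :
  psum V u (n + n') w = psum V u n w + psum V (u + n) n' w.
Proof.
by rewrite /psum (big_cat_nat (n := u + n)) ?leq_addr//= addnA ?leq_addr.
Qed.

Lemma psum0 V u w : psum V u 0 w = 0.
Proof. by rewrite /psum addn0 big_geq. Qed.

Lemma bmeas_psum V u n : (forall t, bmeas (V t)) -> bmeas (psum V u n).
Proof. by move=> bV; apply: bmeas_sum => t _. Qed.

Lemma known_psum (Fam : nat -> set_system Omega) V I u n :
  (forall t, (u <= t < u + n)%N -> I t) ->
  (forall t, known Fam [set t] (V t)) -> known Fam I (psum V u n).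
Proof.
move=> uI kV; rewrite /psum.
rewrite (_ : (fun w => _) =
    fun w => \sum_(u <= t < u + n | (u <= t < u + n)%N) V t w); last first.
  by apply/funext => w; rewrite big_nat.
by apply: known_sum => t /uI It; apply: sub_known (kV t) => _ ->.
Qed.

(** Some term has at least the average modulus, so n times that term dominates
the sum. Only moments of single variables are then needed. *)
Lemma psum_dominated (phi : R -> R) V u n w : (0 < n)%N ->
  {in Num.nneg &, {homo phi : x y / x <= y}} -> 0 <= phi 0 ->
  phi `|psum V u n w| <= \sum_(u <= t < u + n) phi (n%:R * `|V t w|).
Proof.
move=> n0 phi_mono phi0.
have phi_ge0 x : 0 <= x -> 0 <= phi x.
  by move=> x0; rewrite (le_trans phi0)// phi_mono ?nnegrE.
have [t /andP[/andP[ut tn] tS]] : exists t,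
    ((u <= t < u + n)%N && (`|psum V u n w| <= n%:R * `|V t w|)).
  apply/not_existsP => tN.
  have : n%:R * `|psum V u n w| < n%:R * `|psum V u n w|.
    apply: (@le_lt_trans _ _ (\sum_(u <= t < u + n) n%:R * `|V t w|)).
      by rewrite -mulr_sumr ler_wpM2l// ler_norm_sum.
    have -> : n%:R * `|psum V u n w| = \sum_(u <= t < u + n) `|psum V u n w|.
      by rewrite sumr_const_nat addKn mulr_natl.
    apply: ltr_sum_nat.
      by rewrite -addn1 leq_add2l.
    by move=> t tu; rewrite ltNge; apply/negP => h; apply: (tN t); rewrite tu.
  by rewrite ltxx.
apply: (@le_trans _ _ (phi (n%:R * `|V t w|))).
  by rewrite phi_mono ?nnegrE// mulr_ge0.
rewrite (bigD1_seq t) ?mem_index_iota ?ut ?tn ?iota_uniq//=.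
by rewrite lerDl sumr_ge0// => i _; rewrite phi_ge0// mulr_ge0.
Qed.

Let phi_mono (k j : nat) (lam : R) : 0 <= lam ->
  {in Num.nneg &, {homo (fun x => (lam * x) ^+ k * expR (j%:R * (lam * x))) :
    x y / x <= y}}.
Proof.
move=> l0 x y; rewrite !nnegrE => x0 y0 xy.
apply: ler_pM; rewrite ?expR_ge0 ?exprn_ge0 ?mulr_ge0//.
  by rewrite lerXn2r ?nnegrE ?mulr_ge0// ler_wpM2l.
by rewrite ler_expR !ler_wpM2l.
Qed.

Lemma mgf_fourth V u n n' (lam D : R) : (forall t, bmeas (V t)) ->
  (n <= n')%N -> 0 <= lam ->
  (forall t, mean P (fun w =>
     (1 + V t w ^+ 4) * expR (4 * lam * n'%:R * `|V t w|)) <= D) ->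
  mean P (fun w => (expR (lam * psum V u n w) - 1) ^+ 4) <=
    (lam * n%:R) ^+ 4 * n%:R * D.
Proof.
move=> bV nn' l0 hD.
have bS := bmeas_psum u n bV.
have [n0|n0] := posnP n.
  have -> : lam * n%:R = 0 by rewrite n0 mulr0.
  rewrite expr0n/= !mul0r n0 (_ : (fun w => _) = fun=> 0) ?mean_cst//.
  by apply/funext => w; rewrite psum0 mulr0 expR0 subrr expr0n.
pose H t w := (lam * n%:R) ^+ 4 * ((1 + V t w ^+ 4) *
  expR (4 * lam * n'%:R * `|V t w|)).
have bH t : bmeas (H t) by rewrite /H; have := bV t => bVt; bmeas_tac.
apply: (@le_trans _ _ (mean P (fun w => \sum_(u <= t < u + n) H t w))).
  apply: le_mean => [||w]; [by bmeas_tac|exact: bmeas_sum|].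
  have -> : (expR (lam * psum V u n w) - 1) ^+ 4 =
      `|expR (lam * psum V u n w) - 1| ^+ 4.
    by rewrite -normrX ger0_norm// exprn_even_ge0.
  apply: (@le_trans _ _ ((lam * `|psum V u n w|) ^+ 4 *
      expR (4%:R * (lam * `|psum V u n w|)))).
    have := norm_expR_sub1_le (lam * psum V u n w).
    rewrite normrM (ger0_norm l0) => h.
    rewrite expRM_natl -exprMn.
    by rewrite lerXn2r ?nnegrE ?mulr_ge0 ?expR_ge0.
  have := @psum_dominated _ V u n w n0 (phi_mono 4 4 l0).
  rewrite mulr0 expr0n/= mul0r => /(_ (lexx _))/le_trans; apply.
  apply: ler_sum => t _; rewrite /H [leRHS]mulrA.
  apply: ler_pM; rewrite ?expR_ge0 ?exprn_ge0 ?mulr_ge0//.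
    rewrite mulrA exprMn ler_wpM2l ?exprn_ge0 ?mulr_ge0//.
    by rewrite -normrX ger0_norm ?exprn_even_ge0// lerDr.
  rewrite ler_expR !mulrA ler_wpM2r// ler_wpM2l ?ler_nat//.
  by rewrite mulr_ge0.
rewrite mean_sum//.
apply: (@le_trans _ _ (\sum_(u <= t < u + n) (lam * n%:R) ^+ 4 * D)).
  apply: ler_sum => t _; rewrite /H meanZ; last by have := bV t => bVt; bmeas_tac.
  by rewrite ler_wpM2l ?hD// exprn_ge0// mulr_ge0.
by rewrite sumr_const_nat addKn -(mulr_natr (_ ^+ 4 * D)) mulrAC.
Qed.

(** Second order Taylor expansion, where the first order term has mean zero.
The factor n ^+ 3 is harmless because this serves only for sums of boundedly
many terms, at the bottom of the recursion. *)
Lemma mgf_short V u n (lam D : R) : (forall t, bmeas (V t)) ->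
  (forall t, mean P (V t) = 0) -> 0 <= lam ->
  (forall t, mean P (fun w =>
     (1 + V t w ^+ 4) * expR (4 * lam * n%:R * `|V t w|)) <= D) ->
  mean P (fun w => expR (lam * psum V u n w)) <=
    1 + (lam * n%:R) ^+ 2 * n%:R * D.
Proof.
move=> bV V0 l0 hD.
have bS := bmeas_psum u n bV.
have [n0|n0] := posnP n.
  have -> : lam * n%:R = 0 by rewrite n0 mulr0.
  rewrite expr0n/= !mul0r addr0 n0 (_ : (fun w => _) = fun=> 1) ?mean_cst//.
  by apply/funext => w; rewrite psum0 mulr0 expR0.
pose H t w := (lam * n%:R) ^+ 2 * ((1 + V t w ^+ 4) *
  expR (4 * lam * n%:R * `|V t w|)).
have bH t : bmeas (H t) by rewrite /H; have := bV t => bVt; bmeas_tac.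
have bsH : bmeas (fun w => \sum_(u <= t < u + n) H t w) by exact: bmeas_sum.
apply: (@le_trans _ _ (mean P (fun w => 1 + lam * psum V u n w +
    \sum_(u <= t < u + n) H t w))).
  apply: le_mean => [||w]; [by bmeas_tac|by bmeas_tac|].
  apply: (le_trans (expR_taylor2_le _)); rewrite lerD2l.
  rewrite -(real_normK (num_real (lam * _))) normrM (ger0_norm l0).
  rewrite -[X in expR X]mul1r.
  have := @psum_dominated _ V u n w n0 (phi_mono 2 1 l0).
  rewrite mulr0 expr0n/= mul0r => /(_ (lexx _))/le_trans; apply.
  apply: ler_sum => t _; rewrite /H [leRHS]mulrA.
  apply: ler_pM; rewrite ?expR_ge0 ?exprn_ge0 ?mulr_ge0//.
    rewrite mulrA exprMn ler_wpM2l ?exprn_ge0 ?mulr_ge0//.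
    rewrite real_normK ?num_real//.
    by have := sqr_ge0 (V t w ^+ 2 - 1); rewrite !expr2; nra.
  rewrite ler_expR mul1r !mulrA ler_wpM2r// ler_wpM2r// ler_peMl//.
  by rewrite ler1n.
rewrite meanD; [|by bmeas_tac|by bmeas_tac].
rewrite meanD; [|by bmeas_tac|by bmeas_tac].
rewrite mean_cst meanZ// (_ : mean P (psum V u n) = 0); last first.
  by rewrite /psum mean_sum// big1.
rewrite mulr0 addr0 lerD2l mean_sum//.
apply: (@le_trans _ _ (\sum_(u <= t < u + n) (lam * n%:R) ^+ 2 * D)).
  apply: ler_sum => t _; rewrite /H meanZ; last by have := bV t => bVt; bmeas_tac.
  by rewrite ler_wpM2l ?hD// exprn_ge0// mulr_ge0.
by rewrite sumr_const_nat addKn -(mulr_natr (_ ^+ 2 * D)) mulrAC.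
Qed.

End partial_sums.

(** * The moment generating function of a block *)
Section recursion.
Context {R : realType}.

Lemma split_gap (n rho : nat) : (0 < rho)%N -> (2 * rho <= n)%N ->
  let n1 := (n - rho)./2 in let n3 := (n - rho - n1)%N in
  [/\ (n1 + rho + n3 = n)%N, (2 * n1 <= n)%N & (2 * n3 <= n)%N].
Proof.
move=> rho0 rhon n1 n3; have := odd_double_half (n - rho).
rewrite /n3 -/n1 -mul2n; clearbody n1.
by case: (odd _) => /= ?; split; lia.
Qed.

(** By strong induction, the bound for n terms holds with variance proxy C psi n
for lam psi n <= lam0 (B/n)^z, a range that shrinks as n grows. A sum is
divided into half, gap, half. Young's inequality with exponents p = 1 + delta
and q = 1 + 1 / delta separates the gap from the halves; the range condition for
the gap at q lam holds because the gap is short. The two halves at p lam are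
decoupled by mixing across the gap. The moment hypothesis lets the fourth
moments grow at a small fraction of the mixing rate over a gap of
n (n/B)^h terms, and what is left of this rate makes the covariance error at
most a constant times lam ^+ 2, which is absorbed since n delta >= 1. *)
Lemma mgf_mixing (c g1 h z D : R) : 0 < c -> 0 < g1 -> 0 < h < 1 ->
  0 < z <= 2^-1 -> 1 <= D ->
  exists kappa C : R, [/\ 0 < kappa <= 1, 0 < C &
  forall d (Omega : measurableType d) (P : probability Omega R)
    (Fam : nat -> set_system Omega) (V : nat -> Omega -> R) (B lam0 : R),
  0 < B ->
  alpha_mixing P Fam (fun l => expR (- (c * l%:R `^ g1))) ->
  (forall t, bmeas (V t)) -> (forall t, known Fam [set t] (V t)) ->
  (forall t, mean P (V t) = 0) ->
  (forall n t lam, (0 < n)%N -> n%:R <= kappa * B -> 0 <= lam ->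
     lam <= lam0 * (B / n%:R) `^ z ->
     mean P (fun w => (1 + V t w ^+ 4) * expR (4 * lam * n%:R * `|V t w|)) <=
     D * expR (c / 12 * (n%:R * (n%:R / B) `^ h) `^ g1)) ->
  forall u n lam, n%:R <= kappa * B -> 0 <= lam -> 2 * lam <= lam0 ->
    mean P (fun w => expR (lam * psum V u n w)) <= expR (C * lam ^+ 2 * n%:R)].
Proof.
move=> c0 g0 h01 z01 D1; have /andP[h0 h1] := h01; have /andP[z0 z1] := z01.
have [kappa [n0 [/andP[k0 k1] n00 schedule]]] := gap_schedule h01 z01.
have [E E0 decay] : exists2 E : R, 0 < E & forall x, 1 <= x ->
    x ^+ 4 * expR (- (c / 6 * x `^ ((1 - h) * g1))) <= E.
  apply: powR_exp_decay; first by rewrite divr_gt0.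
  by rewrite mulr_gt0// subr_gt0.
have D0 : 0 < D by exact: lt_le_trans D1.
(* Kb serves for the sums of fewer than n0 terms, Ke for the covariance errors. *)
pose Kb := n0%:R ^+ 2 * D * expR (c / 12 * n0%:R `^ g1).
pose Ke := 32 * D ^+ 2 * E.
have Kb0 : 0 < Kb.
  by rewrite !mulr_gt0 ?expR_gt0 ?exprn_gt0 ?ltr0n.
have Ke0 : 0 < Ke by rewrite !mulr_gt0 ?exprn_gt0.
pose C := Kb + Ke; have C0 : 0 < C by rewrite addr_gt0.
exists kappa, (2 * C); split; [by rewrite k0|by rewrite mulr_gt0|].
move=> d Omega P Fam V B lam0 B0 mix bV kV V0 moment.
have [psi [psi12 step]] := schedule B B0.
have Bge n : (0 < n)%N -> n%:R <= kappa * B -> 1 <= B / n%:R.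
  move=> npos nB; rewrite ler_pdivlMr ?ltr0n// mul1r (le_trans nB)//.
  by rewrite ler_piMl// ltW.
have zero u lam : mean P (fun w => expR (lam * psum V u 0 w)) = 1.
  rewrite (_ : (fun w => _) = fun=> 1) ?mean_cst//.
  by apply/funext => w; rewrite psum0 mulr0 expR0.
suff main n : forall u lam, (0 < n)%N -> n%:R <= kappa * B -> 0 <= lam ->
    lam * psi n <= lam0 * (B / n%:R) `^ z ->
    mean P (fun w => expR (lam * psum V u n w)) <=
    expR (C * psi n * lam ^+ 2 * n%:R).
  move=> u n lam nB l0 ll0.
  have [->|npos] := posnP n; first by rewrite zero mulr0 expR0.
  have /andP[p1 p2] := psi12 n nB.
  apply: (le_trans (main n u lam npos nB l0 _)).
    apply: (@le_trans _ _ lam0); first by nra.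
    rewrite ler_peMr//; first by apply: le_trans ll0; rewrite mulr_ge0.
    by rewrite -[leLHS](powRr0 (B / n%:R)) ler_powR ?Bge// ltW.
  rewrite ler_expR ler_wpM2r// ler_wpM2r ?sqr_ge0// mulrC ler_wpM2r//.
  exact: ltW.
elim/ltn_ind: n => n ih u lam npos nB l0 hlam.
have nR : 0 < n%:R :> R by rewrite ltr0n.
have n1R : 1 <= n%:R :> R by rewrite ler1n.
have /andP[p1 p2] := psi12 n nB.
pose Dn := D * expR (c / 12 * (n%:R * (n%:R / B) `^ h) `^ g1).
have nB1 : n%:R / B <= 1.
  rewrite ler_pdivrMr// mul1r (le_trans nB)// ler_piMl//; exact: ltW.
have nBh : (n%:R / B) `^ h <= 1.
  apply: (@le_trans _ _ (1 `^ h)); last by rewrite powR1.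
  by apply: ge0_ler_powR; rewrite ?nnegrE ?divr_ge0//; exact: ltW.
have [nn0|nn0] := ltnP n n0.
  have mom t : mean P (fun w => (1 + V t w ^+ 4) *
      expR (4 * lam * n%:R * `|V t w|)) <= Dn.
    by apply: moment => //; apply: le_trans hlam; rewrite ler_peMr.
  apply: (le_trans (mgf_short u bV V0 l0 mom)).
  apply: (le_trans (expR_ge1Dx _)); rewrite ler_expR.
  have nn0R : n%:R <= n0%:R :> R by rewrite ler_nat ltnW.
  have DnK : n%:R ^+ 2 * Dn <= Kb.
    have le2 : n%:R ^+ 2 <= n0%:R ^+ 2 :> R by rewrite lerXn2r ?nnegrE.
    have Dn_ge0 : 0 <= Dn by rewrite mulr_ge0 ?expR_ge0// ltW.
    rewrite /Kb -mulrA; apply: (ler_pM (sqr_ge0 _) Dn_ge0 le2).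
    rewrite /Dn ler_pM2l// ler_expR ler_pM2l ?divr_gt0//.
    rewrite ge0_ler_powR ?nnegrE ?mulr_ge0 ?powR_ge0//; first exact: ltW.
    by apply: le_trans nn0R; rewrite ler_piMr.
  have -> : (lam * n%:R) ^+ 2 * n%:R * Dn = n%:R ^+ 2 * Dn * (lam ^+ 2 * n%:R).
    by rewrite exprMn; ring.
  rewrite -(mulrA (C * _)) ler_wpM2r ?mulr_ge0 ?sqr_ge0//.
  apply: (le_trans DnK); apply: (@le_trans _ _ C); first by rewrite lerDl ltW.
  by rewrite ler_peMr// ltW.
have [rho [delta [[/andP[d0 d1] nd] [rho0 rhon] [r1 r2] [r3 r4] grow]]] :=
  step n nn0 nB.
have rhoR : 0 < rho%:R :> R by rewrite ltr0n.
have n2 : (2 * 1 <= n)%N by apply: leq_trans rhon; rewrite leq_mul2l.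
have psi_low : 1 + 4 * delta <= psi n.
  have /andP[q1 _] := psi12 1 (le_trans n1R nB).
  by apply: le_trans (grow 1 isT n2); rewrite lerD2r.
have [->|lne0] := eqVneq lam 0.
  rewrite expr0n/= mulr0 mul0r expR0 (_ : (fun w => _) = fun=> 1) ?mean_cst//.
  by apply/funext => w; rewrite mul0r expR0.
have lpos : 0 < lam by rewrite lt0r lne0.
pose p := 1 + delta; have p0 : 0 < p by rewrite addr_gt0.
have Bpow : 0 <= (B / n%:R) `^ z by exact: powR_ge0.
have lam00 : 0 < lam0.
  have : 0 < lam0 * (B / n%:R) `^ z.
    by apply: lt_le_trans hlam; rewrite mulr_gt0// (lt_le_trans _ p1).
  by rewrite pmulr_lgt0// powR_gt0// divr_gt0.
have plam : p * lam <= lam0 * (B / n%:R) `^ z.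
  by apply: le_trans hlam; rewrite mulrC ler_pM2l// /p; clear - psi_low d0; lra.
have pl0 : 0 < p * lam by rewrite mulr_gt0.
pose Q := C * (psi n - 4 * delta).
have Q0 : 0 <= Q.
  by rewrite mulr_ge0 ?(ltW C0)//; clear - psi_low; lra.
have half v n' : (2 * n' <= n)%N ->
    mean P (fun w => expR (p * lam * psum V v n' w)) <=
    expR (Q * (p * lam) ^+ 2 * n'%:R).
  move=> n'n; have [->|n'0] := posnP n'; first by rewrite zero mulr0 expR0.
  have n'n' : (n' < n)%N.
    by apply: leq_trans n'n; rewrite mul2n -addnn -addn1 leq_add2l.
  have n'B : n'%:R <= kappa * B by apply: le_trans nB; rewrite ler_nat ltnW.
  have gr := grow n' n'0 n'n; have /andP[q1 q2] := psi12 n' n'B.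
  apply: (le_trans (ih n' n'n' v (p * lam) n'0 n'B (ltW pl0) _)).
    apply: (@le_trans _ _ (lam * psi n)).
      have -> : p * lam * psi n' = lam * (p * psi n') by ring.
      by rewrite ler_pM2l// /p; clear - d0 d1 gr q1 q2; nra.
    apply: (le_trans hlam); rewrite ler_pM2l// ge0_ler_powR ?nnegrE//.
    - exact: ltW.
    - by rewrite divr_ge0// ltW.
    - by rewrite divr_ge0// ltW.
    rewrite ler_pM2l// lef_pV2 ?posrE ?ltr0n// ler_nat; exact: ltnW.
  rewrite ler_expR ler_wpM2r// ler_wpM2r ?sqr_ge0// /Q ler_pM2l//; clear - gr; lra.
pose n1 := (n - rho)./2; pose n3 := (n - rho - n1)%N.
have [n13 h1n h3n] : [/\ (n1 + rho + n3 = n)%N, (2 * n1 <= n)%N &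
  (2 * n3 <= n)%N] := split_gap rho0 rhon.
pose X w := lam * psum V u n1 w + lam * psum V (u + n1 + rho) n3 w.
pose Y w := lam * psum V (u + n1) rho w.
have bS v k : bmeas (psum V v k) by exact: bmeas_psum.
have bX : bmeas X by rewrite /X; bmeas_tac.
have bY : bmeas Y by rewrite /Y; bmeas_tac.
have -> : (fun w => expR (lam * psum V u n w)) = (fun w => expR (X w + Y w)).
  apply/funext => w; congr expR.
  by rewrite -n13 psumD psumD addnA /X /Y; ring.
pose m := p * lam * n%:R ^+ 2 * Dn.
have Dn1 : 1 <= Dn.
  rewrite -[leLHS]mulr1; apply: ler_pM => //.
  by rewrite -expR0 ler_expR mulr_ge0 ?powR_ge0// divr_ge0// ltW.
have Dn0 : 0 < Dn by exact: lt_le_trans Dn1.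
have m0 : 0 < m.
  by rewrite /m (mulr_gt0 _ Dn0)// (mulr_gt0 pl0)// exprn_gt0.
have fourth v n' : (n' <= n)%N ->
    mean P (fun w => (expR (p * lam * psum V v n' w) - 1) ^+ 4) <= m ^+ 4.
  move=> n'n; have mom t : mean P (fun w => (1 + V t w ^+ 4) *
      expR (4 * (p * lam) * n%:R * `|V t w|)) <= Dn.
    by apply: moment => //; exact: ltW.
  apply: (le_trans (mgf_fourth v bV n'n (ltW pl0) mom)).
  have n'R : n'%:R <= n%:R :> R by rewrite ler_nat.
  have -> : m ^+ 4 = (p * lam) ^+ 4 * (n%:R ^+ 8 * Dn ^+ 4) by rewrite /m; ring.
  have -> : (p * lam * n'%:R) ^+ 4 * n'%:R * Dn =
    (p * lam) ^+ 4 * (n'%:R ^+ 5 * Dn) by ring.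
  rewrite ler_pM2l ?exprn_gt0//; apply: ler_pM.
  - exact: exprn_ge0.
  - exact: ltW.
  - apply: (@le_trans _ _ (n%:R ^+ 5)); first by rewrite lerXn2r ?nnegrE.
    by rewrite ler_weXn2l.
  - by rewrite ler_eXnr.
have X_le : mean P (fun w => expR (X w / p^-1)) <=
    expR (Q * (p * lam) ^+ 2 * (n1 + n3)%:R + Ke * lam ^+ 2).
  pose s := expR (c / 3 * rho%:R `^ g1).
  have s0 : 0 < s by exact: expR_gt0.
  have mix13 : mixed P (fun w => p * lam * psum V u n1 w)
      (fun w => p * lam * psum V (u + n1 + rho) n3 w)
      (expR (- (c * rho%:R `^ g1))).
    have mL : measurable_fun setT (fun x : R => p * lam * x).
      by apply: measurable_funM => //; exact: measurable_id.
    apply: (mixed_comp mL mL); apply: (alpha_mixed (k := u + n1) (l := rho) mix).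
      by apply: known_psum kV => t /andP[].
    by apply: known_psum kV => t /andP[].
  have bL v k : bmeas (fun w => p * lam * psum V v k w) by bmeas_tac.
  have Qn k : 0 <= Q * (p * lam) ^+ 2 * k%:R.
    by rewrite mulr_ge0// mulr_ge0// sqr_ge0.
  have := mgf_decouple (bL _ _) (bL _ _) mix13 (expR_ge0 _) m0 s0 (Qn n1) (Qn n3)
    (fourth u n1 _) (fourth _ n3 _) (half u n1 h1n) (half _ n3 h3n).
  have le_half k : (2 * k <= n)%N -> (k <= n)%N.
    by apply: leq_trans; rewrite leq_pmull.
  move=> /(_ (le_half _ h1n) (le_half _ h3n)).
  rewrite (_ : (fun w => expR (p * lam * psum V u n1 w + _)) =
      (fun w => expR (X w / p^-1))); last first.
    by apply/funext => w; congr expR; rewrite /X invrK; ring.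
  move=> /le_trans; apply; rewrite ler_expR natrD (mulrDr (Q * _)) lerD2l.
  (* By the choice of s both error terms equal 1 / s, where s is the mixing rate of
     the gap to the power - 1 / 3; the fourth moments Dn use half of it. *)
  have -> : s ^+ 2 * expR (- (c * rho%:R `^ g1)) + s^-1 = 2 * s^-1.
    have -> : s ^+ 2 * expR (- (c * rho%:R `^ g1)) = s^-1.
      rewrite /s -expRM_natl -expRD -expRN; congr expR.
      by field.
    by ring.
  set y := n%:R * (n%:R / B) `^ h in r1 *.
  have yg : y `^ g1 <= rho%:R `^ g1.
    by rewrite ge0_ler_powR ?nnegrE ?mulr_ge0 ?powR_ge0//; exact: ltW.
  have ng : n%:R `^ ((1 - h) * g1) <= rho%:R `^ g1.
    by rewrite powRrM ge0_ler_powR ?nnegrE ?powR_ge0//; exact: ltW.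
  have Dns : Dn ^+ 2 * s^-1 <= D ^+ 2 * expR (- (c / 6 * n%:R `^ ((1 - h) * g1))).
    rewrite /Dn exprMn -(mulrA (D ^+ 2)) ler_pM2l ?exprn_gt0//.
    rewrite -expRM_natl -expRN -expRD ler_expR -/y; clear - yg ng c0; nra.
  have -> : 4 * m ^+ 2 * (2 * s^-1) =
      8 * p ^+ 2 * lam ^+ 2 * (n%:R ^+ 4 * (Dn ^+ 2 * s^-1)).
    by rewrite /m; ring.
  have nE := decay n%:R n1R.
  have hE : n%:R ^+ 4 * (Dn ^+ 2 * s^-1) <= D ^+ 2 * E.
    apply: (le_trans (ler_wpM2l _ Dns)); first by rewrite exprn_ge0.
    by rewrite mulrCA ler_pM2l// exprn_gt0.
  have p4 : p ^+ 2 <= 4 by rewrite /p; clear - d0 d1; nra.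
  apply: (@le_trans _ _ (8 * p ^+ 2 * lam ^+ 2 * (D ^+ 2 * E))).
    apply: (ler_wpM2l _ hE).
    by rewrite mulr_ge0 ?sqr_ge0// mulr_ge0 ?sqr_ge0.
  have -> : Ke * lam ^+ 2 = 8 * 4 * lam ^+ 2 * (D ^+ 2 * E) by rewrite /Ke; ring.
  apply: ler_wpM2r; first by apply: mulr_ge0; [exact: sqr_ge0|exact: ltW].
  apply: ler_wpM2r; first exact: sqr_ge0.
  by rewrite ler_pM2l.
have t01 : 0 < p^-1 < 1.
  by rewrite invr_gt0 p0/= invf_lt1// /p ltrDl.
pose q := 1 + delta^-1.
have qE : 1 - p^-1 = q^-1.
  by rewrite /p /q; clear - d0; field; rewrite !gt_eqF//; lra.
have q0 : 0 < q by rewrite addr_gt0 ?invr_gt0.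
have qd : q * delta <= 2 by rewrite /q mulrDl mulVf ?gt_eqF//; clear - d1; lra.
have rn : (rho < n)%N.
  by apply: leq_trans rhon; rewrite mul2n -addnn -addn1 leq_add2l.
have rB : rho%:R <= kappa * B by apply: le_trans nB; rewrite ler_nat ltnW.
have Y_le : mean P (fun w => expR (Y w / (1 - p^-1))) <=
    expR (2 * C * (q * lam) ^+ 2 * rho%:R).
  rewrite qE (_ : (fun w => _) =
      (fun w => expR (q * lam * psum V (u + n1) rho w))); last first.
    by apply/funext => w; congr expR; rewrite /Y invrK; ring.
  have /andP[s1 s2] := psi12 rho rB.
  apply: (le_trans (ih rho rn (u + n1)%N (q * lam) rho0 rB _ _)).
  - by rewrite mulr_ge0// ltW.
  - set Br := (B / rho%:R) `^ z in r4 *; set Bn := (B / n%:R) `^ z in r4 hlam *.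
    have b1 : lam <= lam0 * Bn by apply: le_trans hlam; rewrite ler_peMr.
    have Br0 : 0 <= Br by exact: powR_ge0.
    rewrite -(ler_pM2l d0).
    apply: (@le_trans _ _ (4 * lam)).
      have -> : delta * (q * lam * psi rho) = q * delta * psi rho * lam by ring.
      rewrite ler_pM2r//; clear - qd s1 s2 q0 d0.
      have : 0 <= q * delta by rewrite mulr_ge0// ltW.
      by nra.
    apply: (@le_trans _ _ (lam0 * (4 * Bn))).
      by rewrite mulrCA ler_pM2l.
    by rewrite (mulrCA delta) ler_pM2l.
  - rewrite ler_expR ler_wpM2r// ler_wpM2r ?sqr_ge0// mulrC ler_wpM2r//.
    exact: ltW.
have unscale (r v : R) : 0 < r -> r * v / r = v.
  by move=> r0; rewrite mulrAC mulfV ?mul1r// gt_eqF.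
pose x := p^-1 * (Q * (p * lam) ^+ 2 * (n1 + n3)%:R + Ke * lam ^+ 2).
pose y := q^-1 * (2 * C * (q * lam) ^+ 2 * rho%:R).
have XY := mgf_young (P := P) (x := x) (y := y) t01 bX bY.
apply: (le_trans (XY _ _)).
- by rewrite /x unscale// invr_gt0.
- by rewrite [in leRHS]qE /y unscale// invr_gt0.
rewrite ler_expR.
have n13R : (n1 + n3)%:R <= n%:R :> R.
  by rewrite ler_nat -n13 addnAC leq_addr.
have xE : x <= lam ^+ 2 * (C * ((1 + delta) * (psi n - 4 * delta) + delta) * n%:R).
  have -> : x = lam ^+ 2 * (p * Q * (n1 + n3)%:R + p^-1 * Ke).
    by rewrite /x; field; rewrite gt_eqF.
  rewrite ler_wpM2l ?sqr_ge0//.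
  have -> : C * ((1 + delta) * (psi n - 4 * delta) + delta) * n%:R =
      p * Q * n%:R + C * (n%:R * delta) by rewrite /p /Q; ring.
  apply: lerD; first by rewrite ler_wpM2l// mulr_ge0// ltW.
  apply: (@le_trans _ _ (1 * Ke)).
    rewrite ler_wpM2r ?(ltW Ke0)//; apply/ltW; by case/andP: t01.
  rewrite mul1r; apply: (@le_trans _ _ C); first by rewrite /C lerDr (ltW Kb0).
  by rewrite ler_peMr// ltW.
have yE : y <= lam ^+ 2 * (C * delta * n%:R).
  have -> : y = lam ^+ 2 * (2 * C * q * rho%:R).
    by rewrite /y; field; rewrite gt_eqF.
  rewrite ler_wpM2l ?sqr_ge0//.
  rewrite -(ler_pM2l d0).
  have -> : delta * (2 * C * q * rho%:R) = C * (q * delta * (2 * rho%:R)) by ring.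
  have -> : delta * (C * delta * n%:R) = C * (delta ^+ 2 * n%:R) by ring.
  rewrite ler_pM2l//; clear - qd r3 rhoR; nra.
apply: (le_trans (lerD xE yE)).
rewrite -mulrDr.
have -> : C * psi n * lam ^+ 2 * n%:R = lam ^+ 2 * (C * psi n * n%:R) by ring.
rewrite ler_wpM2l ?sqr_ge0// -mulrDl ler_pM2r// -mulrDr ler_pM2l//.
clear - d0 d1 p2; nra.
Qed.

End recursion.

(** * Products over alternate blocks *)
Section capped_product.
Context {R : realType} d (Omega : measurableType d) (P : probability Omega R).
Context (Fam : nat -> set_system Omega).
Context (Fam_meas : forall t, Fam t `<=` measurable).
Implicit Types E : nat -> Omega -> R.

Definition below (H z : R) : R := z * \1_(`]-oo, H[) z.

Lemma measurable_below H : measurable_fun setT (below H).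
Proof.
apply: measurable_funM; first exact: measurable_id.
by apply: measurable_indic; exact: measurable_itv.
Qed.

Lemma belowE H z : below H z = if z < H then z else 0.
Proof.
rewrite /below indicE mem_setE in_itv/=.
by case: ifP => _; rewrite ?mulr1 ?mulr0.
Qed.

(** The partial products of the E j, replaced by H for ever from the first time
at which they reach H. In contrast to the products themselves they are bounded,
so that the covariance inequality applies at each step. *)
Fixpoint capped (H : R) E (k : nat) (w : Omega) : R :=
  if k is j.+1 then
    let z := capped H E j w in
    Num.min H (below H z * E j w) + (z - below H z)
  else 1.

Lemma capped_bound H E k w : 1 <= H -> (forall j w, 0 <= E j w) ->
  0 <= capped H E k w <= H.
Proof.
move=> H1 E0; elim: k => [|k]; first by rewrite /= ler01.
rewrite /= belowE; set z := capped _ _ _ _ => /andP[z0 zH].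
case: ltP => zH'; first by rewrite subrr addr0 ge_min lexx le_min mulr_ge0// andbT; lra.
have -> : Num.min H (0 * E k w) = 0 by rewrite mul0r min_r//; lra.
by rewrite add0r subr0 z0.
Qed.

Lemma capped_prod H E k w : 1 <= H -> (forall j w, 0 <= E j w) ->
  capped H E k w = H \/ capped H E k w = \prod_(j < k) E j w.
Proof.
move=> H1 E0; elim: k => [|k]; first by right; rewrite big_ord0.
have /andP[_ zH] := capped_bound k w H1 E0.
rewrite big_ord_recr /= belowE; case: ltP => zH'.
  move=> [h|<-]; first by move: zH'; rewrite h ltxx.
  rewrite subrr addr0 minEle; case: ifP => _; [by left|by right].
move=> _; left; rewrite mul0r min_r ?add0r ?subr0; last by lra.
by apply/eqP; rewrite eq_le zH.
Qed.

Lemma bmeas_below H (f : Omega -> R) : bmeas f -> bmeas (below H \o f).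
Proof.
move=> [mf [C fC]]; split; first exact: measurableT_comp (measurable_below H) mf.
exists C => w; rewrite /= belowE; case: ifP => _ //.
by rewrite normr0 (le_trans _ (fC w)).
Qed.

Lemma bmeas_min H (f : Omega -> R) : bmeas f -> bmeas (fun w => Num.min H (f w)).
Proof.
move=> [mf [C fC]]; split; first exact: measurable_minr.
exists (`|H| + C) => w; rewrite minEle; case: ifP => _.
  by rewrite lerDl (le_trans _ (fC w)).
by rewrite (le_trans (fC w))// lerDr.
Qed.

Lemma bmeas_capped H E k : (forall j, bmeas (E j)) -> bmeas (capped H E k).
Proof.
move=> bE; elim: k => [|k ih]; first exact: bmeas_cst.
apply: bmeasD; last by apply: bmeasB => //; exact: bmeas_below.
by apply: bmeas_min; apply: bmeasM => //; exact: bmeas_below.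
Qed.

Lemma known_capped H E k (st en : nat -> nat) :
  (forall j, known Fam [set t | (st j <= t < en j)%N] (E j)) ->
  (forall j, (en j <= en j.+1)%N) ->
  known Fam [set t | (t < en k)%N] (capped H E k.+1).
Proof.
move=> kE en_mono.
have kE' j : known Fam [set t | (t < en j)%N] (E j).
  by apply: sub_known (kE j) => t /andP[].
suff step j f : known Fam [set t | (t < en j)%N] f ->
    known Fam [set t | (t < en j)%N]
      (fun w => Num.min H (below H (f w) * E j w) + (f w - below H (f w))).
  elim: k => [|k ih]; first by apply: step; exact: measurable_cst.
  apply: step; apply: sub_known ih => t /= tk.
  exact: leq_trans tk (en_mono k).
move=> kf; have kb := known_comp (measurable_below H) kf.
apply: measurable_funD; last exact: (measurable_funB kf kb).
apply: measurable_minr; first exact: measurable_cst.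
exact: (measurable_funM kb (kE' j)).
Qed.

(** Markov's inequality for the frozen product. One step multiplies its mean by
at most m j, up to the covariance of a variable bounded by H and one bounded by
emax. Dividing by H, the errors lose their dependence on the threshold. *)
Lemma capped_tail (al : nat -> R) l E (st en : nat -> nat) (m : nat -> R)
    (emax H : R) (N : nat) :
  alpha_mixing P Fam al -> (forall l, 0 <= al l) ->
  (forall j, bmeas (E j)) ->
  (forall j, known Fam [set t | (st j <= t < en j)%N] (E j)) ->
  (forall j, (en j <= en j.+1)%N) -> (forall j, (en j + l <= st j.+1)%N) ->
  1 <= H -> 0 < emax -> (forall j w, 0 <= E j w <= emax) ->
  (forall j, mean P (E j) <= m j) -> (forall j, 1 <= m j) ->
  fine (P [set w | H < \prod_(j < N) E j w]) <=
    (\prod_(j < N) m j) * (H^-1 + N%:R * (4 * al l * emax)).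
Proof.
move=> mix al0 bE kE en_mono gap H1 emax0 E01 mE m1.
have E0 j w : 0 <= E j w by have /andP[] := E01 j w.
have H0 : 0 < H by exact: lt_le_trans H1.
pose err := 4 * H * emax * al l.
have err0 : 0 <= err by rewrite mulr_ge0// !mulr_ge0// ltW.
have bZ k : bmeas (capped H E k) by exact: bmeas_capped.
have prod1 k : 1 <= \prod_(j < k) m j.
  elim: k => [|k ih]; first by rewrite big_ord0.
  by rewrite big_ord_recr/= mulr_ege1.
have main k : mean P (capped H E k) <= (\prod_(j < k) m j) * (1 + k%:R * err).
  elim: k => [|k ih].
    by rewrite big_ord0 mul0r addr0 mulr1 mean_cst.
  pose U := below H \o capped H E k.
  have bU : bmeas U by exact: bmeas_below.
  have U0 w : 0 <= U w.
    by rewrite /U /= belowE; case: ifP => // _; have /andP[] := capped_bound k w H1 E0.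
  have UZ w : U w <= capped H E k w.
    have /andP[z0 _] := capped_bound k w H1 E0.
    by rewrite /U /= belowE; case: ifP.
  have UH w : `|U w| <= H.
    rewrite ger0_norm// (le_trans (UZ w))//.
    by have /andP[] := capped_bound k w H1 E0.
  have EM w : `|E k w| <= emax by rewrite ger0_norm//; have /andP[] := E01 k w.
  have cUE : cov P U (E k) <= err.
    apply: (le_trans (ler_norm _)).
    case: k {ih bZ bU U0 UZ} @U UH EM => [|k] U UH EM.
      by rewrite /U (cov_cstl P (below H 1) (bE 0%N)) normr0.
    apply: cov_bounded => //; first by exact: bmeas_below (bmeas_capped _ _ bE).
    apply: (alpha_mixed mix (k := en k)).
      apply: (known_comp (f := capped H E k.+1) (measurable_below H)).
      exact: (known_capped H kE en_mono).
    apply: sub_known (kE k.+1) => t /andP[+ _].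
    exact: leq_trans (gap k).
  apply: (@le_trans _ _ (mean P (fun w => U w * E k w + (capped H E k w - U w)))).
    apply: le_mean; [exact: bZ|by apply: bmeasD; [exact: bmeasM|exact: bmeasB]|].
    by move=> w /=; rewrite lerD2r ge_min lexx orbT.
  rewrite meanD; [|exact: bmeasM|exact: bmeasB].
  rewrite meanB//; move: cUE; rewrite /cov lerBlDr => cUE.
  have mU0 : 0 <= mean P U by exact: mean_ge0.
  have mUZ : mean P U <= mean P (capped H E k) by exact: le_mean.
  have mk := m1 k; have mEk := mE k.
  have step : mean P (fun w => U w * E k w) + (mean P (capped H E k) - mean P U)
      <= m k * mean P (capped H E k) + err.
    have : mean P U * mean P (E k) <= mean P U * m k by rewrite ler_wpM2l.
    have : 0 <= (m k - 1) * (mean P (capped H E k) - mean P U).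
      by rewrite mulr_ge0// subr_ge0.
    move: cUE; clear; nra.
  apply: (le_trans step).
  rewrite big_ord_recr/= -natr1.
  set p := \prod_(_ < _) _ in ih *; have p1 : 1 <= p by exact: prod1.
  have : m k * mean P (capped H E k) <= m k * (p * (1 + k%:R * err)).
    by rewrite ler_wpM2l// (le_trans _ mk).
  have : err <= p * m k * err.
    by rewrite ler_peMl// mulr_ege1.
  clear; lra.
have mprod : measurable_fun setT (fun w => \prod_(j < N) E j w).
  elim: (N) => [|n ih].
    rewrite (_ : (fun w => _) = fun=> 1); first exact: measurable_cst.
    by apply/funext => w; rewrite big_ord0.
  rewrite (_ : (fun w => _) = (fun w => (\prod_(j < n) E j w) * E n w)).
    by apply: measurable_funM => //; exact: (bE n).1.
  by apply/funext => w; rewrite big_ord_recr.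
have mA : measurable [set w | H < \prod_(j < N) E j w].
  exact: measurable_gt.
have HP : H * fine (P [set w | H < \prod_(j < N) E j w]) <= mean P (capped H E N).
  rewrite -mean_indic// -meanZ; last exact: bmeas_indic.
  apply: le_mean => //; first by apply/bmeasZ/bmeas_indic.
  move=> w; have /andP[z0 zH] := capped_bound N w H1 E0.
  rewrite indicE; case: (boolP (w \in _)); rewrite ?mulr0 ?mulr1// inE /=.
  by case: (capped_prod N w H1 E0) => ->// /ltW.
have := le_trans HP (main N).
rewrite -ler_pdivlMl// => /le_trans; apply.
rewrite mulrCA ler_wpM2l//; first by rewrite (le_trans _ (prod1 N)).
rewrite mulrDr mulr1 lerD2l /err le_eqVlt; apply/orP; left; apply/eqP.
by field; rewrite gt_eqF.
Qed.

End capped_product.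

Section block_tail.
Context {R : realType} d (Omega : measurableType d) (P : probability Omega R).
Context (Fam : nat -> set_system Omega).
Context (Fam_meas : forall t, Fam t `<=` measurable).

Lemma psum_blocks (V : nat -> Omega -> R) (b N : nat) w :
  psum V 0 (2 * N * b) w =
  \sum_(j < N) psum V (2 * j * b) b w + \sum_(j < N) psum V ((2 * j).+1 * b) b w.
Proof.
elim: N => [|N ih]; first by rewrite muln0 mul0n psum0 !big_ord0 addr0.
rewrite !big_ord_recr /= (_ : (2 * N.+1 * b = 2 * N * b + (b + b))%N); last lia.
rewrite psumD ih add0n psumD.
rewrite (_ : ((2 * N).+1 * b = 2 * N * b + b)%N); last lia.
ring.
Qed.

Let chain_tail (al : nat -> R) (V : nat -> Omega -> R) (M q lam x : R)
    (b N : nat) (off : nat) :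
  alpha_mixing P Fam al -> (forall l, 0 <= al l) ->
  (forall t, bmeas (V t)) -> (forall t, known Fam [set t] (V t)) ->
  (forall t w, `|V t w| <= M) -> 0 <= q -> 0 <= lam -> 0 <= x ->
  (forall u, mean P (fun w => expR (lam * psum V u b w)) <= expR (q * b%:R)) ->
  fine (P [set w | expR (lam * x) <
     \prod_(j < N) expR (lam * psum V ((2 * j + off) * b) b w)]) <=
    expR (q * (N * b)%:R) *
    (expR (- (lam * x)) + N%:R * (4 * al b * expR (lam * b%:R * M))).
Proof.
move=> mix al0 bV kV VM q0 l0 x0 mgf.
have SM u w : `|psum V u b w| <= b%:R * M.
  apply: (le_trans (ler_norm_sum _ _ _)).
  rewrite (_ : b%:R * M = \sum_(u <= t < u + b) M); first by apply: ler_sum.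
  by rewrite sumr_const_nat addKn mulr_natl.
have bS u : bmeas (psum V u b) by exact: bmeas_psum.
have := @capped_tail _ _ _ P Fam al b
  (fun j w => expR (lam * psum V ((2 * j + off) * b) b w))
  (fun j => (2 * j + off) * b)%N (fun j => (2 * j + off) * b + b)%N
  (fun=> expR (q * b%:R)) (expR (lam * b%:R * M)) (expR (lam * x)) N mix al0.
rewrite prodr_const card_ord -expRM_natl mulrCA natrM -expRN; apply.
- by move=> j; have := bS ((2 * j + off) * b)%N => ?; bmeas_tac.
- move=> j; apply: (@known_comp _ _ _ Fam _ (psum V ((2 * j + off) * b) b)
    (fun x => expR (lam * x))).
    apply: (measurableT_comp (@measurable_expR R)).
    by apply: measurable_funM => //; exact: measurable_id.
  exact: known_psum kV.
- by move=> j; rewrite leq_add2r leq_mul2r leq_add2r leq_mul2l leqnSn !orbT.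
- by move=> j; clear; nia.
- by rewrite -expR0 ler_expR mulr_ge0.
- exact: expR_gt0.
- move=> j w; rewrite expR_ge0/= ler_expR -mulrA ler_wpM2l//.
  exact: le_trans (ler_norm _) (SM _ w).
- by move=> j; exact: mgf.
- by move=> j; rewrite -expR0 ler_expR mulr_ge0.
Qed.

(** The even blocks are separated by the odd ones and conversely, so each of the
two sums is a sum over blocks with gaps of one block length. *)
Lemma block_tail (al : nat -> R) (V : nat -> Omega -> R) (M q lam x : R)
    (b N : nat) :
  alpha_mixing P Fam al -> (forall l, 0 <= al l) ->
  (forall t, bmeas (V t)) -> (forall t, known Fam [set t] (V t)) ->
  (forall t w, `|V t w| <= M) -> 0 <= q -> 0 < lam -> 0 <= x ->
  (forall u, mean P (fun w => expR (lam * psum V u b w)) <= expR (q * b%:R)) ->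
  fine (P [set w | 2 * x < psum V 0 (2 * N * b) w]) <=
    2 * (expR (q * (N * b)%:R) *
    (expR (- (lam * x)) + N%:R * (4 * al b * expR (lam * b%:R * M)))).
Proof.
move=> mix al0 bV kV VM q0 l0 x0 mgf.
have tail off := chain_tail N off mix al0 bV kV VM q0 (ltW l0) x0 mgf.
pose A off := [set w | expR (lam * x) <
  \prod_(j < N) expR (lam * psum V ((2 * j + off) * b) b w)].
have AE off w : A off w <-> x < \sum_(j < N) psum V ((2 * j + off) * b) b w.
  by rewrite /A /= -expR_sum ltr_expR -mulr_sumr ltr_pM2l.
have mS off : measurable_fun setT
    (fun w => \sum_(j < N) psum V ((2 * j + off) * b) b w).
  have : bmeas (fun w => \sum_(j < N) psum V ((2 * j + off) * b) b w).
    by apply: bmeas_sum => j _; exact: bmeas_psum.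
  by case.
have mA off : measurable (A off).
  rewrite (_ : A off = [set w | x < \sum_(j < N) psum V ((2 * j + off) * b) b w]).
    exact: measurable_gt.
  by apply/seteqP; split=> w /AE.
have mB : measurable [set w | 2 * x < psum V 0 (2 * N * b) w].
  by apply: measurable_gt; case: (bmeas_psum 0 (2 * N * b) bV).
have sub : [set w | 2 * x < psum V 0 (2 * N * b) w] `<=` A 0%N `|` A 1%N.
  move=> w /=; rewrite psum_blocks => h.
  have [h0|h0] := ltP x (\sum_(j < N) psum V ((2 * j + 0) * b) b w).
    by left; apply/AE.
  right; apply/AE.
  under eq_bigr do rewrite addn1.
  have : \sum_(j < N) psum V ((2 * j + 0) * b) b w =
      \sum_(j < N) psum V (2 * j * b) b w.
    by apply: eq_bigr => j _; rewrite addn0.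
  lra.
have fA off : P (A off) \is a fin_num by exact: fin_num_measure.
apply: (@le_trans _ _ (fine (P (A 0%N)) + fine (P (A 1%N)))).
  rewrite -fineD//; apply: fine_le; rewrite ?fin_numD ?fA//.
    exact: fin_num_measure.
  apply: (le_trans (le_measure P _ _ sub)); rewrite ?inE//.
    exact: measurableU.
  exact: measureU2.
by rewrite mulr_natl mulr2n; apply: lerD; exact: tail.
Qed.

End block_tail.

(** * Orders of magnitude of the parameters *)
Section scales.
Context {R : realType}.
Implicit Types L l K a b w : R.

Lemma powRD_pos (x r s : R) : 0 < x -> x `^ r * x `^ s = x `^ (r + s).
Proof. by move=> x0; rewrite powRD// (gt_eqF x0) implybT. Qed.

Lemma le_powR_nonpos (x y r : R) : 0 < x -> x <= y -> r <= 0 -> y `^ r <= x `^ r.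
Proof.
move=> x0 xy r0; have y0 : 0 < y by exact: lt_le_trans xy.
rewrite -(opprK r) !(powRN _ (- r)) lef_pV2 ?posrE ?powR_gt0//.
by rewrite ge0_ler_powR ?nnegrE ?oppr_ge0//; exact: ltW.
Qed.

(** The logarithm of T is absorbed in the constant: if ln T <= L the left side is
of the order of L `^ w, and otherwise it is a power of ln T, hence at most a
constant times the square root of T, with a constant below that root. *)
Lemma sample_size_dominates (L0 K a b w : R) : 0 < L0 -> 0 <= K ->
  0 <= a -> 0 <= b -> a + b <= w ->
  exists2 C : R, 0 < C & forall L T, L0 <= L -> 1 <= T ->
    C * L `^ w <= T -> K * (L `^ a * (L + ln T) `^ b) <= T.
Proof.
move=> L00 K0 a0 b0 abw.
have w0 : 0 <= w by apply: le_trans abw; rewrite addr_ge0.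
pose K' := K * (2 `^ b * L0 `^ (a + b - w)).
have K'0 : 0 <= K' by rewrite !mulr_ge0 ?powR_ge0.
pose k := (Num.trunc w).+1.
have wk : w <= k%:R.
  by have := truncn_itv w0 => /andP[_ /ltW].
have half0 : 0 < 2^-1 :> R by rewrite invr_gt0.
have [E E0 decay] := powR_exp_decay k half0 ltr01.
pose K'' := K' * (E * expR 2^-1).
have K''0 : 0 <= K'' by rewrite mulr_ge0// mulr_ge0 ?expR_ge0// ltW.
pose C := K' + 1 + K'' ^+ 2 / L0 `^ w.
have C0 : 0 < C.
  by rewrite ltr_wpDr ?divr_ge0 ?sqr_ge0 ?powR_ge0// ltr_wpDl.
exists C => // L T L0L T1 CT.
have L_gt0 : 0 < L by exact: lt_le_trans L0L.
have T0 : 0 < T by exact: lt_le_trans T1.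
have lnT0 : 0 <= ln T by exact: ln_ge0.
pose m := Num.max L (ln T).
have Lm : L <= m by rewrite le_max lexx.
have m0 : 0 < m by exact: lt_le_trans Lm.
have step : K * (L `^ a * (L + ln T) `^ b) <= K' * m `^ w.
  have h1 : L `^ a <= m `^ a by rewrite ge0_ler_powR ?nnegrE// ltW.
  have h2 : (L + ln T) `^ b <= 2 `^ b * m `^ b.
    rewrite -powRM//; last exact: ltW.
    rewrite ge0_ler_powR ?nnegrE ?addr_ge0 ?mulr_ge0//; try exact: ltW.
    by rewrite mulr2n mulrDl mul1r lerD// le_max lexx orbT.
  have h3 : m `^ (a + b) <= L0 `^ (a + b - w) * m `^ w.
    have -> : m `^ (a + b) = m `^ (a + b - w) * m `^ w.
      by rewrite powRD_pos// subrK.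
    rewrite ler_wpM2r ?powR_ge0// le_powR_nonpos ?subr_le0//.
    exact: le_trans Lm.
  rewrite /K' -!mulrA ler_wpM2l//.
  apply: (le_trans (ler_pM (powR_ge0 _ _) (powR_ge0 _ _) h1 h2)).
  by rewrite mulrCA ler_wpM2l ?powR_ge0// powRD_pos.
apply: (le_trans step).
have [lnTL|LlnT] := leP (ln T) L.
  have -> : m = L by rewrite /m max_l.
  apply: le_trans CT; rewrite ler_wpM2r ?powR_ge0// /C -addrA lerDl.
  by rewrite addr_ge0 ?divr_ge0 ?sqr_ge0 ?powR_ge0.
have -> : m = ln T by rewrite /m max_r// ltW.
pose s := expR (2^-1 * ln T).
have sT : s ^+ 2 = T.
  by rewrite /s -expRM_natl mulrA mulfV// mul1r lnK.
have K''s : K'' <= s.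
  have : K'' ^+ 2 <= s ^+ 2.
    rewrite sT; apply: le_trans CT.
    apply: (@le_trans _ _ (K'' ^+ 2 / L0 `^ w * L `^ w)); last first.
      by rewrite ler_wpM2r ?powR_ge0// /C lerDr addr_ge0.
    rewrite mulrAC -mulrA ler_peMr ?sqr_ge0// ler_pdivlMr ?powR_gt0// mul1r.
    by rewrite ge0_ler_powR ?nnegrE// ltW.
  by rewrite ler_pXn2r ?nnegrE ?expR_ge0.
have y1 : 1 <= 1 + ln T by rewrite lerDl.
have hdec := decay _ y1.
have : ln T `^ w <= E * expR 2^-1 * s.
  apply: (@le_trans _ _ ((1 + ln T) ^+ k)).
    apply: (@le_trans _ _ ((1 + ln T) `^ w)).
      by rewrite ge0_ler_powR ?nnegrE ?addr_ge0// lerDr.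
    rewrite -powR_mulrn; last by rewrite addr_ge0.
    by rewrite ler_powR.
  move: hdec; rewrite powRr1 ?addr_ge0// expRN ler_pdivrMr ?expR_gt0//.
  by rewrite mulrDr mulr1 expRD mulrA.
move=> /(ler_wpM2l K'0) /le_trans; apply.
rewrite mulrA -sT expr2.
apply: ler_wpM2r; first exact: expR_ge0.
exact: K''s.
Qed.

(** Here u stands for a truncated variable and v for its centred version, whose
n-fold repetition must be affordable: half of the exponential moment and a small
fraction of the mixing rate over n (n/B)^z terms have to dominate 4 lam n v.
If a <= 1, then u <= M^(1 - a) u^a, and the exponential moment suffices.
If a > 1, Young's inequality leaves (lam n)^a', with a' conjugate to a, and
this is at most a multiple of the mixing rate, because the choice of z makes
(1 - z) a' >= (1 + z) g1. Such a z > 0 exists since the hypothesis on g1 and a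
says that g1 (1 - 1/a) < 1. The first conclusion bounds the exponent of a whole
block of variables bounded by 2 M. *)
Lemma exponent_bound (c g1 a k1 K1 K2 m0 L0 : R) :
  0 < c -> 0 < g1 -> 0 < a -> 0 < k1 -> 0 < K1 -> 0 < K2 -> 0 <= m0 ->
  0 < L0 -> 1 < g1^-1 + a^-1 ->
  let z := if a <= 1 then 2^-1 else (1 - g1 * (1 - a^-1)) / 2 in
  0 < z <= 2^-1 /\
  exists2 K3 : R, 0 < K3 & forall l, L0 <= l ->
    let B := K2 * l `^ g1^-1 in let M := (K1 * l) `^ a^-1 in
    let lam0 := K3 * l `^ (1 - (g1^-1 + a^-1)) in
    2 * lam0 * B * M <= l /\
    forall n lam u v, 0 < n -> n <= B -> 0 <= lam ->
      lam <= lam0 * (B / n) `^ z ->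
      0 <= u -> u <= M -> v <= u + m0 ->
      4 * lam * n * v <=
        k1 / 2 * u `^ a + 1 + c / 12 * (n * (n / B) `^ z) `^ g1.
Proof.
move=> c0 g0 a0 k0 K10 K20 m00 L00 ga z.
have wlt : g1 * (1 - a^-1) < 1.
  by rewrite mulrC -ltr_pdivlMr// div1r; lra.
have z01 : 0 < z <= 2^-1.
  rewrite /z; have [a1|a1] := leP a 1; first by apply/andP; split; lra.
  have ai : a^-1 < 1 by rewrite invf_lt1.
  have h2 : 0 < g1 * (1 - a^-1) by rewrite mulr_gt0// subr_gt0.
  by clear - wlt h2; apply/andP; split; lra.
split=> //; have /andP[z0 z1] := z01.
pose a' := a / (a - 1); pose eps := (k1 / 2) `^ a^-1.
pose Y := eps `^ (- a') + (m0 + 1) `^ a'.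
pose t1 := k1 / (8 * K2 * K1 `^ (a^-1 - 1)).
pose t2 := 1 / (4 * K2 * (m0 + 1) * L0 `^ (1 - a^-1)).
pose t3 := (c / 12 * K2 `^ g1 / Y) `^ a'^-1 / (4 * K2).
pose t4 := 1 / (2 * K2 * K1 `^ a^-1).
(* t1 and t2 serve for a <= 1, t3 for a > 1, and t4 for the block of bounded
   variables. *)
pose K3 := Num.min (Num.min t1 t2) (Num.min t3 t4).
have eps0 : 0 < eps by rewrite powR_gt0// divr_gt0.
have m1 : 0 < m0 + 1 by rewrite ltr_wpDl.
have Y0 : 0 < Y by rewrite addr_gt0// powR_gt0.
have cK : 0 < c / 12 * K2 `^ g1 by rewrite mulr_gt0 ?powR_gt0// divr_gt0.
have d1 : 0 < 8 * K2 * K1 `^ (a^-1 - 1) by rewrite !mulr_gt0// powR_gt0.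
have d2 : 0 < 4 * K2 * (m0 + 1) * L0 `^ (1 - a^-1).
  by rewrite !mulr_gt0 ?powR_gt0.
have d3 : 0 < 4 * K2 by rewrite mulr_gt0.
have d4 : 0 < 2 * K2 * K1 `^ a^-1 by rewrite !mulr_gt0// powR_gt0.
have K30 : 0 < K3.
  by rewrite !lt_min /t1 /t2 /t3 /t4 !divr_gt0// powR_gt0// divr_gt0.
have [K31 K32 K33 K34] : [/\ K3 <= t1, K3 <= t2, K3 <= t3 & K3 <= t4].
  by split; rewrite /K3 !ge_min lexx ?orbT.
move: K31 K32 K33 K34; rewrite /t1 /t2 /t3 /t4.
rewrite !ler_pdivlMr// => K31 K32 K33 K34.
exists K3; first exact: K30.
move=> l l0; set B := K2 * _; set M := (K1 * l) `^ _; set lam0 := K3 * _.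
have l_gt0 : 0 < l by exact: lt_le_trans l0.
have B0 : 0 < B by rewrite mulr_gt0// powR_gt0.
have lamB : lam0 * B = K3 * K2 * l `^ (1 - a^-1).
  rewrite /lam0 /B mulrACA powRD_pos//; congr (_ * _ `^ _); ring.
have ME : M = K1 `^ a^-1 * l `^ a^-1 by rewrite /M powRM//; exact: ltW.
have lamBM : lam0 * B * M = K3 * K2 * K1 `^ a^-1 * l.
  rewrite lamB ME mulrACA -mulrA powRD_pos// subrK powRr1 ?mulrA//.
  exact: ltW.
split.
  have -> : 2 * lam0 * B * M = K3 * (2 * K2 * K1 `^ a^-1) * l.
    by transitivity (2 * (lam0 * B * M)); [ring|rewrite lamBM; ring].
  by rewrite -[leRHS]mul1r ler_pM2r.
move=> n lam u v n0 nB lam_ge0 hlam u0 uM vu.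
pose r := n / B; have r0 : 0 < r by rewrite divr_gt0.
have r1 : r <= 1 by rewrite ler_pdivrMr// mul1r.
have nr : n = B * r by rewrite /r mulrCA mulfV ?mulr1// gt_eqF.
have lamn : lam * n <= K3 * K2 * l `^ (1 - a^-1) * r `^ (1 - z).
  have Bn : (B / n) `^ z = r `^ (- z).
    by rewrite powRN -[B / n]invrK invf_div -/r -powR_inv1 ?ltW// -powRrM mulN1r powRN.
  rewrite -lamB nr; apply: (@le_trans _ _ (lam0 * r `^ (- z) * (B * r))).
    by rewrite ler_wpM2r -?Bn// mulr_ge0// ltW.
  rewrite mulrACA -[X in _ * X <= _](_ : r `^ (- z) * r `^ 1 = _).
    by rewrite powRD_pos// addrC.
  by rewrite powRr1// ltW.
have lamn0 : 0 <= lam * n by rewrite mulr_ge0// ltW.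
have -> : 4 * lam * n * v = 4 * (lam * n) * v by ring.
have {vu} : 4 * (lam * n) * v <= 4 * (lam * n) * (u + m0).
  by rewrite ler_wpM2l// mulr_ge0.
move/le_trans; apply.
have E0 : 0 <= c / 12 * (n * (n / B) `^ z) `^ g1.
  by rewrite mulr_ge0 ?powR_ge0// divr_ge0// ltW.
have U0 : 0 <= k1 / 2 * u `^ a by rewrite mulr_ge0 ?powR_ge0// divr_ge0// ltW.
have [a1|a1] := leP a 1; last first.
  (* eps is the scale for which Young's inequality produces exactly k1 / 2 u^a. *)
  have zE : z = (1 - g1 * (1 - a^-1)) / 2 by rewrite /z leNgt a1.
  have a10 : 0 < a - 1 by rewrite subr_gt0.
  have a'0 : 0 < a' by rewrite divr_gt0.
  have conj : a^-1 + a'^-1 = 1 by rewrite /a' invf_div; field; rewrite gt_eqF.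
  pose th := 4 * (lam * n); have th0 : 0 <= th by rewrite mulr_ge0.
  have young x y : 0 <= x -> 0 <= y -> x * y <= x `^ a + y `^ a'.
    move=> x0 y0; apply: (le_trans (conjugate_powR x0 y0 a0 a'0 conj)).
    have ai : a^-1 <= 1 by rewrite invf_le1// ltW.
    have a'i : a'^-1 <= 1 by rewrite -conj lerDr invr_ge0 ltW.
    by apply: lerD; apply: ler_piMr => //; exact: powR_ge0.
  have hu : th * u <= k1 / 2 * u `^ a + eps `^ (- a') * th `^ a'.
    have -> : th * u = (eps * u) * (eps^-1 * th) by field; rewrite gt_eqF.
    apply: (le_trans (young _ _ _ _)); first by rewrite mulr_ge0// ltW.
      by rewrite mulr_ge0// invr_ge0 ltW.
    rewrite !powRM ?invr_ge0//; try exact: ltW.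
    rewrite /eps -!powRrM mulVf ?gt_eqF// powRr1; last by rewrite divr_ge0// ltW.
    by rewrite -/eps lerD2l -powR_inv1 ?(ltW eps0)// -!powRrM mulN1r.
  have hm : th * m0 <= 1 + (m0 + 1) `^ a' * th `^ a'.
    apply: (@le_trans _ _ (1 * ((m0 + 1) * th))).
      by rewrite mul1r mulrC ler_wpM2r// lerDl.
    apply: (le_trans (young _ _ _ _)) => //; first by rewrite mulr_ge0// ltW.
    by rewrite powR1 powRM// ltW.
  have hth : th <= 4 * K2 * K3 * (l `^ (1 - a^-1) * r `^ (1 - z)).
    rewrite /th (_ : 4 * K2 * K3 * _ = 4 * (K3 * K2 * l `^ (1 - a^-1) * r `^ (1 - z))).
      by rewrite ler_pM2l.
    by ring.
  have la : l `^ (1 - a^-1) `^ a' = l.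
    rewrite -powRrM (_ : (1 - a^-1) * a' = 1) ?powRr1//; first exact: ltW.
    by rewrite /a'; field; rewrite !gt_eqF.
  have hth' : th `^ a' <= (c / 12 * K2 `^ g1 / Y) * (l * r `^ ((1 - z) * a')).
    apply: (@le_trans _ _ ((4 * K2 * K3 * (l `^ (1 - a^-1) * r `^ (1 - z))) `^ a')).
      rewrite ge0_ler_powR ?nnegrE//; first exact: ltW.
      by rewrite !mulr_ge0 ?powR_ge0// ltW.
    rewrite powRM ?mulr_ge0 ?powR_ge0//; try exact: ltW.
    rewrite [X in _ * X <= _]powRM ?powR_ge0// la -powRrM.
    rewrite ler_wpM2r ?mulr_ge0 ?powR_ge0//; first exact: ltW.
    apply: (@le_trans _ _ (((c / 12 * K2 `^ g1 / Y) `^ a'^-1) `^ a')).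
      rewrite ge0_ler_powR ?nnegrE ?powR_ge0//; first exact: ltW.
        by rewrite !mulr_ge0// ltW.
      by rewrite mulrC.
    by rewrite -powRrM mulVf ?gt_eqF// powRr1// divr_ge0// ltW.
  have -> : (n * (n / B) `^ z) `^ g1 = K2 `^ g1 * l * r `^ ((1 + z) * g1).
    have -> : n * (n / B) `^ z = B * r `^ (1 + z).
      by rewrite -/r [in LHS]nr -mulrA -powRD_pos// powRr1// ltW.
    rewrite powRM ?powR_ge0//; last exact: ltW.
    rewrite /B powRM ?powR_ge0//; last exact: ltW.
    by rewrite -!powRrM mulVf ?gt_eqF// powRr1// ltW.
  have rr : r `^ ((1 - z) * a') <= r `^ ((1 + z) * g1).
    rewrite ger_powR ?r0//.
    have -> : (1 + z) * g1 = (1 + z) * (g1 * (1 - a^-1)) * a'.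
      by rewrite /a'; field; rewrite !gt_eqF.
    rewrite ler_pM2r//.
    rewrite zE; set w := g1 * _.
    have w0 : 0 < w by rewrite /w mulr_gt0// subr_gt0 invf_lt1.
    have w1 : w < 1 by exact: wlt.
    by clear - w0 w1; nra.
  have hY : Y * th `^ a' <= c / 12 * (K2 `^ g1 * l * r `^ ((1 + z) * g1)).
    apply: (@le_trans _ _ (Y * ((c / 12 * K2 `^ g1 / Y) * (l * r `^ ((1 - z) * a'))))).
      by rewrite ler_pM2l.
    have -> : Y * (c / 12 * K2 `^ g1 / Y * (l * r `^ ((1 - z) * a'))) =
        c / 12 * (K2 `^ g1 * l * r `^ ((1 - z) * a')) by field; rewrite gt_eqF.
    by rewrite ler_pM2l ?divr_gt0// ler_pM2l// mulr_gt0// powR_gt0.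
  rewrite -/th mulrDr.
  move: hY; rewrite /Y mulrDl => hY; clear - hu hm hY; lra.
(* For a <= 1 the bound u <= M^(1 - a) u^a makes 4 lam n u a fraction of k1 u^a. *)
have lamn2 : lam * n <= K3 * K2 * l `^ (1 - a^-1).
  apply: (le_trans lamn); rewrite ler_piMr//.
    by rewrite !mulr_ge0 ?powR_ge0// ltW.
  by rewrite -[leRHS](powRr0 r) ger_powR ?r0//; clear - z1; lra.
have uu : u <= u `^ a * (K1 `^ (a^-1 - 1) * l `^ (a^-1 - 1)).
  have [->|un0] := eqVneq u 0; first by rewrite !mulr_ge0 ?powR_ge0.
  have u_gt0 : 0 < u by rewrite lt0r un0.
  have {1}-> : u = u `^ a * u `^ (1 - a).
    by rewrite powRD_pos// addrC subrK powRr1.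
  rewrite ler_pM2l ?powR_gt0//.
  apply: (@le_trans _ _ (M `^ (1 - a))).
    by rewrite ge0_ler_powR ?nnegrE ?subr_ge0 ?powR_ge0//; exact: ltW.
  rewrite /M -powRrM mulrBr mulr1 mulVf ?gt_eqF// powRM//; exact: ltW.
apply: (@le_trans _ _ (4 * (K3 * K2 * l `^ (1 - a^-1) *
    (u `^ a * (K1 `^ (a^-1 - 1) * l `^ (a^-1 - 1)) + m0)))).
  rewrite -mulrA ler_pM2l//; apply: ler_pM => //; first by rewrite addr_ge0.
  by rewrite lerD2r.
have ll : l `^ (1 - a^-1) * l `^ (a^-1 - 1) = 1.
  rewrite powRD_pos//; have -> : 1 - a^-1 + (a^-1 - 1) = 0 by ring.
  by rewrite powRr0.
have -> : 4 * (K3 * K2 * l `^ (1 - a^-1) *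
    (u `^ a * (K1 `^ (a^-1 - 1) * l `^ (a^-1 - 1)) + m0)) =
  (K3 * (8 * K2 * K1 `^ (a^-1 - 1))) / 2 * u `^ a *
    (l `^ (1 - a^-1) * l `^ (a^-1 - 1)) +
  K3 * (4 * K2 * m0 * l `^ (1 - a^-1)) by field.
rewrite ll mulr1.
have p1 : K3 * (8 * K2 * K1 `^ (a^-1 - 1)) / 2 * u `^ a <= k1 / 2 * u `^ a.
  by rewrite ler_wpM2r ?powR_ge0// ler_wpM2r.
have p2 : K3 * (4 * K2 * m0 * l `^ (1 - a^-1)) <= 1.
  apply: le_trans K32; rewrite ler_pM2l//; apply: ler_pM.
  - by rewrite !mulr_ge0// ltW.
  - exact: powR_ge0.
  - by rewrite ler_pM2l ?mulr_gt0// lerDl.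
  - by rewrite le_powR_nonpos// subr_le0 invf_ge1.
by clear - p1 p2 E0; lra.
Qed.

End scales.

(** * Truncation *)
Section truncation.
Context {R : realType} d (Omega : measurableType d) (P : probability Omega R).

Lemma mean_le_moment (f W : Omega -> R) (K D : R) :
  bmeas f -> measurable_fun setT W -> 0 <= K -> (forall w, 0 <= f w) ->
  (forall w, 0 <= W w) -> (forall w, f w <= K * W w) ->
  (\int[P]_w (W w)%:E <= D%:E)%E -> mean P f <= K * D.
Proof.
move=> bf mW K0 f0 W0 fW WD; rewrite -lee_fin -mean_fin// EFinM.
apply: (@le_trans _ _ (K%:E * \int[P]_w (W w)%:E)%E); last first.
  by rewrite lee_wpmul2l ?lee_fin.
have mEW : measurable_fun setT (EFin \o W) by apply/measurable_EFinP.
rewrite -ge0_integralZl//=; last by move=> w _; rewrite lee_fin.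
apply: ge0_le_integral => //=.
- by move=> w _; rewrite lee_fin.
- by apply/measurable_EFinP; exact: bf.1.
- by apply: emeasurable_funM => //; exact: measurable_cst.
- by move=> w _; rewrite -EFinM lee_fin.
Qed.

Definition cutoff (M x : R) : R := x * \1_(`[- M, M]) x.

Lemma cutoffE M x : cutoff M x = if `|x| <= M then x else 0.
Proof.
rewrite /cutoff indicE mem_setE in_itv/= -ler_norml.
by case: ifP => _; rewrite ?mulr1 ?mulr0.
Qed.

Lemma measurable_cutoff M : measurable_fun setT (cutoff M).
Proof.
apply: measurable_funM; first exact: measurable_id.
by apply: measurable_indic; exact: measurable_itv.
Qed.

Lemma cutoff_bound M x : 0 <= M -> `|cutoff M x| <= M.
Proof. by move=> M0; rewrite cutoffE; case: ifP => //; rewrite normr0. Qed.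

Lemma cutoff_le M x : `|cutoff M x| <= `|x|.
Proof. by rewrite cutoffE; case: ifP => //; rewrite normr0. Qed.

Lemma bmeas_cutoff M (U : Omega -> R) : 0 <= M -> measurable_fun setT U ->
  bmeas (cutoff M \o U).
Proof.
move=> M0 mU; split; first exact: measurableT_comp (measurable_cutoff M) mU.
by exists M => w; exact: cutoff_bound.
Qed.

Lemma poly4_le_exp (k1 a : R) : 0 < k1 -> 0 < a -> exists2 C : R, 1 <= C &
  forall x, 0 <= x -> (1 + x) ^+ 4 <= C * expR (k1 / 2 * x `^ a).
Proof.
move=> k0 a0; have k20 : 0 < k1 / 2 by rewrite divr_gt0.
have [E E0 decay] := powR_exp_decay 4 k20 a0.
exists (16 * (1 + E)); first by lra.
move=> x x0; have e1 : 1 <= expR (k1 / 2 * x `^ a).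
  by rewrite -[leLHS]expR0 ler_expR mulr_ge0 ?powR_ge0// ltW.
have [x1|x1] := leP x 1.
  apply: (@le_trans _ _ (2 ^+ 4)).
    by rewrite lerXn2r ?nnegrE ?addr_ge0//; lra.
  apply: (@le_trans _ _ (16 * (1 + E) * 1)); first by rewrite !exprS expr0; lra.
  by rewrite ler_wpM2l// mulr_ge0// addr_ge0// ltW.
apply: (@le_trans _ _ ((2 * x) ^+ 4)).
  by rewrite lerXn2r ?nnegrE ?addr_ge0 ?mulr_ge0//; lra.
have := decay x (ltW x1); rewrite expRN ler_pdivrMr ?expR_gt0// => h.
rewrite exprMn (_ : 2 ^+ 4 = 16); last by rewrite !exprS expr0; ring.
rewrite -mulrA ler_pM2l//; apply: (le_trans h).
by rewrite ler_wpM2r ?expR_ge0// lerDr.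
Qed.

Section moments.
Context (k1 a C D : R) (k0 : 0 < k1) (a0 : 0 < a) (C1 : 1 <= C).
Context (poly : forall x, 0 <= x -> (1 + x) ^+ 4 <= C * expR (k1 / 2 * x `^ a)).
Context (U : Omega -> R) (mU : measurable_fun setT U).
Context (UD : (\int[P]_w (expR (k1 * `|U w| `^ a))%:E <= D%:E)%E).

Let W w := expR (k1 * `|U w| `^ a).

Let mW : measurable_fun setT W.
Proof.
apply: (measurableT_comp (@measurable_expR R)).
apply: measurable_funM; first exact: measurable_cst.
apply: (measurableT_comp (measurable_powR _)).
exact: measurableT_comp.
Qed.

Let C0 : 0 <= C. Proof. exact: le_trans C1. Qed.

Let le_poly x : 0 <= x -> x <= C * expR (k1 / 2 * x `^ a).
Proof.
move=> x0; apply: le_trans (poly x0).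
apply: (@le_trans _ _ (1 + x)); first by rewrite lerDr.
by rewrite ler_eXnr// lerDl.
Qed.

Let le_W x w : 0 <= x -> x <= `|U w| -> expR (k1 / 2 * x `^ a) <= W w.
Proof.
move=> x0 xU; rewrite ler_expR; apply: ler_pM; rewrite ?powR_ge0//.
- by rewrite divr_ge0// ltW.
- by have := k0; lra.
- by rewrite ge0_ler_powR ?nnegrE// ltW.
Qed.

Lemma mean_cutoff_le M : 0 <= M -> `|mean P (cutoff M \o U)| <= C * D.
Proof.
move=> M0; have bc := bmeas_cutoff M0 mU.
apply: (le_trans (ler_norm_mean P bc)).
apply: (mean_le_moment (W := W)) => //; first exact: bmeas_norm.
- by move=> w; exact: expR_ge0.
- move=> w /=; apply: (le_trans (le_poly (normr_ge0 _))).
  by rewrite ler_wpM2l// le_W// cutoff_le.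
Qed.

Let le_tail M w : 0 <= M -> M < `|U w| ->
  `|U w| <= C * expR (- (k1 / 2 * M `^ a)) * W w.
Proof.
move=> M0 MU; apply: (le_trans (le_poly (normr_ge0 _))).
rewrite -(mulrA C) ler_wpM2l// /W -expRD ler_expR.
have : M `^ a <= `|U w| `^ a by rewrite ge0_ler_powR ?nnegrE// ltW.
move=> h; have : k1 / 2 * M `^ a <= k1 / 2 * `|U w| `^ a.
  by rewrite ler_pM2l// divr_gt0.
by lra.
Qed.

(** As U is centred, the bias is minus the mean of U over the event M < |U|,
where half of the exponential moment yields the small factor and the other half
pays for the integrand. *)
Lemma cutoff_bias M : 0 <= M -> (\int[P]_w (U w)%:E = 0)%E ->
  `|mean P (cutoff M \o U)| <= C * expR (- (k1 / 2 * M `^ a)) * D.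
Proof.
move=> M0 U0; have bc := bmeas_cutoff M0 mU.
have CM0 : 0 <= C * expR (- (k1 / 2 * M `^ a)) by rewrite mulr_ge0 ?expR_ge0.
have WD : P.-integrable setT (EFin \o W).
  apply/integrableP; split; first exact/measurable_EFinP.
  apply: (@le_lt_trans _ _ D%:E); last exact: ltry.
  rewrite (_ : (\int[P]_x `|(EFin \o W) x|)%E = (\int[P]_x (W x)%:E)%E)//.
  by apply: eq_integral => x _; rewrite /= ger0_norm ?expR_ge0.
have dom (f : Omega -> R) K : measurable_fun setT f -> 0 <= K ->
    (forall w, `|f w| <= K * W w) -> P.-integrable setT (EFin \o f).
  move=> mf K0 fK.
  have iKW : P.-integrable setT (EFin \o (fun w => K * W w)).
    rewrite (_ : _ \o _ = (fun w => K%:E * (W w)%:E)%E); last first.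
      by apply/funext => w; rewrite /= EFinM.
    exact: integrableZl.
  apply: (le_integrable measurableT _ _ iKW); first exact/measurable_EFinP.
  by move=> w _; rewrite /= lee_fin; exact: le_trans (fK w) (ler_norm _).
have iU : P.-integrable setT (EFin \o U).
  apply: (dom _ C) => // w; apply: (le_trans (le_poly (normr_ge0 _))).
  by rewrite ler_wpM2l// le_W.
pose g w := U w - cutoff M (U w).
have mg : measurable_fun setT g by apply: measurable_funB => //; exact: bc.1.
have gE w : g w = if `|U w| <= M then 0 else U w.
  by rewrite /g cutoffE; case: ifP => _; rewrite ?subrr ?subr0.
have gW w : `|g w| <= C * expR (- (k1 / 2 * M `^ a)) * W w.
  rewrite gE; have [h|h] := leP `|U w| M; last exact: le_tail.
  by rewrite normr0 mulr_ge0// expR_ge0.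
have ig : P.-integrable setT (EFin \o g) by exact: dom gW.
have -> : mean P (cutoff M \o U) = - \int[P]_w g w.
  rewrite /g RintegralB//; last exact: bmeas_integrable.
  by rewrite /Rintegral U0 /= opprB subr0.
rewrite normrN; apply: (le_trans (le_normr_Rintegral measurableT ig)).
rewrite -lee_fin /Rintegral.
have fin : (\int[P]_w (`|g w|)%:E)%E \is a fin_num.
  apply: integrable_fin_num => //.
  rewrite (_ : (fun w => _) = abse \o (EFin \o g))//.
  exact: integrable_abse.
rewrite fineK//.
apply: (@le_trans _ _ (\int[P]_w
    ((C * expR (- (k1 / 2 * M `^ a)))%:E * (W w)%:E))%E).
  apply: ge0_le_integral => //=.
  - exact/measurable_EFinP/measurableT_comp.
  - by apply: emeasurable_funM => //; exact/measurable_EFinP.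
  - by move=> w _; rewrite -EFinM lee_fin gW.
rewrite ge0_integralZl//=; last 2 first.
- exact/measurable_EFinP.
- by move=> w _; rewrite lee_fin expR_ge0.
by rewrite (EFinM _ D) lee_wpmul2l ?lee_fin.
Qed.

Lemma tail_prob M : 0 <= M ->
  mean P (\1_[set w | M < `|U w|]) <= expR (- (k1 * M `^ a)) * D.
Proof.
move=> M0; apply: (mean_le_moment (W := W) _ mW (expR_ge0 _) _ _ _ UD).
- by apply: bmeas_indic; apply: measurable_gt; exact: measurableT_comp.
- by move=> w; rewrite indicE.
- by move=> w; exact: expR_ge0.
- move=> w; rewrite indicE; case: (boolP (_ \in _)); rewrite ?inE /=; last first.
    by move=> _; rewrite mulr_ge0 ?expR_ge0.
  move=> MU; rewrite /W -expRD -[leLHS]expR0 ler_expR.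
  have : M `^ a <= `|U w| `^ a by rewrite ge0_ler_powR ?nnegrE// ltW.
  by move=> /(ler_wpM2l (ltW k0)); lra.
Qed.

(** Half of the exponential moment pays for the polynomial factor, the other half
for the exponential one. *)
Lemma centered_moment M (th e : R) (m := mean P (cutoff M \o U)) : 0 <= M ->
  0 <= e ->
  (forall u v, 0 <= u -> u <= M -> v <= u + C * D ->
     th * v <= k1 / 2 * u `^ a + 1 + e) ->
  mean P (fun w => (1 + (cutoff M (U w) - m) ^+ 4) *
     expR (th * `|cutoff M (U w) - m|)) <=
  (1 + C * D) ^+ 4 * C * expR 1 * D * expR e.
Proof.
move=> M0 e0 hth; have bc := bmeas_cutoff M0 mU.
have mCD : `|m| <= C * D by exact: mean_cutoff_le.
have CD0 : 0 <= C * D by exact: le_trans mCD.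
pose K := (1 + C * D) ^+ 4 * C * expR 1 * expR e.
have K0 : 0 <= K.
  apply: mulr_ge0 (expR_ge0 _); apply: mulr_ge0 (expR_ge0 _).
  by apply: mulr_ge0 C0; rewrite exprn_ge0// addr_ge0.
have -> : (1 + C * D) ^+ 4 * C * expR 1 * D * expR e = K * D.
  by rewrite /K; ring.
have bV : bmeas (fun w => cutoff M (U w) - m).
  by apply: (bmeasB bc); exact: bmeas_cst.
apply: (mean_le_moment (W := W)) => //.
- by bmeas_tac.
- move=> w; rewrite mulr_ge0 ?expR_ge0// addr_ge0// exprn_even_ge0//.
- by move=> w; exact: expR_ge0.
move=> w; set u := cutoff M (U w); set v := `|u - m|.
have v0 : 0 <= v by exact: normr_ge0.
have vu : v <= `|u| + C * D.
  by apply: (le_trans (ler_normB _ _)); rewrite lerD2l.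
have uM : `|u| <= M by exact: cutoff_bound.
have uU : `|u| <= `|U w| by exact: cutoff_le.
have p1 : 1 + (u - m) ^+ 4 <= (1 + v) ^+ 4.
  have -> : (u - m) ^+ 4 = v ^+ 4.
    by rewrite /v -normrX ger0_norm// exprn_even_ge0.
  by rewrite !exprS expr0; nra.
have p2 : (1 + v) ^+ 4 <= (1 + C * D) ^+ 4 * (C * expR (k1 / 2 * `|u| `^ a)).
  apply: (@le_trans _ _ (((1 + C * D) * (1 + `|u|)) ^+ 4)).
    rewrite lerXn2r ?nnegrE ?addr_ge0 ?mulr_ge0 ?addr_ge0//.
    have := normr_ge0 u; nra.
  by rewrite exprMn ler_wpM2l ?exprn_ge0 ?addr_ge0// poly.
have p3 : expR (th * v) <= expR (k1 / 2 * `|u| `^ a) * expR 1 * expR e.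
  by rewrite -!expRD ler_expR hth.
apply: (le_trans (ler_pM _ (expR_ge0 _) (le_trans p1 p2) p3)).
  by rewrite addr_ge0// exprn_even_ge0.
rewrite [leLHS](_ : _ = K * (expR (k1 / 2 * `|u| `^ a) * expR (k1 / 2 * `|u| `^ a))).
  apply: (ler_wpM2l K0); rewrite -expRD.
  have -> : k1 / 2 * `|u| `^ a + k1 / 2 * `|u| `^ a = k1 * `|u| `^ a by field.
  rewrite ler_expR ler_pM2l// ge0_ler_powR ?nnegrE//; exact: ltW.
by rewrite /K; ring.
Qed.

End moments.
End truncation.

(** * The deviation inequality for real variables *)
Section mixing_tail.
Context {R : realType}.

(** Working at the level L + ln T gains the factor 1 / T that pays for a union
bound over T times. *)
Lemma expR_sample (L T k : R) : 1 <= T -> 1 <= k ->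
  expR (- (k * (L + ln T))) <= expR (- (k * L)) / T.
Proof.
move=> T1 k1; have T0 : 0 < T by exact: lt_le_trans T1.
have lnT0 : 0 <= ln T by exact: ln_ge0.
rewrite -[X in _ / X]lnK// -expRN -expRD ler_expR; nra.
Qed.

Lemma natr_le_expR (k : nat) (L : R) : ln 2 <= L -> 2 ^+ k <= expR (k%:R * L).
Proof.
move=> hL; rewrite expRM_natl lerXn2r ?nnegrE ?expR_ge0//.
by rewrite -[leLHS](@lnK _ 2) ?posrE// ler_expR.
Qed.

Lemma block_count (T b : nat) : (0 < b <= T)%N ->
  exists2 N, (T <= 2 * N * b)%N & (2 * N * b <= 3 * T)%N /\ (N <= 2 * T)%N.
Proof.
move=> /andP[b0 bT]; exists (T %/ (2 * b)).+1%N.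
  have := divn_eq T (2 * b); have : (T %% (2 * b) < 2 * b)%N.
    by rewrite ltn_mod muln_gt0.
  by move: (T %/ _)%N (T %% _)%N => x y; nia.
have : (T %/ (2 * b) * (2 * b) <= T)%N by exact: leq_divM.
by move: (T %/ _)%N => x; split; nia.
Qed.

(** The exponents leave expR (- (3 * L)) and expR (- (7 * L)) to spare, which are
at most 2 ^- 3 and 2 ^- 7 and pay for the numerical factors. *)
Lemma tail_budget (C c2 L T l E al lam : R) (N : nat) :
  0 <= C -> 0 < c2 -> ln 2 <= L -> 1 <= T -> l = L + ln T ->
  N%:R <= 2 * T -> 0 <= E -> E <= 2 * C * L ->
  al <= expR (- ((2 * C + c2 + 8) * l)) -> 0 <= al -> lam <= l ->
  2 * (expR E * (expR (- ((2 * C + c2 + 3) * L)) +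
     N%:R * (4 * al * expR lam))) <= expR (- (c2 * L)) / 2.
Proof.
move=> C0 c20 hL T1 lE NT E0 EC hal al0 hlam.
have T0 : 0 < T by exact: lt_le_trans T1.
have L0 : 0 < L by apply: lt_le_trans hL; rewrite ln_gt0// ltr1n.
have k1 : 1 <= 2 * C + c2 + 7 by lra.
have hT : N%:R * (4 * al * expR lam) <= 8 * expR (- ((2 * C + c2 + 7) * L)).
  apply: (@le_trans _ _ (2 * T * (4 * (expR (- ((2 * C + c2 + 7) * L)) / T)))).
    apply: ler_pM => //; first by rewrite !mulr_ge0 ?expR_ge0.
    rewrite -mulrA ler_pM2l//; apply: le_trans (expR_sample L T1 k1).
    apply: (@le_trans _ _ (expR (- ((2 * C + c2 + 8) * l)) * expR l)).
      by apply: ler_pM; rewrite ?expR_ge0// ler_expR.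
    by rewrite -expRD ler_expR -lE; lra.
  by rewrite le_eqVlt; apply/orP; left; apply/eqP; field; rewrite gt_eqF.
have h3 := natr_le_expR 3 hL; have h7 := natr_le_expR 7 hL.
pose e := expR (- (c2 * L)); have e0 : 0 < e by exact: expR_gt0.
have s3 : expR (2 * C * L) * expR (- ((2 * C + c2 + 3) * L)) <= e / 8.
  rewrite ler_pdivlMr//; apply: (@le_trans _ _ (expR (2 * C * L) *
    expR (- ((2 * C + c2 + 3) * L)) * expR (3 * L))).
    rewrite ler_pM2l ?mulr_gt0 ?expR_gt0//; apply: le_trans h3.
    by rewrite !exprS expr0; lra.
  by rewrite -!expRD ler_expR; lra.
have s7 : expR (2 * C * L) * expR (- ((2 * C + c2 + 7) * L)) <= e / 128.
  rewrite ler_pdivlMr//; apply: (@le_trans _ _ (expR (2 * C * L) *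
    expR (- ((2 * C + c2 + 7) * L)) * expR (7 * L))).
    rewrite ler_pM2l ?mulr_gt0 ?expR_gt0//; apply: le_trans h7.
    by rewrite !exprS expr0; lra.
  by rewrite -!expRD ler_expR; lra.
have : expR E * (expR (- ((2 * C + c2 + 3) * L)) + N%:R * (4 * al * expR lam)) <=
    expR (2 * C * L) * (expR (- ((2 * C + c2 + 3) * L)) +
      8 * expR (- ((2 * C + c2 + 7) * L))).
  apply: ler_pM; rewrite ?expR_ge0 ?ler_expR ?lerD2l//.
  by rewrite addr_ge0 ?expR_ge0// !mulr_ge0 ?expR_ge0.
rewrite -/e (mulrDr (expR (2 * C * L))); move: s3 s7 e0; clear.
set x := expR (2 * C * L) * expR _; rewrite (mulrCA _ 8).
set y := expR (2 * C * L) * expR _; move: (expR _ * _) => w; lra.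
Qed.

(** A sum of T centred variables with exponential moments of order a is at most
the block sum of the truncated centred variables, plus a bias of order 1, off an
event on which some truncation is active. The block sum is controlled with
lam = sqrt (L / T): the proxy C lam ^+ 2 T is then a multiple of L, as is lam x
for x a multiple of sqrt (L T). *)
Lemma mixing_tail (c g1 a k1 D c2 : R) : 0 < c -> 0 < g1 -> 0 < a ->
  0 < k1 -> 1 <= D -> 0 < c2 -> 1 < g1^-1 + a^-1 ->
  exists C1 C2 : R, [/\ 0 < C1, 0 < C2 &
  forall d (Omega : measurableType d) (P : probability Omega R)
    (Fam : nat -> set_system Omega) (U : nat -> Omega -> R) (L : R) (T : nat),
  (forall t, Fam t `<=` measurable) ->
  alpha_mixing P Fam (fun l => expR (- (c * l%:R `^ g1))) ->
  (forall t, known Fam [set t] (U t)) ->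
  (forall t, \int[P]_w (U t w)%:E = 0)%E ->
  (forall t, \int[P]_w (expR (k1 * `|U t w| `^ a))%:E <= D%:E)%E ->
  ln 2 <= L -> (0 < T)%N ->
  C1 * L `^ (2 * (g1^-1 + a^-1) - 1) <= T%:R ->
  mean P (\1_[set w | C2 * Num.sqrt (L * T%:R) < \sum_(t < T) U t w]) <=
    expR (- (c2 * L))].
Proof.
move=> c0 g0 a0 k0 D1 c20 ga.
pose L0 : R := ln 2; have L00 : 0 < L0 by rewrite ln_gt0// ltr1n.
have D0 : 0 < D by exact: lt_le_trans D1.
have [Cm Cm1 poly] := poly4_le_exp k0 a0.
have Cm0 : 0 < Cm by exact: lt_le_trans Cm1.
pose m0 := Cm * D; have m00 : 0 < m0 by rewrite mulr_gt0.
pose Dm := (1 + m0) ^+ 4 * Cm * expR 1 * D.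
have Dm1 : 1 <= Dm.
  have e1 : 1 <= expR 1 :> R by rewrite -[leLHS]expR0 ler_expR.
  rewrite /Dm; apply: mulr_ege1 D1; apply: mulr_ege1 e1; apply: mulr_ege1 Cm1.
  by rewrite exprn_ege1// lerDl ltW.
pose z := if a <= 1 then 2^-1 else (1 - g1 * (1 - a^-1)) / 2.
(* The exponent z does not depend on K1 and K2, while K2 is chosen after kap, which
   depends on z; hence two uses of the same lemma. *)
have [z01 _] := exponent_bound c0 g0 a0 k0 ltr01 ltr01 (ltW m00) L00 ga.
rewrite -/z in z01.
have zlt1 : 0 < z < 1 by case/andP: z01 => -> z1; lra.
have [kap [C [/andP[kap0 kap1] C0 mgf]]] := mgf_mixing c0 g0 zlt1 z01 Dm1.
(* This makes 2 D at most expR (kD * L) for all L >= ln 2. *)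
pose kD := ln (2 * D) / ln 2.
have lnD0 : 0 <= ln (2 * D) by rewrite ln_ge0//; lra.
have kD0 : 0 <= kD by rewrite divr_ge0// ltW.
pose K1 := 2 * (1 + c2 + kD) / k1.
have K10 : 0 < K1 by rewrite divr_gt0// mulr_gt0//; lra.
pose Ka := 2 * C + c2 + 8; have Ka0 : 0 < Ka by rewrite /Ka; lra.
(* The first summand makes the mixing coefficient of a gap of one block at most
   expR (- (Ka * l)), the second makes the block length at least 1. *)
pose K2 := 2 / kap * ((Ka / c) `^ g1^-1 + (L0 `^ g1^-1)^-1).
have K20 : 0 < K2.
  by rewrite mulr_gt0 ?divr_gt0// addr_gt0 ?invr_gt0 ?powR_gt0// divr_gt0.
have [_ [K3 K30 expo]] := exponent_bound c0 g0 a0 k0 K10 K20 (ltW m00) L00 ga.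
pose ig := g1^-1 + a^-1; pose w := 2 * ig - 1.
have ig0 : 0 < g1^-1 /\ 0 < a^-1 by rewrite !invr_gt0.
have [Ca Ca0 growa] : exists2 C : R, 0 < C & forall L T, L0 <= L -> 1 <= T ->
    C * L `^ w <= T -> 4 / K3 ^+ 2 * (L `^ 1 * (L + ln T) `^ (2 * ig - 2)) <= T.
  apply: sample_size_dominates => //.
  - by rewrite divr_ge0// sqr_ge0.
  - by rewrite /ig; lra.
  - by rewrite /w; lra.
have [Cb Cb0 growb] : exists2 C : R, 0 < C & forall L T, L0 <= L -> 1 <= T ->
    C * L `^ w <= T -> K2 * (L `^ 0 * (L + ln T) `^ g1^-1) <= T.
  apply: sample_size_dominates => //; first exact: ltW.
  - by case: ig0 => /ltW.
  - by rewrite /w /ig; case: ig0; lra.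
pose Kx := 2 * C + c2 + 3; have Kx0 : 0 < Kx by rewrite /Kx; lra.
have sL0 : 0 < Num.sqrt L0 by rewrite sqrtr_gt0.
exists (Ca + Cb), (2 * Kx + m0 / Num.sqrt L0); split; first exact: addr_gt0.
  by rewrite addr_gt0 ?divr_gt0// mulr_gt0.
move=> d Omega P Fam U L T Fam_meas mix kU U0 UD hL T0 hT.
have mU t : measurable_fun setT (U t) by exact: known_measurable (kU t).
have T1 : 1 <= T%:R :> R by rewrite ler1n.
have TR : 0 < T%:R :> R by rewrite ltr0n.
have L_gt0 : 0 < L by exact: lt_le_trans hL.
have lnT0 : 0 <= ln T%:R :> R by exact: ln_ge0.
pose l := L + ln T%:R.
have lL : L <= l by rewrite lerDl.
have lL0 : L0 <= l by exact: le_trans lL.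
have l_gt0 : 0 < l by exact: lt_le_trans lL0.
have {}growa : 4 / K3 ^+ 2 * (L `^ 1 * l `^ (2 * ig - 2)) <= T%:R.
  apply: growa => //; apply: le_trans hT.
  by rewrite ler_wpM2r ?powR_ge0// lerDl ltW.
have {}growb : K2 * (L `^ 0 * l `^ g1^-1) <= T%:R.
  apply: growb => //; apply: le_trans hT.
  by rewrite ler_wpM2r ?powR_ge0// lerDr ltW.
have {expo} := expo l lL0; rewrite -/z -/ig.
set B := K2 * l `^ g1^-1; set M := (K1 * l) `^ a^-1.
set lam0 := K3 * l `^ (1 - ig) => -[lamBM expo].
have B0 : 0 < B by rewrite mulr_gt0// powR_gt0.
have M0 : 0 <= M by exact: powR_ge0.
have lam00 : 0 < lam0 by rewrite mulr_gt0// powR_gt0.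
have Ma : M `^ a = K1 * l.
  by rewrite /M -powRrM mulVf ?gt_eqF// powRr1// mulr_ge0// ltW.
have BT : B <= T%:R by move: growb; rewrite powRr0 mul1r.
pose b := Num.trunc (kap * B).
have kB0 : 0 <= kap * B by rewrite mulr_ge0// ltW.
have /andP[bB Bb] := truncn_itv kB0; rewrite -/b in bB Bb.
have kBE : kap * B = 2 * ((Ka / c) `^ g1^-1 + (L0 `^ g1^-1)^-1) * l `^ g1^-1.
  by rewrite /B /K2; field; rewrite !gt_eqF// powR_gt0.
have l_pow : L0 `^ g1^-1 <= l `^ g1^-1.
  by rewrite ge0_ler_powR ?nnegrE//; [case: ig0 => /ltW|exact: ltW|exact: ltW].
have kB2 : 2 * ((Ka / c) `^ g1^-1 * l `^ g1^-1) + 2 <= kap * B.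
  rewrite kBE mulrDr mulrDl -!mulrA lerD2l -[leLHS]mulr1 ler_pM2l//.
  by rewrite -ler_pdivrMl ?invr_gt0 ?powR_gt0// invrK mulr1.
have pow_ge0 : 0 <= (Ka / c) `^ g1^-1 * l `^ g1^-1 by rewrite mulr_ge0 ?powR_ge0.
have bge : (Ka / c * l) `^ g1^-1 <= b%:R.
  rewrite powRM ?divr_ge0//; try exact: ltW.
  by move: Bb; rewrite -natr1; clear - kB2 pow_ge0; lra.
have b0 : (0 < b)%N.
  by rewrite -(ltr_nat R); move: Bb; rewrite -natr1; clear - kB2 pow_ge0; lra.
have bR : 0 < b%:R :> R by rewrite ltr0n.
have bT : (b <= T)%N.
  rewrite -(ler_nat R) (le_trans bB)// (le_trans _ BT)// ler_piMl//.
  exact: ltW.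
have al_b : expR (- (c * b%:R `^ g1)) <= expR (- (Ka * l)).
  rewrite ler_expR lerN2; apply: (@le_trans _ _ (c * ((Ka / c * l) `^ g1^-1) `^ g1)).
    rewrite -powRrM mulVf ?gt_eqF// powRr1.
      by rewrite mulrA mulrCA mulfV ?mulr1// gt_eqF.
    by rewrite mulr_ge0 ?divr_ge0//; exact: ltW.
  by rewrite ler_pM2l// ge0_ler_powR ?nnegrE ?powR_ge0//; exact: ltW.
(* The extension by 0 beyond T allows for a whole number of pairs of blocks. *)
pose m t := mean P (cutoff M \o U t).
pose V t : Omega -> R :=
  if (t < T)%N then fun w => cutoff M (U t w) - m t else fun=> 0.
have bcut t : bmeas (cutoff M \o U t) by exact: bmeas_cutoff.
have bV t : bmeas (V t).
  rewrite /V; case: ifP => _; last exact: bmeas_cst.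
  by apply: (bmeasB (bcut t)); exact: bmeas_cst.
have kV t : known Fam [set t] (V t).
  rewrite /V; case: ifP => _; last exact: measurable_cst.
  apply: (known_comp (phi := fun x => cutoff M x - m t)) (kU t).
  by apply: measurable_funB; [exact: measurable_cutoff|exact: measurable_cst].
have V0 t : mean P (V t) = 0.
  rewrite /V; case: ifP => _; last exact: mean_cst.
  rewrite (meanB P (bcut t) (bmeas_cst _ (m t))) mean_cst.
  by rewrite -/(m t) subrr.
have mM t : `|m t| <= M.
  apply: (le_trans (ler_norm_mean P (bcut t))).
  rewrite -[leRHS](mean_cst P); apply: le_mean.
  - exact/bmeas_norm.
  - exact: bmeas_cst.
  - by move=> w'; exact: cutoff_bound.
have VM t w' : `|V t w'| <= 2 * M.
  rewrite /V; case: ifP => _; last by rewrite normr0 mulr_ge0.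
  apply: (le_trans (ler_normB _ _)).
  have := cutoff_bound (U t w') M0; have := mM t; clear; lra.
have moment n t lam : (0 < n)%N -> n%:R <= kap * B -> 0 <= lam ->
    lam <= lam0 * (B / n%:R) `^ z ->
    mean P (fun w => (1 + V t w ^+ 4) * expR (4 * lam * n%:R * `|V t w|)) <=
    Dm * expR (c / 12 * (n%:R * (n%:R / B) `^ z) `^ g1).
  move=> n0 nB l0 hlam.
  set e := c / 12 * _.
  have e0 : 0 <= e by rewrite mulr_ge0 ?powR_ge0// divr_ge0// ltW.
  have [tT|tT] := ltnP t T; last first.
    have -> : V t = fun=> 0 by rewrite /V ltnNge tT.
    rewrite normr0 mulr0 expR0 expr0n/= addr0 mulr1 mean_cst.
    by apply: mulr_ege1 => //; rewrite -[leLHS]expR0 ler_expR.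
  have -> : V t = fun w => cutoff M (U t w) - m t by rewrite /V tT.
  apply: (centered_moment k0 a0 Cm1 poly (mU t) (UD t) M0 e0).
  move=> u v u0 uM vu; apply: expo => //; first by rewrite ltr0n.
  by rewrite (le_trans nB)// ler_piMl// ltW.
pose lam := Num.sqrt (L / T%:R).
have LT0 : 0 < L / T%:R by rewrite divr_gt0.
have lam_gt0 : 0 < lam by rewrite sqrtr_gt0.
have lam2 : lam ^+ 2 = L / T%:R by rewrite sqr_sqrtr// ltW.
(* This is where the lower bound on the sample size is used. *)
have lam_le : 2 * lam <= lam0.
  rewrite -(@ler_pXn2r _ 2) ?nnegrE//; try exact: ltW.
    rewrite exprMn lam2 /lam0 exprMn -(@powR_mulrn _ (l `^ _)) ?powR_ge0// -powRrM.
    have -> : (1 - ig) * 2%:R = - (2 * ig - 2) by ring.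
    rewrite powRN; set y := l `^ (2 * ig - 2) in growa *.
    have y0 : 0 < y by rewrite powR_gt0.
    rewrite ler_pdivlMr//.
    have -> : 2 ^+ 2 * (L / T%:R) * y = 4 * L * y / T%:R.
      by rewrite expr2; field; rewrite gt_eqF.
    rewrite ler_pdivrMr//.
    move: growa; rewrite powRr1; last exact: ltW.
    by rewrite mulrAC ler_pdivrMr ?exprn_gt0// mulrA (mulrC T%:R).
  by rewrite mulr_ge0// ltW.
have mgf' u : mean P (fun w => expR (lam * psum V u b w)) <=
    expR (C * lam ^+ 2 * b%:R).
  exact: (mgf d Omega P Fam V B lam0 B0 mix bV kV V0 moment u b lam bB
    (ltW lam_gt0) lam_le).
have [N TN [N3 N2]] : exists2 N, (T <= 2 * N * b)%N &
    (2 * N * b <= 3 * T)%N /\ (N <= 2 * T)%N.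
  by apply: block_count; rewrite b0.
pose x := Kx * Num.sqrt (L * T%:R).
have x0 : 0 <= x by rewrite mulr_ge0 ?sqrtr_ge0// ltW.
have lamx : lam * x = Kx * L.
  rewrite /x mulrCA /lam -sqrtrM; last exact: ltW.
  rewrite [_ * (L * _)](_ : _ = L ^+ 2); last by field; rewrite gt_eqF.
  by rewrite sqrtr_sqr ger0_norm// ltW.
have q0 : 0 <= C * lam ^+ 2 by rewrite mulr_ge0 ?sqr_ge0// ltW.
have tail := block_tail N mix (fun l => expR_ge0 _) bV kV VM q0 lam_gt0 x0 mgf'.
have budget : fine (P [set w | 2 * x < psum V 0 (2 * N * b) w]) <=
    expR (- (c2 * L)) / 2.
  apply: (le_trans tail); rewrite lamx.
  apply: (@tail_budget C c2 L T%:R l) => //.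
  - exact: ltW.
  - by rewrite -natrM ler_nat.
  - by rewrite mulr_ge0.
  - rewrite lam2; have : 2 * (N * b)%:R <= 3 * T%:R :> R.
      by rewrite -!natrM ler_nat mulnA.
    move=> h; rewrite -(ler_pM2r TR).
    have -> : C * (L / T%:R) * (N * b)%:R * T%:R = C * L * (N * b)%:R.
      by field; rewrite gt_eqF.
    have -> : 2 * C * L * T%:R = C * L * (2 * T%:R) by ring.
    by rewrite ler_pM2l ?mulr_gt0//; clear - h TR; lra.
  apply: le_trans lamBM.
  have -> : lam * b%:R * (2 * M) = 2 * lam * b%:R * M by ring.
  rewrite ler_wpM2r//; apply: ler_pM => //.
  - by rewrite mulr_ge0// ltW.
  - by apply: (le_trans lam_le); rewrite ler_peMl ?ler1n// ltW.
  - by rewrite (le_trans bB)// ler_piMl// ltW.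
pose A t := [set w | M < `|U t w|].
have kK : 1 <= 1 + c2 + kD by clear - c20 kD0; lra.
have k1K1 : k1 * (K1 * l) = 2 * (1 + c2 + kD) * l.
  by rewrite /K1; field; rewrite gt_eqF.
have tailA t : mean P (\1_(A t)) <= expR (- (c2 * L)) / 2 / T%:R.
  apply: (le_trans (tail_prob k0 a0 (mU t) (UD t) M0)).
  rewrite Ma k1K1.
  apply: (@le_trans _ _ (expR (- ((1 + c2 + kD) * l)) * D)).
    rewrite ler_wpM2r ?(ltW D0)// ler_expR; clear - kK l_gt0; nra.
  apply: (le_trans (ler_wpM2r (ltW D0) (expR_sample L T1 kK))).
  rewrite mulrAC ler_pM2r ?invr_gt0//.
  rewrite ler_pdivlMr// -mulrA (mulrC D).
  rewrite -[X in _ * X <= _]lnK ?posrE ?mulr_gt0// -expRD ler_expR.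
  have : ln (2 * D) <= kD * L.
    rewrite -[leLHS](@mulfVK _ (ln 2)); last by rewrite gt_eqF.
    by rewrite -/kD ler_wpM2l.
  by clear - L_gt0; lra.
have bias t : m t <= m0 / T%:R.
  apply: (le_trans (ler_norm _)).
  apply: (le_trans (cutoff_bias k0 a0 Cm1 poly (mU t) (UD t) M0 (U0 t))).
  have -> : m0 / T%:R = Cm * T%:R^-1 * D by rewrite /m0; ring.
  rewrite Ma ler_pM2r// ler_pM2l//.
  have -> : k1 / 2 * (K1 * l) = (1 + c2 + kD) * l.
    by rewrite /K1; field; rewrite gt_eqF.
  apply: (le_trans (expR_sample L T1 kK)).
  rewrite ler_piMl ?invr_ge0 ?ler0n//.
  rewrite -[leRHS]expR0 ler_expR oppr_le0 mulr_ge0// ?(ltW L_gt0)//.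
  exact: le_trans ler01 kK.
pose S := [set w | 2 * x < psum V 0 (2 * N * b) w].
have mS : measurable S by apply: measurable_gt; case: (bmeas_psum 0 (2 * N * b) bV).
have mA t : measurable (A t) by apply: measurable_gt; exact: measurableT_comp.
have mE : measurable [set w | (2 * Kx + m0 / Num.sqrt L0) * Num.sqrt (L * T%:R)
    < \sum_(t < T) U t w].
  by apply: measurable_gt; apply: measurable_sum => t; exact: mU.
apply: (@le_trans _ _ (mean P (fun w => \1_S w + \sum_(t < T) \1_(A t) w))).
  apply: le_mean; first exact: bmeas_indic.
    by apply: bmeasD; [exact: bmeas_indic|apply: bmeas_sum => t _; exact: bmeas_indic].
  move=> w'; have s0 : 0 <= \sum_(t < T) \1_(A t) w' :> R.
    by apply: sumr_ge0 => t _; rewrite indicE.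
  rewrite indicE; case: (boolP (w' \in _)) => [|_]; last first.
    by rewrite addr_ge0// indicE.
  rewrite inE /= => big.
  have [/existsP[t At]|/existsPn noA] := boolP [exists t : 'I_T, w' \in A t].
    rewrite (bigD1 t)//= [in X in _ <= _ + (X + _)]indicE At.
    rewrite addrCA lerDl addr_ge0 ?indicE//.
    by apply: sumr_ge0 => i _; rewrite indicE.
  suff Sw : w' \in S by rewrite [X in _ <= X + _]indicE Sw lerDl.
  rewrite inE /S /=.
  have -> : psum V 0 (2 * N * b) w' = \sum_(t < T) (U t w' - m t).
    rewrite /psum add0n (big_cat_nat (n := T))//= [X in _ + X]big_nat_cond.
    rewrite [X in _ + X]big1 ?addr0.
      rewrite big_mkord; apply: eq_bigr => t _; rewrite /V ltn_ord cutoffE.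
      have := noA t; rewrite notin_setE /A /= => /negP; rewrite -leNgt => ->.
      by [].
    by move=> t /andP[/andP[Tt _] _]; rewrite /V ltnNge Tt.
  rewrite sumrB.
  have sm : \sum_(t < T) m t <= m0.
    apply: (@le_trans _ _ (\sum_(t < T) m0 / T%:R)); first by apply: ler_sum.
    by rewrite sumr_const card_ord -(mulr_natr (m0 / _)) mulfVK// gt_eqF.
  have sq : m0 <= m0 / Num.sqrt L0 * Num.sqrt (L * T%:R).
    rewrite mulrAC ler_pdivlMr// ler_pM2l// ler_wsqrtr//.
    by rewrite (le_trans hL)// ler_peMr// ltW.
  move: big; rewrite mulrDl => big.
  have xE : 2 * x = 2 * Kx * Num.sqrt (L * T%:R) by rewrite /x mulrA.
  by clear - sm sq big xE; lra.
rewrite meanD; last 2 first.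
- exact: bmeas_indic.
- by apply: bmeas_sum => t _; exact: bmeas_indic.
rewrite mean_sum; last by move=> t _; exact: bmeas_indic.
rewrite mean_indic// [leRHS]splitr; apply: lerD; first exact: budget.
apply: (@le_trans _ _ (\sum_(t < T) expR (- (c2 * L)) / 2 / T%:R)).
  by apply: ler_sum => t _; exact: tailA.
by rewrite sumr_const card_ord -(mulr_natr (_ / T%:R)) mulfVK// gt_eqF.
Qed.

End mixing_tail.

(** * Exponential moments from polynomial moments *)
Section exponential_moments.
Context {R : realType}.

Lemma expR_nneseries (y : R) : (expR y)%:E =
  (\sum_(k <oo) ((y ^+ k / k`!%:R)%:E))%E.
Proof.
rewrite /expR -EFin_lim; last exact: is_cvg_series_exp_coeff.
by congr (limn _); apply/funext => n; rewrite /series /= -sumEFin.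
Qed.

(** One term of the exponential series at k. *)
Lemma pow_le_fact_expR (k : nat) : k%:R ^+ k <= k`!%:R * expR 1 ^+ k :> R.
Proof.
case: k => [|k]; first by rewrite fact0 expr0 mulr1.
rewrite mulrC -ler_pdivrMr ?ltr0n ?fact_gt0// -expRM_natl mulr1.
by apply: le_trans (expR_ge1Dxn k (ler0n R k.+1)); rewrite lerDr.
Qed.

(** The exponential series is integrated term by term. The moment of order g k
contributes k1^k (g k)^k / k!, at most (k1 g e)^k, a term of a geometric series.
The finitely many orders g k < 1, about which nothing is assumed, are compared
with order 1. *)
Lemma exp_moment (g : R) : 0 < g -> exists k1 : R, 0 < k1 /\
  forall d (Omega : measurableType d) (P : probability Omega R)
    (V : Omega -> R) (K : R), 0 < K -> measurable_fun setT V ->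
  (forall r : R, (1 <= r)%R ->
     \int[P]_w (`|V w| `^ r)%:E <= ((K * r `^ g^-1) `^ r)%:E)%E ->
  (\int[P]_w (expR (k1 * (`|V w| / K) `^ g))%:E <= 4%:E)%E.
Proof.
move=> g0; pose k1 := Num.min 2^-1 (2 * g * expR 1)^-1.
have d0 : 0 < 2 * g * expR 1 by rewrite !mulr_gt0// expR_gt0.
have k10 : 0 < k1 by rewrite lt_min !invr_gt0 d0 ltr0n.
have k1a : k1 <= 2^-1 by rewrite ge_min lexx.
have k1b : k1 * (g * expR 1) <= 2^-1.
  have : k1 <= 1 / (2 * g * expR 1) by rewrite div1r ge_min lexx orbT.
  rewrite ler_pdivlMr//.
  have -> : k1 * (2 * g * expR 1) = 2 * (k1 * (g * expR 1)) by ring.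
  by move: (k1 * _) => y; lra.
exists k1; split=> // d Omega P V K K0 mV mom.
pose v w := `|V w| / K.
have v0 w : 0 <= v w by rewrite divr_ge0// ltW.
have mv : measurable_fun setT v.
  apply: measurable_funM; last exact: measurable_cst.
  exact: measurableT_comp.
have mpow (r : R) : measurable_fun setT (fun w => v w `^ r).
  exact: (measurableT_comp (measurable_powR _) mv).
have vmom r : 1 <= r -> (\int[P]_w (v w `^ r)%:E <= ((r `^ g^-1) `^ r)%:E)%E.
  move=> r1; have r0 : 0 <= r by exact: le_trans r1.
  have vE w : (v w `^ r)%:E = ((K^-1 `^ r)%:E * (`|V w| `^ r)%:E)%E.
    by rewrite -EFinM /v mulrC powRM// invr_ge0 ltW.
  under eq_integral do rewrite vE.
  rewrite ge0_integralZl//=; last 2 first.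
  - apply/measurable_EFinP; apply: (measurableT_comp (measurable_powR _)).
    exact: measurableT_comp.
  - by rewrite lee_fin powR_ge0.
  apply: (@le_trans _ _ ((K^-1 `^ r)%:E * ((K * r `^ g^-1) `^ r)%:E)%E).
    by rewrite lee_wpmul2l ?lee_fin ?powR_ge0// mom.
  rewrite -EFinM lee_fin -powRM ?invr_ge0 ?mulr_ge0 ?powR_ge0//; try exact: ltW.
  by rewrite mulKf// gt_eqF.
pose f k w : \bar R := ((k1 ^+ k / k`!%:R) * v w `^ (g * k%:R))%:E.
have f0 k w : (0 <= f k w)%E.
  rewrite lee_fin mulr_ge0 ?powR_ge0// divr_ge0// exprn_ge0//; exact: ltW.
have mf k : measurable_fun setT (f k).
  by apply/measurable_EFinP/measurable_funM; [exact: measurable_cst|exact: mpow].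
have fint k : (\int[P]_w f k w <= (2 * 2^-1 ^+ k)%:E)%E.
  have ck : 0 <= k1 ^+ k / k`!%:R by rewrite divr_ge0// exprn_ge0//; exact: ltW.
  have fact1 : 1 <= k`!%:R :> R by rewrite ler1n fact_gt0.
  have -> : (\int[P]_w f k w = (k1 ^+ k / k`!%:R)%:E *
      \int[P]_w (v w `^ (g * k%:R))%:E)%E.
    rewrite -ge0_integralZl//=.
    - exact/measurable_EFinP.
    - by move=> w _; rewrite lee_fin powR_ge0.
  have [gk|gk] := leP 1 (g * k%:R).
    apply: (@le_trans _ _ ((k1 ^+ k / k`!%:R)%:E *
        (((g * k%:R) `^ g^-1) `^ (g * k%:R))%:E)%E).
      by rewrite lee_wpmul2l ?lee_fin// vmom.
    rewrite -EFinM lee_fin -powRrM mulKf ?gt_eqF// powR_mulrn; last first.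
      by rewrite mulr_ge0// ltW.
    apply: (@le_trans _ _ ((k1 * (g * expR 1)) ^+ k)).
      rewrite mulrAC ler_pdivrMr ?ltr0n ?fact_gt0// !exprMn.
      rewrite -!mulrA ler_wpM2l ?exprn_ge0 ?(ltW k10)//.
      rewrite ler_wpM2l ?exprn_ge0 ?(ltW g0)// [leRHS]mulrC.
      exact: pow_le_fact_expR.
    apply: (@le_trans _ _ (2^-1 ^+ k)).
      by rewrite lerXn2r ?nnegrE ?invr_ge0// !mulr_ge0 ?expR_ge0// ltW.
    by rewrite ler_peMl ?exprn_ge0 ?invr_ge0// ler1n.
  apply: (@le_trans _ _ ((k1 ^+ k / k`!%:R)%:E * 2%:E)%E).
    rewrite lee_wpmul2l ?lee_fin//.
    apply: (@le_trans _ _ (\int[P]_w (1%:E + (v w `^ 1)%:E))%E).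
      apply: ge0_le_integral => //=.
      - by move=> w _; rewrite lee_fin powR_ge0.
      - by apply/measurable_EFinP.
      - apply: emeasurable_funD; first exact: measurable_cst.
        exact/measurable_EFinP.
      - move=> w _; rewrite -EFinD lee_fin.
        have [v1|v1] := leP (v w) 1.
          apply: (@le_trans _ _ (1 `^ (g * k%:R))).
            by rewrite ge0_ler_powR ?nnegrE// mulr_ge0// ltW.
          by rewrite powR1 lerDl powR_ge0.
        apply: (@le_trans _ _ (v w `^ 1)); last by rewrite lerDr.
        by rewrite ler_powR// ltW.
    rewrite ge0_integralD//=; last 2 first.
    - by move=> w _; rewrite lee_fin powR_ge0.
    - exact/measurable_EFinP.
    rewrite integral_cst//= probability_setT mule1.
    have -> : 2%:E = (1%:E + 1%:E)%E :> \bar R by rewrite -EFinD.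
    rewrite leeD2l//; apply: le_trans (vmom 1 (lexx _)) _.
    by rewrite !powR1.
  rewrite -EFinM lee_fin mulrC ler_pM2l//.
  rewrite ler_pdivrMr ?ltr0n ?fact_gt0//.
  apply: (@le_trans _ _ (2^-1 ^+ k)).
    by rewrite lerXn2r ?nnegrE ?invr_ge0// ltW.
  by rewrite ler_peMr// exprn_ge0// invr_ge0.
rewrite (_ : (fun w => _) = fun w => (\sum_(k <oo) f k w)%E); last first.
  apply/funext => w; rewrite expR_nneseries; congr (limn _); apply/funext => n.
  apply: eq_bigr => k _; rewrite /f exprMn powRrM powR_mulrn ?powR_ge0//.
  by rewrite mulrAC.
rewrite integral_nneseries//.
apply: lime_le; first by apply: is_cvg_nneseries => k _ _; exact: integral_ge0.
apply: nearW => n.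
apply: (@le_trans _ _ (\sum_(0 <= k < n) (2 * 2^-1 ^+ k)%:E)%E).
  by apply: lee_sum => k _; exact: fint.
rewrite sumEFin lee_fin.
have -> : \sum_(0 <= k < n) 2 * 2^-1 ^+ k = 4 * (1 - 2^-1 ^+ n) :> R.
  elim: n => [|n ih]; first by rewrite big_nil expr0 subrr mulr0.
  by rewrite big_nat_recr//= ih exprS; lra.
have : 0 <= 2^-1 ^+ n :> R by rewrite exprn_ge0// invr_ge0.
by lra.
Qed.

End exponential_moments.

(** * From absolute regularity to strong mixing *)
Section beta_alpha.
Context {R : realType} d (Omega : measurableType d) (P : probability Omega R).

(** For the partitions of the space into A, B and their complements, the four
terms of the sum coincide, so their half-sum is twice the left side. Since the
blocks of a partition are nonempty, trivial events are treated apart. *)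
Lemma beta_dep_alpha (F G : set_system Omega) (x : R) A B :
  F `<=` measurable -> G `<=` measurable ->
  (forall A, F A -> F (~` A)) -> (forall B, G B -> G (~` B)) ->
  0 <= x -> (beta_dep P F G <= (2 * x)%:E)%E -> F A -> G B ->
  `|fine (P (A `&` B)) - fine (P A) * fine (P B)| <= x.
Proof.
move=> FM GM FC GC x0 hb FA GB.
have mA := FM _ FA; have mB := GM _ GB.
have PT : fine (P setT) = 1 by rewrite (@probability_setT _ _ _ P).
have [->|/set0P A0] := eqVneq A set0.
  by rewrite set0I measure0 mul0r subrr normr0.
have [->|/set0P B0] := eqVneq B set0.
  by rewrite setI0 measure0 mulr0 subrr normr0.
have [AT|/set0P A1] := eqVneq (~` A) set0.
  have -> : A = setT by rewrite -(setCK A) AT setC0.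
  by rewrite setTI PT mul1r subrr normr0.
have [BT|/set0P B1] := eqVneq (~` B) set0.
  have -> : B = setT by rewrite -(setCK B) BT setC0.
  by rewrite setIT PT mulr1 subrr normr0.
pose two (S : set Omega) (i : 'I_2) := if i == ord0 then S else ~` S.
have part (S : set Omega) : S !=set0 -> ~` S !=set0 ->
    partition setT (two S) setT.
  move=> S0 S1; split.
  - apply/seteqP; split=> // w _; have [Sw|Sw] := pselect (S w).
      by exists ord0.
    by exists (lift ord0 ord0).
  - apply/trivIsetP => i j _ _; rewrite /two.
    case: (unliftP ord0 i) => [i'|] ->; case: (unliftP ord0 j) => [j'|] -> /=;
      rewrite ?eqxx//.
    - by rewrite (ord1 i') (ord1 j') eqxx.
    - by move=> _; rewrite setIC setICr.
    - by move=> _; rewrite setICr.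
  - by move=> i _; rewrite /two; case: ifP.
pose p S := fine (P S).
have PE S : measurable S -> P S = (p S)%:E.
  by move=> mS; rewrite /p fineK// fin_num_measure.
have pC S : measurable S -> p (~` S) = 1 - p S.
  move=> mS; rewrite /p probability_setC//.
  by rewrite fineB ?fin_num_measure// fine1.
have pD S S' : measurable S -> measurable S' -> p (S `&` ~` S') = p S - p (S `&` S').
  move=> mS mS'; rewrite -setDE /p measureD// ?fineB ?fin_num_measure//.
    exact: measurableI.
  by rewrite (le_lt_trans (probability_le1 _ _)) ?ltry.
have mC (S : set Omega) : measurable S -> measurable (~` S) by exact: measurableC.
have hb' := le_trans (ereal_sup_ubound _) hb.
have /hb' : [set x : \bar R |
    exists (I J : nat) (A : 'I_I -> set Omega) (B : 'I_J -> set Omega),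
      [/\ partition setT A setT, partition setT B setT,
          forall i, F (A i), forall j, G (B j)
        & x = ((2^-1)%:E * \sum_(i < I) \sum_(j < J)
                 `|P (A i `&` B j) - P (A i) * P (B j)|)%E]]
    (2^-1 * (`|p (A `&` B) - p A * p B| + `|p (A `&` ~` B) - p A * p (~` B)| +
      (`|p (~` A `&` B) - p (~` A) * p B| +
       `|p (~` A `&` ~` B) - p (~` A) * p (~` B)|)))%:E.
  exists 2%N, 2%N, (two A), (two B); split; [exact: part|exact: part| | |].
  - by move=> i; rewrite /two; case: ifP => // _; exact: FC.
  - by move=> i; rewrite /two; case: ifP => // _; exact: GC.
  rewrite !big_ord_recl !big_ord0 !adde0 /two /=.
  rewrite !PE//; do ?exact: measurableI; do ?exact: mC.
  - by apply: measurableI; exact: mC.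
  - by apply: measurableI => //; exact: mC.
  - by apply: measurableI => //; exact: mC.
rewrite lee_fin !pD ?pC//; last by exact: mC.
have -> : p (~` A `&` B) = p B - p (A `&` B) by rewrite setIC pD// setIC.
have -> : p A - p (A `&` B) - p A * (1 - p B) = - (p (A `&` B) - p A * p B) by ring.
have -> : p B - p (A `&` B) - (1 - p A) * p B = - (p (A `&` B) - p A * p B) by ring.
have -> : 1 - p A - (p B - p (A `&` B)) - (1 - p A) * (1 - p B) =
  p (A `&` B) - p A * p B by ring.
rewrite !normrN -/(p _) -/(p _) -/(p _) /p; set y := `|_|; lra.
Qed.

End beta_alpha.

Section vector_process.
Context {R : realType} d (Omega : measurableType d) (P : probability Omega R).
Context (m : nat) (Z : int -> Omega -> 'cV[R]_m).

(** The data are indexed from 1, the sequences of the previous parts from 0. *)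
Definition observation (t : nat) : set_system Omega :=
  preimage_set_system setT (Z t.+1%:Z) (@mx_borel R m 1).

Lemma mx_borel_coord (i : 'I_m) (S : set R) : measurable S ->
  @mx_borel R m 1 [set A | S (A i 0)].
Proof.
move=> mS; apply: sub_gen_smallest; exists (i, 0) => //.
by exists S => //; rewrite setTI.
Qed.

Lemma random_vector_coord (V : Omega -> 'cV[R]_m) (i : 'I_m) :
  random_vector V -> measurable_fun setT (fun w => V w i 0).
Proof.
by move=> rV _ S mS; rewrite setTI; apply: (rV [set A | S (A i 0)]);
  exact: mx_borel_coord.
Qed.

Lemma random_vectorP (V : Omega -> 'cV[R]_m) :
  (forall i, measurable_fun setT (fun w => V w i 0)) -> random_vector V.
Proof.
move=> mV; rewrite /random_vector => B.
apply: (@smallest_sub _ _ _ [set B | measurable (V @^-1` B)]).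
  split=> /=; first by rewrite preimage_set0.
  - by move=> A mA; rewrite setTD preimage_setC; exact: measurableC.
  - by move=> A mA; rewrite preimage_bigcup; exact: bigcup_measurable.
move=> A [[i j] _ [S mS <-]] /=; rewrite setTI (ord1 j).
by have := mV i measurableT S mS; rewrite setTI.
Qed.

Context (rZ : forall t, random_vector (Z t)).

Lemma observation_measurable t : observation t `<=` measurable.
Proof. by move=> _ [B mB <-]; rewrite setTI; exact: rZ. Qed.

Lemma known_observation t (i : 'I_m) :
  known observation [set t] (fun w => Z t.+1%:Z w i 0).
Proof.
move=> _ S mS; rewrite setTI; apply: sub_gen_smallest; exists t => //.
by exists [set A | S (A i 0)]; [exact: mx_borel_coord|rewrite setTI].
Qed.

(** The past ends at time k and the future starts at time k + l + 1, so it is the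
coefficient of order l + 1 that is available; this covers l = 0 as well. *)
Lemma observation_alpha_mixing (c g : R) : 0 <= c -> 0 <= g ->
  (forall (t : int) (n : nat), (0 < n)%N ->
    (beta_mixing P Z t n <= (2 * expR (- c * n%:R `^ g))%:E)%E) ->
  alpha_mixing P observation (fun l => expR (- (c * l%:R `^ g))).
Proof.
move=> c0 g0 hb k l A B hA hB.
have sub I (S : set int) : (forall t, I t -> S t.+1%:Z) ->
    <<s \bigcup_(t in I) observation t >> `<=` sigma_process Z S.
  move=> IS; apply: smallest_sub; first exact: smallest_sigma_algebra.
  move=> C [t It oC]; apply: sub_gen_smallest; exists t.+1%:Z => //.
  exact: IS.
have sM (S : set int) : sigma_process Z S `<=` measurable.
  apply: smallest_sub; first exact: sigma_algebra_measurable.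
  by move=> C [t _ [D mD <-]]; rewrite setTI; exact: rZ.
have sC (S : set int) C : sigma_process Z S C -> sigma_process Z S (~` C).
  exact: sigma_algebraC.
apply: (@le_trans _ _ (expR (- (c * l.+1%:R `^ g)))); last first.
  rewrite ler_expR lerN2 ler_wpM2l// ge0_ler_powR ?nnegrE//.
  by rewrite ler_nat.
apply: (@beta_dep_alpha _ _ _ _ (sigma_process Z [set s | s <= k%:Z])
  (sigma_process Z [set s | k%:Z + l.+1%:Z <= s])); do ?exact: sM; do ?exact: sC.
- exact: expR_ge0.
- by have := hb k%:Z l.+1 isT; rewrite mulNr.
- by apply: (sub [set t | (t < k)%N]) hA => t /=.
- apply: (sub [set t | (k + l <= t)%N]) hB => t /= kt.
  by rewrite -PoszD lez_nat addnS ltnS.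
Qed.

End vector_process.

(** * Projections of subweibull vectors *)
Section euclidean.
Context {R : realType}.

Lemma l2norm_ge0 n (v : 'cV[R]_n) : 0 <= l2norm v.
Proof. exact: sqrtr_ge0. Qed.

Lemma sqr_l2norm n (v : 'cV[R]_n) : l2norm v ^+ 2 = \sum_i v i 0 ^+ 2.
Proof. by rewrite sqr_sqrtr// sumr_ge0// => i _; exact: sqr_ge0. Qed.

Lemma l2normZ n (a : R) (v : 'cV[R]_n) : l2norm (a *: v) = `|a| * l2norm v.
Proof.
rewrite /l2norm -sqrtr_sqr -sqrtrM ?sqr_ge0//; congr Num.sqrt.
by rewrite mulr_sumr; apply: eq_bigr => i _; rewrite mxE exprMn.
Qed.

Lemma l2norm_eq0 n (v : 'cV[R]_n) : l2norm v = 0 -> v = 0.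
Proof.
move=> v0; have := sqr_l2norm v; rewrite v0 expr0n/= => /esym/eqP.
rewrite psumr_eq0; last by move=> i _; exact: sqr_ge0.
move=> /allP h; apply/matrixP => i j; rewrite (ord1 j) mxE.
by apply/eqP; rewrite -sqrf_eq0; exact: (implyP (h i (mem_index_enum i))).
Qed.

Lemma l2norm_delta n (i : 'I_n) : l2norm (delta_mx i 0 : 'cV[R]_n) = 1.
Proof.
rewrite /l2norm (bigD1 i)//= mxE !eqxx expr1n big1 ?addr0 ?sqrtr1//.
by move=> j ji; rewrite mxE (negbTE ji) expr0n.
Qed.

Lemma norm_coord_le n (v : 'cV[R]_n) i : `|v i 0| <= l2norm v.
Proof.
rewrite -sqrtr_sqr ler_wsqrtr// (bigD1 i)//= lerDl sumr_ge0// => j _.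
exact: sqr_ge0.
Qed.

(** A column is the image of a unit vector. *)
Lemma l2norm_col_le_opnorm m n (A : 'M[R]_(m, n)) (j : 'I_n) :
  l2norm (col j A) <= opnorm A.
Proof.
apply: ub_le_sup; last by exists (delta_mx j 0); [exact: l2norm_delta|rewrite colE].
exists (Num.sqrt (\sum_i (\sum_k `|A i k|) ^+ 2)) => _ [v v1 <-].
rewrite ler_wsqrtr//; apply: ler_sum => i _.
rewrite -real_normK ?num_real// lerXn2r ?nnegrE ?sumr_ge0//.
rewrite mxE (le_trans (ler_norm_sum _ _ _))//; apply: ler_sum => k _.
by rewrite normrM ler_piMr// (le_trans (norm_coord_le _ _))// v1.
Qed.

End euclidean.

Section vector_moments.
Context {R : realType} d (Omega : measurableType d) (P : probability Omega R).

Lemma projZ m (a : R) (v : 'cV[R]_m) (V : Omega -> 'cV[R]_m) w :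
  Defs.proj (a *: v) V w = a * Defs.proj v V w.
Proof. by rewrite /Defs.proj linearZ/= -scalemxAl mxE. Qed.

Lemma proj_delta m (i : 'I_m) (V : Omega -> 'cV[R]_m) w :
  Defs.proj (delta_mx i 0) V w = V w i 0.
Proof.
rewrite /Defs.proj mxE (bigD1 i)//= mxE mxE !eqxx mul1r big1 ?addr0// => j ji.
by rewrite !mxE (negbTE ji) mul0r.
Qed.

Lemma measurable_proj m (v : 'cV[R]_m) (V : Omega -> 'cV[R]_m) :
  random_vector V -> measurable_fun setT (Defs.proj v V).
Proof.
move=> rV; rewrite (_ : Defs.proj v V = fun w => \sum_i v i 0 * V w i 0).
  apply: measurable_sum => i; apply: measurable_funM => //.
  exact: random_vector_coord.
by apply/funext => w; rewrite /Defs.proj mxE; apply: eq_bigr => i _; rewrite mxE.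
Qed.

(** The norm speaks of unit vectors; the other directions follow by homogeneity,
the zero vector being trivial. *)
Lemma psi_vnorm_moment m (g K : R) (V : Omega -> 'cV[R]_m) (v : 'cV[R]_m) (r : R) :
  random_vector V -> (psi_vnorm P g V <= K%:E)%E -> 1 <= r ->
  (\int[P]_w (`|Defs.proj v V w| `^ r)%:E <= ((K * l2norm v * r `^ g^-1) `^ r)%:E)%E.
Proof.
move=> rV hK r1; have r0 : 0 < r by exact: lt_le_trans r1.
have [v0|v0] := eqVneq (l2norm v) 0.
  rewrite v0 mulr0 mul0r powR0 ?gt_eqF//.
  rewrite (l2norm_eq0 v0); under eq_integral => w _.
    by rewrite /Defs.proj trmx0 mul0mx mxE normr0 powR0 ?gt_eqF//; over.
  by rewrite integral0.
have vpos : 0 < l2norm v by rewrite lt0r v0 l2norm_ge0.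
pose u := (l2norm v)^-1 *: v.
have u1 : l2norm u = 1.
  by rewrite l2normZ ger0_norm ?invr_ge0 ?l2norm_ge0// mulVf.
have vE : v = l2norm v *: u by rewrite scalerA mulfV// scale1r.
have rg0 : 0 < r `^ g^-1 by rewrite powR_gt0.
have hL : ('N[P]_r%:E[EFin \o Defs.proj u V] <= (K * r `^ g^-1)%:E)%E.
  have : ('N[P]_r%:E[EFin \o Defs.proj u V] * (r `^ (- g^-1))%:E <= K%:E)%E.
    apply: le_trans hK; apply: (@le_trans _ _ (psi_norm P g (Defs.proj u V))).
      by apply: ereal_sup_ubound; exists r.
    by apply: ereal_sup_ubound; exists u.
  rewrite powRN; have := Lnorm_ge0 P r%:E (EFin \o Defs.proj u V).
  case: ('N[P]_r%:E[_])%E => [y| |]//=.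
    by rewrite -EFinM !lee_fin => _; rewrite ler_pdivrMr.
  by rewrite gt0_mulye ?leye_eq// lte_fin invr_gt0.
have hu : (\int[P]_w (`|Defs.proj u V w| `^ r)%:E <= ((K * r `^ g^-1) `^ r)%:E)%E.
  have -> : (\int[P]_w (`|Defs.proj u V w| `^ r)%:E =
      \int[P]_w (`|(EFin \o Defs.proj u V) w| `^ r))%E.
    by apply: eq_integral.
  rewrite -(@powR_Lnorm _ _ _ P) ?gt_eqF// -poweR_EFin.
  have K0 : (0 <= (K * r `^ g^-1)%:E)%E by exact: le_trans (Lnorm_ge0 _ _ _) hL.
  apply: gt0_ler_poweR; rewrite ?in_itv/= ?Lnorm_ge0 ?K0 ?leey//.
  exact: ltW.
have vw w : (`|Defs.proj v V w| `^ r)%:E =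
    ((l2norm v `^ r)%:E * (`|Defs.proj u V w| `^ r)%:E)%E.
  rewrite {1}vE projZ normrM powRM// ger0_norm ?l2norm_ge0//.
under eq_integral do rewrite vw.
have mpu : measurable_fun setT (fun w => (`|Defs.proj u V w| `^ r)%:E).
  apply/measurable_EFinP; apply: (measurableT_comp (measurable_powR _)).
  by apply: measurableT_comp => //; exact: measurable_proj.
rewrite ge0_integralZl//=; last by rewrite lee_fin powR_ge0.
apply: (@le_trans _ _ ((l2norm v `^ r)%:E * ((K * r `^ g^-1) `^ r)%:E)%E).
  by rewrite lee_wpmul2l ?lee_fin ?powR_ge0.
rewrite -EFinM lee_fin -powRM ?l2norm_ge0//.
  by rewrite mulrCA mulrA.
have : (0 <= (K * r `^ g^-1)%:E)%E by exact: le_trans (Lnorm_ge0 _ _ _) hL.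
by rewrite lee_fin.
Qed.

Lemma psi_vnorm_ge0 m (g K : R) (V : Omega -> 'cV[R]_m) :
  (0 < m)%N -> (psi_vnorm P g V <= K%:E)%E -> 0 <= K.
Proof.
move=> m0 hK; rewrite -lee_fin; apply: le_trans hK.
pose v : 'cV[R]_m := delta_mx (Ordinal m0) 0.
have h1 : (psi_norm P g (Defs.proj v V) <= psi_vnorm P g V)%E.
  by apply: ereal_sup_ubound; exists v => //; exact: l2norm_delta.
have h2 : ('N[P]_1[EFin \o Defs.proj v V] * (1 `^ (- g^-1))%:E <=
    psi_norm P g (Defs.proj v V))%E.
  by apply: ereal_sup_ubound; exists 1; rewrite //= lexx.
apply: le_trans h1; apply: le_trans h2.
by rewrite mule_ge0 ?Lnorm_ge0// lee_fin powR_ge0.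
Qed.

End vector_moments.

(** * The regression residuals *)
Section regression.
Context {R : realType}.

Definition resid d (Omega : measurableType d) p q (X : Omega -> 'cV[R]_p)
    (Y : Omega -> 'cV[R]_q) (Theta : 'M[R]_(p, q)) (j : 'I_q) (w : Omega) : R :=
  Y w j 0 - Defs.proj (col j Theta) X w.

Lemma residE d (Omega : measurableType d) p q (X : Omega -> 'cV[R]_p)
    (Y : Omega -> 'cV[R]_q) (Theta : 'M[R]_(p, q)) (j : 'I_q) (w : Omega) :
  (Y w - Theta^T *m X w) j 0 = resid X Y Theta j w.
Proof.
rewrite !mxE /resid /Defs.proj mxE; congr (_ - _); apply: eq_bigr => k _.
by rewrite !mxE.
Qed.

Lemma measurable_resid d (Omega : measurableType d) p q (X : Omega -> 'cV[R]_p)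
    (Y : Omega -> 'cV[R]_q) (Theta : 'M[R]_(p, q)) (j : 'I_q) :
  random_vector X -> random_vector Y -> measurable_fun setT (resid X Y Theta j).
Proof.
move=> rX rY; apply: measurable_funB; first exact: random_vector_coord.
exact: measurable_proj.
Qed.

(** Let x, y and v be |X_i|, |Y_j| and |(Theta' X)_j| divided by constants for
which all three have exponential moments of order g. The normalised product is
at most x max(y, v), and its power g / 2 is at most the largest of x^g, y^g and
v^g. Hence its exponential is at most the sum of three exponentials, each of
mean at most 4. The term KX of the normalisation is shared equally between the
constants of Y_j and (Theta' X)_j, so that neither of them vanishes. *)
Lemma product_exp_moment (g : R) : 0 < g -> exists2 k1 : R, 0 < k1 &
  forall d (Omega : measurableType d) (P : probability Omega R) p q
    (X : Omega -> 'cV[R]_p) (Y : Omega -> 'cV[R]_q) (Theta : 'M[R]_(p, q))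
    (KX KY : R) (i : 'I_p) (j : 'I_q),
  random_vector X -> random_vector Y -> 0 < KX -> 0 <= KY ->
  (psi_vnorm P g X <= KX%:E)%E -> (psi_vnorm P g Y <= KY%:E)%E ->
  (\int[P]_w (expR (k1 * (`|X w i 0 * resid X Y Theta j w| /
     (KX * (KY + KX * (1 + opnorm Theta)))) `^ (g / 2)))%:E <= 12%:E)%E.
Proof.
move=> g0; have [k1 [k10 mom]] := exp_moment g0.
exists k1 => // d Omega P p q X Y Theta KX KY i j rX rY KX0 KY0 hX hY.
set op := opnorm Theta.
have opc : l2norm (col j Theta) <= op by exact: l2norm_col_le_opnorm.
have op0 : 0 <= op by exact: le_trans (l2norm_ge0 _) opc.
pose K1 := KY + KX / 2; pose K2 := KX * (2^-1 + op).
have K10 : 0 < K1 by rewrite ltr_wpDl// divr_gt0.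
have K20 : 0 < K2 by rewrite mulr_gt0// ltr_wpDr// invr_gt0.
have KS0 : 0 < KX * (K1 + K2) := mulr_gt0 KX0 (addr_gt0 K10 K20).
have KE : KY + KX * (1 + op) = K1 + K2 by rewrite /K1 /K2; field.
have mX : measurable_fun setT (fun w => X w i 0) by exact: random_vector_coord.
have mY : measurable_fun setT (fun w => Y w j 0) by exact: random_vector_coord.
have mZ : measurable_fun setT (Defs.proj (col j Theta) X) by exact: measurable_proj.
have mE (V : Omega -> R) (K : R) : measurable_fun setT V ->
    measurable_fun setT (fun w => (expR (k1 * (`|V w| / K) `^ g))%:E).
  move=> mV; apply/measurable_EFinP; apply: (measurableT_comp (@measurable_expR R)).
  apply: measurable_funM => //; apply: (measurableT_comp (measurable_powR _)).
  by apply: measurable_funM => //; exact: measurableT_comp.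
have eX : (\int[P]_w (expR (k1 * (`|X w i 0| / KX) `^ g))%:E <= 4%:E)%E.
  apply: mom => // r r1.
  have := psi_vnorm_moment (delta_mx i 0) rX hX r1.
  rewrite l2norm_delta mulr1; apply: le_trans.
  by under eq_integral do rewrite -(proj_delta i).
have mono (x y r : R) : 0 <= x -> x <= y -> 1 <= r ->
    (((x * r `^ g^-1) `^ r)%:E <= ((y * r `^ g^-1) `^ r)%:E)%E.
  move=> x0 xy r1; rewrite lee_fin ge0_ler_powR ?nnegrE ?mulr_ge0 ?powR_ge0//.
  - exact: le_trans r1.
  - exact: le_trans xy.
  - by rewrite ler_wpM2r ?powR_ge0.
have eY : (\int[P]_w (expR (k1 * (`|Y w j 0| / K1) `^ g))%:E <= 4%:E)%E.
  apply: mom => // r r1.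
  have := psi_vnorm_moment (delta_mx j 0) rY hY r1.
  rewrite l2norm_delta mulr1 => h; apply: le_trans (mono KY K1 r KY0 _ r1).
    apply: le_trans h.
    by under eq_integral do rewrite -(proj_delta j).
  by rewrite lerDl divr_ge0// ltW.
have eZ : (\int[P]_w (expR (k1 * (`|Defs.proj (col j Theta) X w| / K2) `^ g))%:E
    <= 4%:E)%E.
  apply: mom => // r r1.
  have h := psi_vnorm_moment (col j Theta) rX hX r1.
  apply: (le_trans h); apply: mono => //; first by rewrite mulr_ge0 ?l2norm_ge0// ltW.
  by rewrite ler_pM2l// (le_trans opc)// lerDr invr_ge0.
pose F w := (expR (k1 * (`|X w i 0| / KX) `^ g))%:E.
pose G w := (expR (k1 * (`|Y w j 0| / K1) `^ g))%:E.
pose H w := (expR (k1 * (`|Defs.proj (col j Theta) X w| / K2) `^ g))%:E.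
have mF : measurable_fun setT F by exact: mE.
have mG : measurable_fun setT G by exact: mE.
have mH : measurable_fun setT H by exact: mE.
have e0 (x : R) : (0 <= (expR x)%:E)%E by rewrite lee_fin expR_ge0.
have F0 w : setT w -> (0 <= F w)%E by move=> _; exact: e0.
have G0 w : setT w -> (0 <= G w)%E by move=> _; exact: e0.
have H0 w : setT w -> (0 <= H w)%E by move=> _; exact: e0.
rewrite KE.
pose Q w := (expR (k1 * (`|X w i 0 * resid X Y Theta j w| / (KX * (K1 + K2)))
  `^ (g / 2)))%:E.
have Q0 w : setT w -> (0 <= Q w)%E by move=> _; exact: e0.
have mQ : measurable_fun setT Q.
  apply/measurable_EFinP; apply: (measurableT_comp (@measurable_expR R)).
  apply: measurable_funM => //; apply: (measurableT_comp (measurable_powR _)).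
  apply: measurable_funM => //; apply: measurableT_comp => //.
  by apply: measurable_funM => //; exact: measurable_resid.
have QFGH w : setT w -> (Q w <= F w + (G w + H w))%E.
  move=> _; rewrite /Q /F /G /H -!EFinD lee_fin.
  set x := `|X w i 0| / KX; set y := `|Y w j 0| / K1.
  set v := `|Defs.proj (col j Theta) X w| / K2.
  have x0 : 0 <= x by rewrite divr_ge0// ltW.
  have y0 : 0 <= y by rewrite divr_ge0// ltW.
  have v0 : 0 <= v by rewrite divr_ge0// ltW.
  pose u := Num.max y v.
  have u0 : 0 <= u by rewrite le_max y0.
  have xu : `|X w i 0 * resid X Y Theta j w| / (KX * (K1 + K2)) <= x * u.
    have -> : x * u = `|X w i 0| * (u * (K1 + K2)) / (KX * (K1 + K2)).
      rewrite /x; move: (K1 + K2) (addr_gt0 K10 K20) => S S0.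
      by field; rewrite !gt_eqF.
    rewrite ler_pM2r ?invr_gt0// normrM ler_wpM2l//.
    rewrite /resid (le_trans (ler_normB _ _))// mulrDr; apply: lerD.
      have -> : `|Y w j 0| = y * K1 by rewrite /y mulfVK// gt_eqF.
      by rewrite ler_pM2r// le_max lexx.
    have -> : `|Defs.proj (col j Theta) X w| = v * K2 by rewrite /v mulfVK// gt_eqF.
    by rewrite ler_pM2r// le_max lexx orbT.
  have g20 : 0 <= g / 2 by rewrite divr_ge0// ltW.
  have half (s : R) : 0 <= s -> (s `^ (g / 2)) ^+ 2 = s `^ g.
    by move=> s0; rewrite -powR_mulrn ?powR_ge0// -powRrM divfK.
  have pow2 : (`|X w i 0 * resid X Y Theta j w| / (KX * (K1 + K2))) `^ (g / 2) <=
      Num.max (x `^ g) (u `^ g).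
    apply: (@le_trans _ _ ((x * u) `^ (g / 2))).
      apply: ge0_ler_powR => //; rewrite nnegrE; last exact: mulr_ge0.
      exact: divr_ge0 (ltW KS0).
    rewrite powRM// -(half x)// -(half u)//.
    have a0 := powR_ge0 x (g / 2); have b0 := powR_ge0 u (g / 2).
    rewrite le_max; case: (leP (x `^ (g / 2)) (u `^ (g / 2))) => h.
      by apply/orP; right; rewrite expr2 ler_wpM2r.
    by apply/orP; left; rewrite expr2 ler_wpM2l// ltW.
  have max3 : Num.max (x `^ g) (u `^ g) \in [:: x `^ g; y `^ g; v `^ g].
    rewrite !inE /u !maxEle; case: ifP => _; last by rewrite eqxx.
    by case: ifP => _; rewrite eqxx ?orbT.
  have e1 (s : R) : 0 <= expR s by exact: expR_ge0.
  have le_max_exp : expR (k1 * (`|X w i 0 * resid X Y Theta j w| /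
      (KX * (K1 + K2))) `^ (g / 2)) <= expR (k1 * Num.max (x `^ g) (u `^ g)).
    by rewrite ler_expR ler_pM2l.
  apply: (le_trans le_max_exp); move: max3; rewrite !inE => /or3P[] /eqP ->.
  - by rewrite lerDl addr_ge0.
  - by rewrite addrCA lerDl addr_ge0.
  - by rewrite addrA lerDr addr_ge0.
have eF : (\int[P]_w F w <= 4%:E)%E by exact: eX.
have eG : (\int[P]_w G w <= 4%:E)%E by exact: eY.
have eH : (\int[P]_w H w <= 4%:E)%E by exact: eZ.
rewrite -[X in (X <= _)%E]/(\int[P]_w Q w)%E.
clearbody Q F G H; clear eX eY eZ.
have GH0 w : setT w -> (0 <= G w + H w)%E by move=> Tw; rewrite adde_ge0 ?G0 ?H0.
have mGH : measurable_fun setT (fun w => G w + H w)%E by exact: emeasurable_funD.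
apply: (@le_trans _ _ (\int[P]_w (F w + (G w + H w)))%E).
  by apply: ge0_le_integral => //; exact: emeasurable_funD.
rewrite (ge0_integralD P measurableT F0 mF GH0 mGH).
rewrite (ge0_integralD P measurableT G0 mG H0 mH).
have -> : 12%:E = (4%:E + (4%:E + 4%:E))%E :> \bar R.
  by rewrite -!EFinD; congr EFin; ring.
by rewrite leeD// leeD.
Qed.

Section orthogonality.
Context d (Omega : measurableType d) (P : probability Omega R) (p q : nat).
Context (X : Omega -> 'cV[R]_p) (Y : Omega -> 'cV[R]_q) (Theta : 'M[R]_(p, q)).
Context (g KX KY : R) (rX : random_vector X) (rY : random_vector Y).
Context (hX : (psi_vnorm P g X <= KX%:E)%E) (hY : (psi_vnorm P g Y <= KY%:E)%E).

Let square_integrable m (V : Omega -> 'cV[R]_m) K (v : 'cV[R]_m) :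
  random_vector V -> (psi_vnorm P g V <= K%:E)%E ->
  P.-integrable setT (EFin \o (fun w => Defs.proj v V w ^+ 2)).
Proof.
move=> rV hV; have mv := measurable_proj v rV.
have m2 : measurable_fun setT (fun w => Defs.proj v V w ^+ 2).
  exact: measurable_funX.
apply/integrableP; split; first exact/measurable_EFinP.
have := psi_vnorm_moment v rV hV (ler1n _ 2); set Q := (_ `^ _)%:E => h.
apply: (@le_lt_trans _ _ Q); last exact: ltry.
apply: le_trans h; rewrite le_eqVlt; apply/orP; left; apply/eqP.
apply: eq_integral => w _ /=; rewrite powR_mulrn// normrX.
by [].
Qed.

Lemma integrable_coord2 (i : 'I_p) :
  P.-integrable setT (EFin \o (fun w => X w i 0 ^+ 2)).
Proof.
have := square_integrable (delta_mx i 0) rX hX.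
by under eq_fun do rewrite proj_delta.
Qed.

Let dominated (f h : Omega -> R) : measurable_fun setT f ->
  P.-integrable setT (EFin \o h) -> (forall w, `|f w| <= h w) ->
  P.-integrable setT (EFin \o f).
Proof.
move=> mf ih fh; apply: (le_integrable measurableT _ _ ih).
  exact/measurable_EFinP.
by move=> w _; rewrite /= lee_fin (le_trans (fh w))// ler_norm.
Qed.

Lemma integrable_resid2 (j : 'I_q) :
  P.-integrable setT (EFin \o (fun w => resid X Y Theta j w ^+ 2)).
Proof.
pose Z := Defs.proj (col j Theta) X; pose y := Defs.proj (delta_mx j 0) Y.
have iY := square_integrable (delta_mx j 0) rY hY.
have iZ := square_integrable (col j Theta) rX hX.
have iS : P.-integrable setT (EFin \o (fun w =>
    2 * (y w ^+ 2 + Z w ^+ 2))).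
  rewrite (_ : _ \o _ = (fun w => 2%:E * ((EFin \o (fun w => (y w ^+ 2)%R)) \+
      (EFin \o (fun w => (Z w ^+ 2)%R))) w)%E).
    by apply: integrableZl => //; exact: integrableD.
  by apply/funext => w; rewrite /= -EFinD -EFinM.
apply: (dominated _ iS).
  by apply: measurable_funX; exact: measurable_resid.
move=> w; rewrite normrX real_normK ?num_real// /resid /y proj_delta -/(Z w).
set b := Y w j 0; set z := Z w; have := sqr_ge0 (b + z); rewrite !expr2; lra.
Qed.

Lemma integrable_product (i : 'I_p) (j : 'I_q) :
  P.-integrable setT (EFin \o (fun w => X w i 0 * resid X Y Theta j w)).
Proof.
have iS : P.-integrable setT (EFin \o (fun w =>
    X w i 0 ^+ 2 + resid X Y Theta j w ^+ 2)).
  rewrite (_ : _ \o _ = ((EFin \o (fun w => X w i 0 ^+ 2)%R) \+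
      (EFin \o (fun w => resid X Y Theta j w ^+ 2)%R))%E).
    by apply: integrableD => //; [exact: integrable_coord2|exact: integrable_resid2].
  by apply/funext => w; rewrite /= -EFinD.
apply: (dominated _ iS).
  apply: measurable_funM; first exact: random_vector_coord.
  exact: measurable_resid.
move=> w; set x := X w i 0; set r := resid _ _ _ _ _.
have := sqr_ge0 (x - r); have := sqr_ge0 (x + r); rewrite !expr2 => h1 h2.
by rewrite ler_norml; apply/andP; split; nra.
Qed.

Lemma l2norm_shift (e : R) (i : 'I_p) (j : 'I_q) w :
  l2norm (Y w - (Theta + e *: delta_mx i j)^T *m X w) ^+ 2 =
  l2norm (Y w - Theta^T *m X w) ^+ 2 +
  (- 2 * e * (X w i 0 * resid X Y Theta j w) + e ^+ 2 * X w i 0 ^+ 2).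
Proof.
rewrite !sqr_l2norm.
have -> : \sum_k (Y w - (Theta + e *: delta_mx i j)^T *m X w) k 0 ^+ 2 =
    \sum_k (resid X Y Theta k w - e * X w i 0 * (k == j)%:R) ^+ 2.
  apply: eq_bigr => k _; congr (_ ^+ 2).
  rewrite residE /resid -addrA -opprD; congr (_ - _).
  rewrite /Defs.proj !mxE; under eq_bigr do rewrite !mxE mulrDl.
  rewrite big_split/=; congr (_ + _); first by apply: eq_bigr => l _; rewrite !mxE.
  rewrite (bigD1 i)//= eqxx/= big1 ?addr0; last first.
    by move=> l /negbTE ->; rewrite mulr0 mul0r.
  by rewrite mulrAC.
under [in RHS]eq_bigr do rewrite residE.
rewrite (bigD1 j)//= [in RHS](bigD1 j)//= eqxx mulr1.
have -> : \sum_(k | k != j) (resid X Y Theta k w - e * X w i 0 * (k == j)%:R) ^+ 2 =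
    \sum_(k | k != j) resid X Y Theta k w ^+ 2.
  by apply: eq_bigr => k /negbTE ->; rewrite mulr0 subr0.
ring.
Qed.

(** Moving the entry (i, j) of Theta by e changes the risk by - 2 e A + e^2 B, with
A the integral in question and B the second moment of X_i; as this is nonnegative
for every e, A vanishes. *)
Lemma target_orthogonal (i : 'I_p) (j : 'I_q) :
  (forall Theta' : 'M[R]_(p, q),
    \int[P]_w (l2norm (Y w - Theta^T *m X w) ^+ 2)%:E <=
    \int[P]_w (l2norm (Y w - Theta'^T *m X w) ^+ 2)%:E)%E ->
  (\int[P]_w (X w i 0 * resid X Y Theta j w)%:E = 0)%E.
Proof.
move=> opt; have iX := integrable_coord2 i; have iXW := integrable_product i j.
pose S w := l2norm (Y w - Theta^T *m X w) ^+ 2.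
have iS : P.-integrable setT (EFin \o S).
  rewrite (_ : _ \o _ = (fun w => \sum_(k < q)
      ((EFin \o (fun w => resid X Y Theta k w ^+ 2)%R) w))%E).
    by apply: integrable_sum => // k _; exact: integrable_resid2.
  apply/funext => w; rewrite /= /S sqr_l2norm sumEFin; congr EFin.
  by apply: eq_bigr => k _; rewrite residE.
pose A := \int[P]_w (X w i 0 * resid X Y Theta j w).
pose B := \int[P]_w (X w i 0 ^+ 2).
have B0 : 0 <= B by apply: Rintegral_ge0 => w _; exact: sqr_ge0.
have key e : 0 <= - 2 * e * A + e ^+ 2 * B.
  pose h w := - 2 * e * (X w i 0 * resid X Y Theta j w) + e ^+ 2 * X w i 0 ^+ 2.
  have i1 : P.-integrable setT (EFin \o (fun w =>
      - 2 * e * (X w i 0 * resid X Y Theta j w))).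
    rewrite (_ : _ \o _ = (fun w => (- 2 * e)%:E *
      (EFin \o (fun w => X w i 0 * resid X Y Theta j w)%R) w)%E).
      exact: integrableZl.
    by apply/funext => w; rewrite /= -EFinM.
  have i2 : P.-integrable setT (EFin \o (fun w => e ^+ 2 * X w i 0 ^+ 2)).
    rewrite (_ : _ \o _ = (fun w => (e ^+ 2)%:E *
      (EFin \o (fun w => X w i 0 ^+ 2)%R) w)%E).
      exact: integrableZl.
    by apply/funext => w; rewrite /= -EFinM.
  have ih : P.-integrable setT (EFin \o h).
    rewrite (_ : _ \o _ = ((EFin \o (fun w =>
        - 2 * e * (X w i 0 * resid X Y Theta j w))%R) \+
        (EFin \o (fun w => e ^+ 2 * X w i 0 ^+ 2)%R))%E).
      exact: integrableD.
    by apply/funext => w; rewrite /= -EFinD.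
  have hE : \int[P]_w h w = - 2 * e * A + e ^+ 2 * B.
    by rewrite /h RintegralD// !RintegralZl.
  rewrite -hE; have := opt (Theta + e *: delta_mx i j).
  have -> : (\int[P]_w (l2norm (Y w - (Theta + e *: delta_mx i j)^T *m X w) ^+ 2)%:E
      = \int[P]_w ((EFin \o S) w + (EFin \o h) w))%E.
    by apply: eq_integral => w _; rewrite l2norm_shift /= -EFinD.
  rewrite integralD//= -/(S _).
  have fS : (\int[P]_w (S w)%:E)%E \is a fin_num by exact: integrable_fin_num.
  have fh : (\int[P]_w (h w)%:E)%E \is a fin_num by exact: integrable_fin_num.
  rewrite -[X in (X <= X + _)%E]fineK// -[X in (_ + X)%E]fineK// -EFinD lee_fin.
  by rewrite lerDl.
have A0 : A = 0.
  apply/eqP; rewrite -sqrf_eq0 eq_le sqr_ge0 andbT.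
  have B1 : 0 < B + 1 by rewrite ltr_wpDl.
  (* The minimizer A / B is unavailable if B vanishes. *)
  have := key (A / (B + 1)).
  have -> : - 2 * (A / (B + 1)) * A + (A / (B + 1)) ^+ 2 * B =
      - (A ^+ 2 * (B + 2) / (B + 1) ^+ 2) by field; rewrite gt_eqF.
  rewrite oppr_ge0 pmulr_lle0 ?invr_gt0 ?exprn_gt0// pmulr_lle0//.
  by rewrite ltr_wpDl.
rewrite -[LHS]fineK; last exact: integrable_fin_num.
by move: A0; rewrite /A /Rintegral => ->.
Qed.

End orthogonality.
End regression.

(** * The entries of the cross product *)
Section events.
Context {R : realType} d (Omega : measurableType d) (P : probability Omega R).

Lemma union_bound (I : finType) (E : set Omega) (A : I -> set Omega) :
  measurable E -> (forall i, measurable (A i)) ->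
  (forall w, E w -> exists i, A i w) ->
  fine (P E) <= \sum_i mean P (\1_(A i)).
Proof.
move=> mE mA EA; rewrite -mean_indic// -mean_sum; last first.
  by move=> i _; exact: bmeas_indic.
apply: le_mean; [exact: bmeas_indic|by apply: bmeas_sum => i _; exact: bmeas_indic|].
move=> w; rewrite indicE; case: (boolP (w \in E)) => [|_]; last first.
  by apply: sumr_ge0 => i _; rewrite indicE.
rewrite inE => /EA[i Ai]; rewrite (bigD1 i)//= indicE mem_set// lerDl.
by apply: sumr_ge0 => j _; rewrite indicE.
Qed.

Lemma psi_vnorm0_null m (g : R) (V : Omega -> 'cV[R]_m) (i : 'I_m) :
  random_vector V -> (psi_vnorm P g V <= 0%:E)%E ->
  mean P (\1_[set w | 0 < `|V w i 0|]) = 0.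
Proof.
move=> rV hV; have mV := random_vector_coord i rV.
have mnV : measurable_fun setT (fun w => `|V w i 0|) by exact: measurableT_comp.
have mA : measurable [set w | 0 < `|V w i 0|] by exact: measurable_gt.
have V0 : (\int[P]_w `|(V w i 0)%:E| = 0)%E.
  apply/eqP; rewrite eq_le integral_ge0// andbT.
  have := psi_vnorm_moment (delta_mx i 0) rV hV (lexx 1).
  rewrite mul0r mul0r powRr1//; apply: le_trans.
  rewrite le_eqVlt; apply/orP; left; apply/eqP; apply: eq_integral => w _.
  by rewrite proj_delta powRr1.
have : ae_eq P setT (fun w => (V w i 0)%:E) (cst 0%E).
  by apply/(ae_eq_integral_abs P measurableT) => //; exact/measurable_EFinP.
move=> /negligibleS h.
have negl : P.-negligible [set w | 0 < `|V w i 0|].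
  by apply: h => w /= V1 /(_ I)[] V2; move: V1; rewrite V2 normr0 ltxx.
by rewrite mean_indic// ((negligibleP P mA).1 negl).
Qed.

End events.

Section maximal_entry.
Context {R : realType} d (Omega : measurableType d) (P : probability Omega R).
Context p q (X : int -> Omega -> 'cV[R]_p) (Y : int -> Omega -> 'cV[R]_q).
Context (Theta : 'M[R]_(p, q)) (T : nat).
Context (rX : forall t, random_vector (X t)) (rY : forall t, random_vector (Y t)).

Definition cross (i : 'I_p) (j : 'I_q) (t : nat) (w : Omega) : R :=
  X t.+1%:Z w i 0 * resid (X t.+1%:Z) (Y t.+1%:Z) Theta j w.

Lemma cross_sumE i j w :
  ((data_mx X T w)^T *m residuals X Y Theta T w) i j =
  \sum_(t < T) cross i j t w.
Proof.
rewrite mxE; apply: eq_bigr => t _; rewrite !mxE; congr (_ * (_ - _)).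
rewrite /Defs.proj mxE; apply: eq_bigr => k _; rewrite !mxE mulrC.
by [].
Qed.

Lemma measurable_cross i j t : measurable_fun setT (cross i j t).
Proof.
apply: measurable_funM; first exact: random_vector_coord.
exact: measurable_resid.
Qed.

Lemma exceed_maxP (y : R) w : 0 <= y ->
  y < T%:R^-1 * mx_norm ((data_mx X T w)^T *m residuals X Y Theta T w) <->
  exists ij : 'I_p * 'I_q,
    y < T%:R^-1 * `|\sum_(t < T) cross ij.1 ij.2 t w|.
Proof.
move=> y0; set M := _ *m _; split=> [yM|[[i j] /= yM]].
  have Mn0 : mx_norm M != 0.
    by apply/eqP => M0; move: yM; rewrite M0 mulr0 ltNge y0.
  have [ij Mij] := mx_norm_neq0 Mn0; exists ij.
  by move: yM; rewrite Mij cross_sumE.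
apply: (lt_le_trans yM); rewrite ler_wpM2l ?invr_ge0// -cross_sumE -/M.
rewrite [leRHS]mx_normrE.
exact: (le_bigmax (0 : R) (fun ij : 'I_p * 'I_q => `|M ij.1 ij.2|) (i, j)).
Qed.

Lemma measurable_exceed (y : R) : 0 <= y ->
  measurable [set w | y < T%:R^-1 *
    mx_norm ((data_mx X T w)^T *m residuals X Y Theta T w)].
Proof.
move=> y0; rewrite [X in measurable X](_ : _ = \bigcup_(ij in setT)
    [set w | y < T%:R^-1 * `|\sum_(t < T) cross ij.1 ij.2 t w|]); last first.
  apply/seteqP; split=> w /=; first by move/(exceed_maxP w y0) => [ij h]; exists ij.
  by move=> [ij _ h]; apply/(exceed_maxP w y0); exists ij.
apply: fin_bigcup_measurable => [|ij _]; first exact: finite_finset.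
apply: measurable_gt; apply: measurable_funM => //; apply: measurableT_comp => //.
by apply: measurable_sum => t; exact: measurable_cross.
Qed.

Lemma joint_lshift t w (i : 'I_p) : joint X Y t w (lshift q i) 0 = X t w i 0.
Proof. exact: col_mxEu. Qed.

Lemma joint_rshift t w (j : 'I_q) : joint X Y t w (rshift p j) 0 = Y t w j 0.
Proof. exact: col_mxEd. Qed.

Lemma random_vector_joint t : random_vector (joint X Y t).
Proof.
apply: random_vectorP => k; case: (splitP k) => [i|j] kE.
  rewrite (_ : k = lshift q i); last exact: val_inj.
  rewrite (_ : (fun w => _) = fun w => X t w i 0); first exact: random_vector_coord.
  by apply/funext => w; rewrite joint_lshift.
rewrite (_ : k = rshift p j); last exact: val_inj.
rewrite (_ : (fun w => _) = fun w => Y t w j 0); first exact: random_vector_coord.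
by apply/funext => w; rewrite joint_rshift.
Qed.

Lemma known_cross i j t : known (observation (joint X Y)) [set t] (cross i j t).
Proof.
have kX k : known (observation (joint X Y)) [set t] (fun w => X t.+1%:Z w k 0).
  rewrite (_ : (fun w => _) = fun w => joint X Y t.+1%:Z w (lshift q k) 0).
    exact: known_observation.
  by apply/funext => w; rewrite joint_lshift.
have kY : known (observation (joint X Y)) [set t] (fun w => Y t.+1%:Z w j 0).
  rewrite (_ : (fun w => _) = fun w => joint X Y t.+1%:Z w (rshift p j) 0).
    exact: known_observation.
  by apply/funext => w; rewrite joint_rshift.
have kZ : known (observation (joint X Y)) [set t]
    (Defs.proj (col j Theta) (X t.+1%:Z)).
  rewrite (_ : Defs.proj _ _ = fun w => \sum_k Theta k j * X t.+1%:Z w k 0).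
    apply: known_sum => k _.
    exact: (known_comp (mulrl_measurable (Theta k j)) (kX k)).
  by apply/funext => w; rewrite /Defs.proj mxE; apply: eq_bigr => k _; rewrite !mxE.
exact: (measurable_funM (kX i) (measurable_funB kY kZ)).
Qed.

End maximal_entry.

(** * The deviation inequality for the design *)
Section deviation.
Context {R : realType} d (Omega : measurableType d) (P : probability Omega R).
Context p q (X : int -> Omega -> 'cV[R]_p) (Y : int -> Omega -> 'cV[R]_q).
Context (KX KY g : R) (Theta : 'M[R]_(p, q)) (T : nat).
Context (rX : forall t, random_vector (X t)) (rY : forall t, random_vector (Y t)).
Context (hX : forall t, (psi_vnorm P g (X t) <= KX%:E)%E).
Context (hY : forall t, (psi_vnorm P g (Y t) <= KY%:E)%E).
Context (target : is_target P X Y Theta).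

Lemma cross_mean_zero i j t : (\int[P]_w (cross X Y Theta i j t w)%:E = 0)%E.
Proof.
apply: (target_orthogonal (rX t.+1%:Z) (rY t.+1%:Z) (hX _) (hY _)) => Theta'.
by have := target t.+1%:Z Theta'; rewrite /risk unlock.
Qed.

(** If KX = 0, normalisation by KX is impossible, but every X_t vanishes almost
surely. *)
Lemma null_design (y : R) : KX = 0 -> 0 <= y ->
  P [set w | y < T%:R^-1 * mx_norm ((data_mx X T w)^T *m
                                     residuals X Y Theta T w)] = 0%E.
Proof.
move=> KX0 y0; set E := (X in P X).
have mE : measurable E by exact: measurable_exceed.
have mX t i : measurable [set w | 0 < `|X t w i 0|].
  by apply: measurable_gt; apply: measurableT_comp => //; exact: random_vector_coord.
apply/eqP; rewrite eq_le measure_ge0 andbT -[X in (X <= _)%E]fineK ?fin_num_measure//.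
rewrite lee_fin.
have cover w : E w -> exists ti : 'I_T * 'I_p, 0 < `|X ti.1.+1%:Z w ti.2 0|.
  move=> /(exceed_maxP _ _ _ _ _ y0)[[i j] /= yw]; apply: contrapT => none.
  move: yw; rewrite big1 ?normr0 ?mulr0 ?ltNge ?y0// => t _.
  rewrite /cross; apply/eqP; rewrite mulf_eq0; apply/orP; left.
  case: eqP => // /eqP Xn0; case: none; exists (t, i) => /=.
  by rewrite normr_gt0.
have := union_bound P (I := ('I_T * 'I_p)%type)
  (A := fun ti => [set w | 0 < `|X ti.1.+1%:Z w ti.2 0|]) mE
  (fun ti => mX _ ti.2) cover.
rewrite big1// => ti _; apply: psi_vnorm0_null => //; rewrite -KX0.
exact: hX.
Qed.

End deviation.

Theorem proposition7 (R : realType) (c c' gamma1 gamma2 : R)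
    (c_gt0 : 0 < c) (c'_gt0 : 0 < c')
    (gamma1_gt0 : 0 < gamma1) (gamma2_gt0 : 0 < gamma2) :
  let gamma := (1 / gamma1 + 2 / gamma2)^-1 in
  gamma < 1 ->
  exists C1 C2 : R, [/\ 0 < C1, 0 < C2 &
    forall (d : measure_display) (Omega : measurableType d)
      (P : probability Omega R) (p q : nat)
      (X : int -> Omega -> 'cV[R]_p) (Y : int -> Omega -> 'cV[R]_q)
      (KX KY : R) (s : nat) (Theta : 'M[R]_(p, q)) (T : nat),
    (0 < p)%N -> (0 < q)%N -> (0 < T)%N ->
    (forall t, random_vector (X t)) ->
    (forall t, random_vector (Y t)) ->
    strictly_stationary P (joint X Y) ->
    (forall t, mean_zero P (X t)) ->
    (forall t, mean_zero P (Y t)) ->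
    (forall (t : int) (n : nat), (0 < n)%N ->
      (beta_mixing P (joint X Y) t n <=
         (2 * expR (- c * n%:R `^ gamma1))%:E)%E) ->
    (forall t, subweibull_vec P gamma2 (X t) /\
               (psi_vnorm P gamma2 (X t) <= KX%:E)%E) ->
    (forall t, subweibull_vec P gamma2 (Y t) /\
               (psi_vnorm P gamma2 (Y t) <= KY%:E)%E) ->
    is_target P X Y Theta ->
    sparse s Theta ->
    let K := 2 `^ (2 / gamma2) * (KY + KX * (1 + opnorm Theta)) ^+ 2 in
    C1 * ln (p * q)%:R `^ (2 / gamma - 1) <= T%:R ->
    (P [set w | (C2 * K * Num.sqrt (ln (p * q)%:R / T%:R) <
                T%:R^-1 * mx_norm ((data_mx X T w)^T *m
                                     residuals X Y Theta T w))%R] <=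
       (2 * expR (- c' * ln (p * q)%:R))%:E)%E].
Proof.
move=> gamma gamma_lt1.
have gammaE : gamma^-1 = gamma1^-1 + (gamma2 / 2)^-1.
  by rewrite /gamma invrK mul1r invf_div.
have gamma_gt0 : 0 < gamma by rewrite invr_gt0 addr_gt0// divr_gt0.
have exponents : 1 < gamma1^-1 + (gamma2 / 2)^-1 by rewrite -gammaE invf_gt1.
have [k1 k1_gt0 moment] := product_exp_moment gamma2_gt0.
have c'1_gt0 : 0 < c' + 1 by rewrite addr_gt0.
have [C1 [C2 [C1_gt0 C2_gt0 tail]]] := mixing_tail c_gt0 gamma1_gt0
  (divr_gt0 gamma2_gt0 (ltr0n _ 2)) k1_gt0 (ler1n _ 12) c'1_gt0 exponents.
exists C1, C2; split=> // d Omega P p q X Y KX KY s Theta T p_gt0 q_gt0 T_gt0.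
move=> rX rY _ _ _ mix hX' hY' target _ K; set L := ln (p * q)%:R.
rewrite [2 / gamma]mulrC gammaE mulrC => size.
have hX t := (hX' t).2; have hY t := (hY' t).2.
have pq_gt0 : (0 < p * q)%N by rewrite muln_gt0 p_gt0.
have L_ge0 : 0 <= L by rewrite ln_ge0// ler1n.
set y := C2 * K * _; pose j0 := Ordinal q_gt0.
have KX_ge0 : 0 <= KX := psi_vnorm_ge0 p_gt0 (hX 0).
have KY_ge0 : 0 <= KY := psi_vnorm_ge0 q_gt0 (hY 0).
have op_ge0 : 0 <= opnorm Theta.
  exact: le_trans (l2norm_ge0 _) (l2norm_col_le_opnorm Theta j0).
have K_ge0 : 0 <= K by rewrite mulr_ge0 ?powR_ge0 ?sqr_ge0.
have y_ge0 : 0 <= y by rewrite mulr_ge0 ?sqrtr_ge0// mulr_ge0// ltW.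
have mE := measurable_exceed Theta T rX rY y_ge0.
(* If pq = 1 the right-hand side is 2. *)
have [L0|L_neq0] := eqVneq L 0.
  rewrite L0 mulr0 expR0 mulr1 (le_trans (probability_le1 P mE))// lee_fin.
  exact: ler1n.
have L_ge_ln2 : ln 2 <= L.
  rewrite ler_ln ?posrE ?ltr0n// ler_nat ltn_neqAle pq_gt0 andbT.
  by apply: contra_neq L_neq0 => pq1; rewrite /L -pq1 ln1.
have [KX0|KX_neq0] := eqVneq KX 0.
  by rewrite (null_design _ _ rX rY hX)// lee_fin mulr_ge0 ?expR_ge0.
have KX_gt0 : 0 < KX by rewrite lt_def KX_neq0.
pose S := KY + KX * (1 + opnorm Theta).
have S_gt0 : 0 < S by rewrite ltr_wpDl// mulr_gt0// ltr_pwDl.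
pose K' := KX * S; have K'_gt0 : 0 < K' by rewrite mulr_gt0.
have K'_le : K' <= K.
  rewrite /K' /K -/S -[leLHS]mul1r ler_pM ?mulr_ge0 ?(ltW S_gt0)//.
    by rewrite -[leLHS](powRr0 2) ler_powR ?ler1n// divr_ge0// ltW.
  rewrite expr2 ler_pM2r// /S -[leLHS]add0r lerD// ler_peMr// lerDl.
  exact: op_ge0.
(* The index k runs over the entries with both signs, which turns a two-sided
   deviation into one-sided ones. *)
pose x (k : bool * ('I_p * 'I_q)) t w := (-1) ^+ k.1 / K' * cross X Y Theta k.2.1 k.2.2 t w.
have rZ t : random_vector (joint X Y t) by exact: random_vector_joint.
have mZ := @observation_measurable _ _ _ _ _ rZ.
have xk k t : known (observation (joint X Y)) [set t] (x k t).
  apply: (known_comp (mulrl_measurable ((-1) ^+ k.1 / K'))).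
  exact: known_cross.
have x_mean k t : (\int[P]_w (x k t w)%:E = 0)%E.
  rewrite /x; under eq_integral do rewrite EFinM.
  rewrite integralZl ?(cross_mean_zero rX rY hX hY target) ?mule0//.
  exact: integrable_product (hX _) (hY _) _ _.
have x_moment k t : (\int[P]_w (expR (k1 * `|x k t w| `^ (gamma2 / 2)))%:E <= 12%:E)%E.
  have := moment d Omega P p q _ _ Theta KX KY k.2.1 k.2.2 (rX t.+1%:Z)
    (rY t.+1%:Z) KX_gt0 KY_ge0 (hX _) (hY _).
  apply: le_trans; rewrite le_eqVlt; apply/orP; left; apply/eqP.
  apply: eq_integral => w _.
  have -> : `|x k t w| = `|cross X Y Theta k.2.1 k.2.2 t w| / K'; last by [].
  by rewrite /x -mulrA normrMsign mulrC normrM [`|K'^-1|]gtr0_norm ?invr_gt0.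
have x_tail k : mean P (\1_[set w | C2 * Num.sqrt (L * T%:R) < \sum_(t < T) x k t w]) <=
    expR (- ((c' + 1) * L)).
  apply: (tail _ _ P (observation (joint X Y))) => //.
  exact: observation_alpha_mixing (ltW c_gt0) (ltW gamma1_gt0) mix.
have mx k : measurable [set w | C2 * Num.sqrt (L * T%:R) < \sum_(t < T) x k t w].
  apply: measurable_gt; apply: measurable_sum => t.
  exact: (@known_measurable _ _ _ _ mZ _ _ (xk k t)).
rewrite -[X in (X <= _)%E]fineK ?fin_num_measure// lee_fin.
have cover w : y < T%:R^-1 * mx_norm ((data_mx X T w)^T *m residuals X Y Theta T w) ->
    exists k, C2 * Num.sqrt (L * T%:R) < \sum_(t < T) x k t w.
  move=> /(exceed_maxP _ _ _ _ _ y_ge0)[[i j] /=].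
  set Sum := \sum_t _ => yS; exists (Sum < 0, (i, j)).
  rewrite /x -mulr_sumr /= -/Sum.
  have -> : (-1) ^+ (Sum < 0)%R / K' * Sum = `|Sum| / K'.
    by rewrite mulrAC; congr (_ / _); rewrite normrEsign.
  rewrite ltr_pdivlMr//.
  have T_pos : 0 < T%:R :> R by rewrite ltr0n.
  have sqrtE : Num.sqrt (L * T%:R) = Num.sqrt (L / T%:R) * T%:R.
    have -> : L * T%:R = L / T%:R * T%:R ^+ 2 by field; rewrite gt_eqF.
    by rewrite sqrtrM ?divr_ge0// sqrtr_sqr gtr0_norm.
  have yT : y * T%:R < `|Sum| by move: yS; rewrite mulrC ltr_pdivlMr.
  apply: le_lt_trans yT; rewrite sqrtE /y.
  have -> : C2 * K * Num.sqrt (L / T%:R) * T%:R =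
    C2 * (Num.sqrt (L / T%:R) * T%:R) * K by ring.
  by rewrite ler_wpM2l// mulr_ge0 ?mulr_ge0 ?sqrtr_ge0// ltW.
have := union_bound P mE mx cover; move/le_trans; apply.
apply: (@le_trans _ _ (\sum_(k : bool * ('I_p * 'I_q)) expR (- ((c' + 1) * L)))).
  by apply: ler_sum => k _; exact: x_tail.
rewrite sumr_const !card_prod card_bool !card_ord.
have -> : - ((c' + 1) * L) = - c' * L - L by ring.
rewrite expRD expRN lnK ?posrE ?ltr0n// -mulr_natr natrM.
rewrite le_eqVlt; apply/orP; left; apply/eqP; field.
by rewrite !pnatr_eq0 -!lt0n q_gt0 p_gt0.
Qed.
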